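(* For every fixed $0<\delta<1/6$ and every fixed $\varepsilon>0$, there is a constant $C=C(\varepsilon,\delta)$ such that, for all $n\ge 1$ and all $H$ with $n^{1/2+\delta}\le H\le n^{2/3}$, one has $$M_4(H,n)\le C\,H n^{2+\varepsilon}.$$
   Context: Write $\mathbf{e}(x)=\exp(2\pi i x)$. The notation $x\sim X$ means $X/2\le x\le X$. For an integer $h$ define $S(h,n)=\sum_{a\sim n}\mathbf{e}(h\sqrt a)$, the sum being over integers $a$ with $n/2\le a\le n$, and define $M_4(H,n)=\sum_{h\sim H}|S(h,n)|^4$, the sum being over integers $h$ with $H/2\le h\le H$. *)

(* Defs.v *)
From HB Require Import structures.
From mathcomp Require Import all_boot all_order all_algebra.
From mathcomp Require Import archimedean complex.
From mathcomp Require Import all_classical all_reals all_analysis.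

Set Implicit Arguments.
Unset Strict Implicit.
Unset Printing Implicit Defensive.

Import Order.TTheory GRing.Theory Num.Theory.

Local Open Scope classical_set_scope.
Local Open Scope ring_scope.
Local Open Scope complex_scope.

Definition cexp (R : realType) (z : R[i]) : R[i] :=
  (expR (complex.Re z))%:C * (cos (complex.Im z) +i* sin (complex.Im z)).

Definition e (R : realType) (x : R) : R[i] := cexp (0 +i* (2 * pi * x)).

Definition dyadic (R : realType) (X : R) : set int :=
  [set a : int | X / 2 <= a%:~R <= X].

(* A sum [\sum_(i \in A) F i] is 0 by convention when [F] has infinite support
   in [A]; this lemma excludes that case in the sums below. *)
Lemma finite_dyadic (R : realType) (X : R) : finite_set (dyadic X).
Proof.
apply: (@sub_finite_set _ _ (Posz @` `I_(Num.truncn X).+1)); last first.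
  exact/finite_image/finite_II.
move=> a /= /andP[Xa aX].
have a0 : 0 <= a.
  rewrite -(ler0z R); case: (lerP 0 X) => X0.
    by apply: le_trans Xa; rewrite divr_ge0.
  have := le_trans Xa aX; rewrite ler_pdivrMr// mulr_natr mulr2n.
  by rewrite lerDl leNgt X0.
case: a a0 Xa aX => // k _ _ kX; exists k => //=.
by rewrite ltnS truncn_ge_nat ?(le_trans _ kX).
Qed.

Definition exp_sum (R : realType) (h : int) (n : R) : R[i] :=
  \sum_(a \in dyadic n) e (h%:~R * Num.sqrt a%:~R : R).

(* [Normc.normc] is the modulus with values in [R]; the generic norm on [R[i]]
   takes values in [R[i]] itself. *)
Definition M4 (R : realType) (H n : R) : R :=
  \sum_(h \in dyadic H) Normc.normc (exp_sum h n) ^+ 4.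

(* Main.v *)
Require Import Defs.
From mathcomp Require Import all_boot all_order all_algebra.
From mathcomp Require Import complex ring lra zify.
From mathcomp Require Import all_classical all_reals all_analysis.

Set Implicit Arguments.
Unset Strict Implicit.
Unset Printing Implicit Defensive.

Import Order.TTheory GRing.Theory Num.Theory numFieldNormedType.Exports.

Local Open Scope ring_scope.

(** Write [e(x) = exp(2 pi i x)], [s = sqrt n] and [M = H / s].  The hypotheses
    give [s <= H] and [H^3 <= s^4], that is [M >= 1] and [M^4 <= H].  The idea
    is to replace [S(h,n)] by a dual sum of length about [M], whose fourth power
    can be expanded and averaged over [h].

    The dual sum.  The phase [h sqrt a] has derivative [h / (2 sqrt a)], of size
    [M] on [[n/2, n]], and this derivative equals the integer [m] at the point
    [a_m = h^2 / (4 m^2)].  Cut the sum into blocks according to the integer [m]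
    nearest to the derivative.  At distance more than about [s] from [a_m] the
    derivative stays [>> H/n] away from the integers, and the Kusmin-Landau
    inequality [kusmin_landau] bounds that part of the block by [O(n/H)].  At
    distance at most about [s], expand to second order at [a_m]: the linear term
    is [m (a - a_m)], which only contributes a constant because [e(m a) = 1], so
    that [e(h sqrt a)] is close to [e(h^2/(4m)) e(-(m^3/h^2) (a - a_m)^2)]
    ([taylor_sqrt]).  In the variable [t = (a - a_m)/h] the last factor is
    [e(-m^3 t^2)], which does not involve [h]; if the length of the window is
    proportional to [h], then the window sum is a Riemann sum with step [1/h]
    of a fixed Fresnel integral over a fixed interval, and can be exchanged for
    [h c_m], where [c_m] is the Riemann sum of the same integral with a very
    small step ([riemann_cmp]).  One has [c_m = O(m^(-3/2))]
    ([dual_weight_bound]).  The [O(M)] blocks together give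
    [S(h,n) = h sum_m c_m e(h^2/(4m)) + O(s)] ([exp_sum_approx]).

    The average over [h].  For integers [m1, .., m4] the [h] for which all four
    terms are present in the dual sum form an interval.  Hence the fourth moment
    is at most [H^4 max |c_m|^4] times the sum over quadruples of
    [|sum_h e(rho h^2 / 4)|] with [rho = 1/m1 + 1/m2 - 1/m3 - 1/m4].  If [q] is
    the reduced denominator of [rho/2], then [q <= 2 M^4 <= 2 H], and Weyl
    differencing bounds the sum over [h] by [H / sqrt q] up to a logarithm
    ([weyl_bound]).

    The count.  It remains to show that the sum of [1 / sqrt q] over quadruples
    is [O(M^2 n^eps)] ([quad_sum_bound]).  Let [B] and [E] be the reduced
    denominators of [1/m1 + 1/m2] and [1/m3 + 1/m4]; by the divisor bound only
    [O(n^eps)] pairs share a given [B].  Put [t = gcd(B, E)], [B = t b],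
    [E = t b'].  Over the denominator [2 t b b'] the numerator of [rho/2] is
    prime to [b b'], so [q = b b' u] where [2 t = u g].  Since [u g b] and
    [u g b'] are at most [2 M^2], given [b], [b'] and [u] there are at most
    [2 M^2 / (u sqrt (b b'))] values of [g]; summing [1 / sqrt (b b' u)] over
    them leaves [2 M^2] times three harmonic sums.

    Altogether the moment is [O(H^4 (M^(-3/2))^4 H M^2 n^eps) = O(H n^(2+eps))],
    and the error term [O(s)] contributes [O(H s^4) = O(H n^2)]. *)

Local Notation nrm := (@Normc.normc _).

(** * The character e and the modulus *)

Section Modulus.
Variable R : realType.
Implicit Types (x y : R) (z w : R[i]).

Lemma nrm_ge0 z : 0 <= nrm z.
Proof. by case: z => a b; rewrite /Normc.normc sqrtr_ge0. Qed.

Lemma nrm_sum I (r : seq I) (P : pred I) (F : I -> R[i]) :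
  nrm (\sum_(i <- r | P i) F i) <= \sum_(i <- r | P i) nrm (F i).
Proof.
elim/big_ind2: _ => [|a b c d ab cd|//]; first by rewrite Normc.normc0.
by apply: le_trans (le_normcD _ _) _; exact: lerD.
Qed.

Lemma nrm_real x : nrm x%:C%C = `|x|.
Proof. by rewrite /= expr0n /= addr0 sqrtr_sqr. Qed.

Lemma nrm_conj z : nrm (z^*)%C = nrm z.
Proof. by case: z => a b /=; rewrite sqrrN. Qed.

Lemma conj_sum I (r : seq I) (P : pred I) (F : I -> R[i]) :
  ((\sum_(i <- r | P i) F i)^*)%C = \sum_(i <- r | P i) ((F i)^*)%C.
Proof. exact: (rmorph_sum (@conjc R)). Qed.

Lemma nrmX z k : nrm (z ^+ k) = nrm z ^+ k.
Proof.
by elim: k => [|k IH]; rewrite ?expr0 ?Normc.normc1 // !exprS Normc.normcM IH.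
Qed.

Lemma nrm_sqr z : ((nrm z ^+ 2)%:C)%C = z * conjc z.
Proof.
case: z => a b /=; rewrite sqr_sqrtr ?addr_ge0 ?sqr_ge0 //; simpc.
by rewrite -!expr2 [b * a]mulrC addNr.
Qed.

Lemma eE x : e x = (cos (2 * pi * x) +i* sin (2 * pi * x))%C.
Proof. by rewrite /e /cexp /= expR0; simpc. Qed.

Lemma e0 : e (0 : R) = 1.
Proof. by rewrite eE mulr0 cos0 sin0. Qed.

Lemma eD x y : e (x + y) = e x * e y.
Proof.
rewrite !eE mulrDr cosD sinD; simpc; congr (_ +i* _)%C.
by rewrite addrC [sin _ * cos _]mulrC.
Qed.

Lemma nrm_e x : nrm (e x) = 1.
Proof. by rewrite eE /= cos2Dsin2 sqrtr1. Qed.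

Lemma conj_e x : (e x)^*%C = e (- x).
Proof. by rewrite !eE mulrN cosN sinN. Qed.

Lemma e_nat k : e (k%:R : R) = 1.
Proof.
elim: k => [|k IH]; first exact: e0.
rewrite -addn1 natrD eD IH mul1r eE mulr1 mulrC mulr_natr.
by rewrite cos2pi sin2pi.
Qed.

Lemma e_neq0 x : e x != 0.
Proof.
apply/eqP => ex0; have := nrm_e x.
by rewrite ex0 Normc.normc0 => /eqP; rewrite eq_sym oner_eq0.
Qed.

Lemma eN x : e (- x) = (e x)^-1.
Proof.
by apply: (mulIf (e_neq0 x)); rewrite -eD addNr e0 mulVf ?e_neq0.
Qed.

Lemma eMn x k : e (x * k%:R) = e x ^+ k.
Proof.
elim: k => [|k IH]; first by rewrite mulr0 e0.
by rewrite exprS -IH -eD -natr1 mulrDr mulr1 addrC.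
Qed.

Lemma nrm_e_sub1 x : nrm (e x - 1) = 2 * `|sin (pi * x)|.
Proof.
rewrite eE.
have -> : 2 * pi * x = (pi * x) *+ 2 :> R by rewrite -mulrA mulrC mulr_natr.
rewrite cos_mulr2n sin_mulr2n; move: (pi * x) => u.
simpc; rewrite /=.
have -> : (cos u ^+ 2 *+ 2 - 1 - 1) ^+ 2 + ((cos u * sin u) *+ 2) ^+ 2
   = (2 * sin u) ^+ 2.
  have := cos2Dsin2 u; set c := cos u; set t := sin u => h.
  have t2 : t ^+ 2 = 1 - c ^+ 2 by rewrite -h; ring.
  transitivity (4 * (c ^+ 2 - 1) ^+ 2 + 4 * c ^+ 2 * t ^+ 2); first by ring.
  by transitivity (4 * t ^+ 2); [rewrite t2|]; ring.
by rewrite sqrtr_sqr normrM ger0_norm.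
Qed.

Lemma sin_le x : `|sin x| <= `|x|.
Proof.
wlog x0 : x / 0 <= x => [hw|].
  by case: (lerP 0 x) => hx; [exact: hw | rewrite -normrN -sinN -(normrN x);
     apply: hw; rewrite oppr_ge0 ltW].
have [|c _] := @MVT_segment R sin cos 0 x x0.
- by apply: continuous_subspaceT; exact: continuous_sin.
rewrite sin0 !subr0 => ->; rewrite normrM.
by rewrite ler_piMl // cos_max.
Qed.

Lemma pi_le4 : pi <= 4 :> R.
Proof. by have := pihalf_lt2 R; lra. Qed.

Lemma nrm_eB x y : nrm (e x - e y) <= 8 * `|x - y|.
Proof.
have -> : e x - e y = e y * (e (x - y) - 1).
  by rewrite mulrBr -eD mulr1 [y + _]addrC subrK.
rewrite Normc.normcM nrm_e mul1r nrm_e_sub1.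
have := sin_le (pi * (x - y)); rewrite normrM (ger0_norm (pi_ge0 R)) => h.
have := ler_wpM2r (normr_ge0 (x - y)) pi_le4; lra.
Qed.

(** A linear minorant with a constant that is good enough: up to [pi/4] the
    cosine is at least [1/2] and the mean value theorem applies, and beyond
    [pi/4] the sine itself is at least [1/2]. *)
Lemma sin_pi_ge x : 0 <= x <= 1 / 2 -> x <= sin (pi * x).
Proof.
move=> /andP[x0 x1]; have p2 := pi_ge2 R; have p0 := pi_gt0 R.
have c4 : cos (pi / 4) ^+ 2 = 1 / 2 :> R.
  have := cos_mulr2n (pi / 4 : R).
  have -> : (pi / 4) *+ 2 = pi / 2 :> R by rewrite mulr2n; lra.
  by rewrite cos_pihalf; lra.
have c4p : 0 < cos (pi / 4) :> R by apply: cos_gt0_pihalf; apply/andP; split; lra.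
have c4h : 1 / 2 <= cos (pi / 4) :> R.
  by rewrite leNgt; apply/negP => hc; move: c4; nra.
case: (lerP x (1 / 4)) => hx.
  have px0 : 0 <= pi * x by rewrite mulr_ge0 // ltW.
  have [|c /itvP ci] := @MVT_segment R sin cos 0 (pi * x) px0.
  - by apply: continuous_subspaceT; exact: continuous_sin.
  rewrite sin0 !subr0 => ->.
  have cx : 0 <= c <= pi * x by rewrite !ci.
  have : cos (pi / 4) <= cos c :> R.
    have [cc0 cc1] := andP cx.
    have : c <= pi / 4 by nra.
    rewrite le_eqVlt => /orP[/eqP->//|ltc]; apply: ltW.
    rewrite ltr_cos //; rewrite in_itv /=; apply/andP; split; lra.
  by move=> h; nra.
have : sin (pi / 4) ^+ 2 = 1 / 2 :> R.
  by have := cos2Dsin2 (pi / 4 : R); rewrite c4; lra.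
have s4p : 0 < sin (pi / 4) :> R by apply: sin_gt0_pihalf; apply/andP; split; lra.
move=> s4.
have s4h : 1 / 2 <= sin (pi / 4) :> R.
  by rewrite leNgt; apply/negP => hc; move: s4; nra.
have : sin (pi / 4) < sin (pi * x) :> R.
  rewrite ltr_sin ?in_itv /=; first nra.
  - by apply/andP; split; lra.
  - by apply/andP; split; nra.
lra.
Qed.

(** Quantifies how far [e x] is from [1] when [x] is far from the integers; this is
    the source of all the cancellation below. *)
Lemma nrm_e_sub1_ge x : `|x| <= 1 / 2 -> 2 * `|x| <= nrm (e x - 1).
Proof.
move=> hx; rewrite nrm_e_sub1 ler_pM2l //.
case: (lerP 0 x) => x0.
  rewrite ger0_norm // in hx *; apply: le_trans _ (ler_norm _).
  by apply: sin_pi_ge; rewrite x0.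
rewrite ltr0_norm // in hx *; rewrite -normrN -sinN -mulrN.
apply: le_trans _ (ler_norm _).
by apply: sin_pi_ge; rewrite oppr_ge0 ltW.
Qed.

End Modulus.

(** * The Kusmin-Landau inequality *)

(** Subsets of the integers are described by predicates here; this turns an
    order-convex one into an interval, so that sums over it can be reindexed. *)
Lemma convex_pred_interval (P : pred nat) (N : nat) :
  (forall i j k, (i <= j <= k)%N -> (k < N)%N -> P i -> P k -> P j) ->
  exists p q, [/\ (p <= q <= N)%N &
    forall a, (a < N)%N -> P a = (p <= a < q)%N].
Proof.
move=> cP; case: (boolP [exists a : 'I_N, P a]) => [/existsP[a0 Pa0]|]; last first.
  rewrite negb_exists => /forallP nP; exists 0, 0; split=> // a aN.
  by have := nP (Ordinal aN) => /negbTE ->; rewrite ltn0.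
pose Q a := (a < N)%N && P a.
have exQ : exists a, Q a by exists a0; rewrite /Q ltn_ord.
have ubQ a : Q a -> (a <= N)%N by case/andP => /ltnW.
case: (ex_minnP exQ) => p /andP[pN Pp] minp.
case: (ex_maxnP exQ ubQ) => q /andP[qN Pq] maxq.
exists p, q.+1; split; first by rewrite qN leqW // maxq // /Q pN.
move=> a aN; apply/idP/idP => [Pa|/andP[pa aq]].
  by rewrite minp ?ltnS ?maxq // /Q aN.
by apply: (cP p a q) => //; rewrite pa -ltnS.
Qed.

Lemma sum_convex_pred (P : pred nat) (N : nat) :
  (forall i j k, (i <= j <= k)%N -> (k < N)%N -> P i -> P k -> P j) ->
  exists p len, [/\ (p + len <= N)%N, forall k, (k < len)%N -> P (p + k)%N &
    forall (V : nmodType) (F : nat -> V),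
      \sum_(a < N | P a) F a = \sum_(k < len) F (p + k)%N].
Proof.
move=> /convex_pred_interval[p [q [/andP[pq qN] Pe]]].
exists p, (q - p)%N; split; first by rewrite subnKC.
  move=> k; rewrite ltn_subRL => kq; rewrite Pe ?kq ?leq_addr //.
  exact: leq_trans qN.
move=> V F; rewrite -(big_mkord (fun a => P a) F).
rewrite (@big_cat_nat _ _ _ p) ?(leq_trans pq) //=.
rewrite (@big_cat_nat _ _ _ q p) //= [X in X + _]big_nat_cond.
rewrite [X in X + _]big1 ?add0r; last first.
  move=> a /andP[/andP[_ ap]]; rewrite Pe; last by lia.
  by move=> /andP[pa _]; move: ap; rewrite ltnNge pa.
rewrite [X in _ + X]big_nat_cond [X in _ + X]big1 ?addr0; last first.
  by move=> a /andP[/andP[diff_red_num aN]]; rewrite Pe // ltnNge diff_red_num andbF.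
rewrite big_nat_cond (eq_bigl (fun a => (p <= a < q)%N && true)); last first.
  move=> a; rewrite andbT; apply/andP/idP => [[]//|h]; split=> //.
  by rewrite Pe //; case/andP: h => _ /leq_trans; apply.
rewrite -big_nat_cond -{1}(add0n p) big_addn big_mkord.
by apply: eq_bigr => k _; rewrite addnC.
Qed.

Section KusminLandau.
Variable R : realType.
Implicit Types (x : nat -> R) (D : R).

(** Summation by parts.  With [z_k = e (x k)] and [w_k = 1 / (e (d k) - 1)] one has
    [z_k = (z_(k+1) - z_k) w_k], so that the sum of the [z_k] is a boundary term
    plus the sum of [z_(k+1) (w_k - w_(k+1))]; and
    [w_k - w_(k+1) = (e (d (k+1)) - e (d k)) w_k w_(k+1)] is controlled by the
    increment of [1 / d]. *)
Lemma kusmin_landau_telescope x (N : nat) D : 0 < D ->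
  (forall k, (k <= N)%N -> D <= x k.+1 - x k <= 1 / 2) ->
  let d k := x k.+1 - x k in
  let w k := (e (d k) - 1)^-1 in
  nrm (\sum_(k < N) e (x k) - e (x N) * w N + e (x 0%N) * w 0%N)
    <= 2 * \sum_(k < N) `|(d k)^-1 - (d k.+1)^-1|.
Proof.
move=> D0 hx; cbv zeta; pose d k := x k.+1 - x k; pose w k := (e (d k) - 1)^-1.
change (nrm (\sum_(k < N) e (x k) - e (x N) * w N + e (x 0%N) * w 0%N)
    <= 2 * \sum_(k < N) `|(d k)^-1 - (d k.+1)^-1|).
have dw k : (k <= N)%N -> 0 < d k /\ 2 * d k <= nrm (e (d k) - 1).
  move=> /hx /andP[h1 h2]; rewrite -/(d k) in h1 h2 *.
  have d0 : 0 < d k by apply: lt_le_trans h1.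
  split=> //; have := @nrm_e_sub1_ge R (d k).
  by rewrite ger0_norm ?(ltW d0) //; apply.
have wn k : (k <= N)%N -> e (d k) - 1 != 0.
  move=> /dw [d0 h]; apply/eqP => ed.
  by move: h; rewrite ed Normc.normc0; lra.
have : forall k, (k <= N)%N ->
    nrm (\sum_(j < k) e (x j) - e (x k) * w k + e (x 0%N) * w 0%N)
    <= 2 * \sum_(j < k) `|(d j)^-1 - (d j.+1)^-1|.
  elim=> [|k IH] kN.
    by rewrite !big_ord0 mulr0 sub0r addNr Normc.normc0.
  rewrite !big_ord_recr /=.
  have -> : \sum_(j < k) e (x j) + e (x k) - e (x k.+1) * w k.+1
     + e (x 0%N) * w 0%N =
     (\sum_(j < k) e (x j) - e (x k) * w k + e (x 0%N) * w 0%N)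
     + e (x k.+1) * (w k - w k.+1).
    have : e (x k) = (e (x k.+1) - e (x k)) * w k.
      have -> : x k.+1 = x k + d k by rewrite /d addrC subrK.
      rewrite eD -{3}(mulr1 (e (x k))) -mulrBr -mulrA mulfV ?mulr1 //.
      by apply: wn; apply: ltnW.
    move=> h; apply/eqP; rewrite -subr_eq0; apply/eqP.
    transitivity (e (x k) - (e (x k.+1) - e (x k)) * w k); first by ring.
    by rewrite -h subrr.
  apply: le_trans (le_normcD _ _) _; rewrite [leRHS]mulrDr.
  apply: lerD; first by apply: IH; apply: ltnW.
  rewrite Normc.normcM nrm_e mul1r.
  have [d0 hd0] := dw k (ltnW kN).
  have [d1 hd1] := dw k.+1 kN.
  have -> : w k - w k.+1 = (e (d k.+1) - e (d k)) * (w k * w k.+1).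
    have := wn k (ltnW kN); have := wn k.+1 kN; rewrite /w => n1 n0.
    by field; rewrite n0 n1.
  rewrite !Normc.normcM !Normc.normcV.
  have -> : (d k)^-1 - (d k.+1)^-1 = (d k.+1 - d k) * ((d k)^-1 * (d k.+1)^-1).
    by field; rewrite !gt_eqF.
  rewrite normrM (ger0_norm (_ : 0 <= (d k)^-1 * _)); last first.
    by rewrite mulr_ge0 // invr_ge0 ltW.
  have i0 : (nrm (e (d k) - 1))^-1 <= (2 * d k)^-1.
    by rewrite lef_pV2 // posrE ?mulr_gt0 //; apply: lt_le_trans hd0; rewrite mulr_gt0.
  have i1 : (nrm (e (d k.+1) - 1))^-1 <= (2 * d k.+1)^-1.
    by rewrite lef_pV2 // posrE ?mulr_gt0 //; apply: lt_le_trans hd1; rewrite mulr_gt0.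
  have ip : (nrm (e (d k) - 1))^-1 * (nrm (e (d k.+1) - 1))^-1
     <= (2 * d k)^-1 * (2 * d k.+1)^-1.
    by apply: ler_pM; rewrite ?invr_ge0 ?nrm_ge0.
  apply: le_trans (ler_pM (nrm_ge0 _) _ (nrm_eB _ _) ip) _.
    by rewrite mulr_ge0 ?invr_ge0 ?nrm_ge0.
  by rewrite !invfM; lra.
by apply.
Qed.

(** When the differences [d] are monotone the increments of [1 / d] all have the
    same sign, so their absolute values telescope to at most [1 / D]. *)
Lemma kusmin_landau_unit x (N : nat) D : 0 < D -> D <= 1 / 2 ->
  (forall k, (k < N)%N -> D <= x k.+1 - x k <= 1 / 2) ->
  (forall k, (k.+1 < N)%N -> x k.+2 - x k.+1 <= x k.+1 - x k) \/
  (forall k, (k.+1 < N)%N -> x k.+1 - x k <= x k.+2 - x k.+1) ->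
  nrm (\sum_(k < N) e (x k)) <= 4 / D.
Proof.
move=> D0 D1; case: N => [|N] hx mono.
  by rewrite big_ord0 Normc.normc0 divr_ge0 // ltW.
pose d k := x k.+1 - x k.
have hd k : (k <= N)%N -> [/\ 0 < (d k)^-1, (d k)^-1 <= D^-1,
     nrm (e (d k) - 1)^-1 <= (d k)^-1 / 2 & 0 < d k].
  move=> kN; have /andP[h1 h2] := hx k kN; rewrite -/(d k) in h1 h2.
  have d0 : 0 < d k by apply: lt_le_trans h1.
  have := @nrm_e_sub1_ge R (d k); rewrite ger0_norm ?(ltW d0) // => /(_ h2) h.
  split=> //; first by rewrite invr_gt0.
    by rewrite lef_pV2.
  rewrite Normc.normcV -invfM mulrC lef_pV2 ?posrE ?mulr_gt0 //.
  by apply: lt_le_trans h; rewrite mulr_gt0.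
have := @kusmin_landau_telescope x N D D0 hx; rewrite /= -/(d 0%N) -/(d N) => hT.
have vari : \sum_(k < N) `|(d k)^-1 - (d k.+1)^-1| <= `|(d N)^-1 - (d 0%N)^-1|.
  case: mono => mono.
    rewrite (eq_bigr (fun k : 'I_N => (d k.+1)^-1 - (d k)^-1)); last first.
      move=> k _; rewrite distrC ger0_norm // subr_ge0 lef_pV2 ?posrE //.
      - by apply: mono; rewrite ltnS.
      - by have [] := hd k (ltnW (ltn_ord k)).
      - by have [] := hd k.+1 (ltn_ord k).
    rewrite -(big_mkord predT (fun k => (d k.+1)^-1 - (d k)^-1)).
    by rewrite telescope_sumr // ler_norm.
  rewrite (eq_bigr (fun k : 'I_N => - (d k.+1)^-1 - (- (d k)^-1))); last first.
    move=> k _; rewrite ger0_norm ?opprK; first by rewrite addrC.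
    rewrite subr_ge0 lef_pV2 ?posrE //.
    - by apply: mono; rewrite ltnS.
    - by have [] := hd k.+1 (ltn_ord k).
    - by have [] := hd k (ltnW (ltn_ord k)).
  rewrite -(big_mkord predT (fun k => - (d k.+1)^-1 - (- (d k)^-1))).
  by rewrite telescope_sumr // distrC opprK addrC ler_norm.
rewrite big_ord_recr /=.
set S := \sum_(k < N) _ in hT *.
set w0 := e (x 0%N) * _ in hT *; set wN := e (x N) * _ in hT *.
have -> : S + e (x N) = (S - wN + w0) + (e (x N) + (wN - w0)) by ring.
have [p0 q0 r0 _] := hd 0%N isT; have [pN qN rN _] := hd N (leqnn N).
have n0 : nrm w0 <= (d 0%N)^-1 / 2 by rewrite Normc.normcM nrm_e mul1r.
have nN : nrm wN <= (d N)^-1 / 2 by rewrite Normc.normcM nrm_e mul1r.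
have t1 := le_normcD (S - wN + w0) (e (x N) + (wN - w0)).
have t2 := le_normcD (e (x N)) (wN - w0).
have t3 := le_normcD wN (- w0); rewrite normcN in t3; rewrite nrm_e in t2.
have v2 : `|(d N)^-1 - (d 0%N)^-1| <= D^-1.
  by rewrite ler_norml; apply/andP; split; lra.
have D2 : 2 <= D^-1.
  by rewrite -[2]invrK lef_pV2 ?posrE //; lra.
have : 4 / D = 4 * D^-1 by [].
lra.
Qed.

(** Differences at distance at least [D] from the integer [m], on either side of
    it: subtracting [m k] from the phase changes no term, and conjugation
    exchanges the two sides. *)
Lemma kusmin_landau x (P : pred nat) (N m : nat) D : 0 < D -> D <= 1 / 2 ->
  (forall i j k, (i <= j <= k)%N -> (k < N)%N -> P i -> P k -> P j) ->
  (forall a, x a.+2 - x a.+1 <= x a.+1 - x a) ->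
  (forall a, (a < N)%N -> P a -> D <= x a.+1 - x a - m%:R <= 1 / 2) \/
  (forall a, (a < N)%N -> P a -> D <= m%:R - (x a.+1 - x a) <= 1 / 2) ->
  nrm (\sum_(a < N | P a) e (x a)) <= 4 / D.
Proof.
move=> D0 D1 cP mono hx.
have [p [len [plN Pk sumE]]] := sum_convex_pred cP.
rewrite (sumE _ (fun a => e (x a))).
have em k : e (x (p + k)%N) = e (x (p + k)%N - (m * k)%:R).
  by rewrite eD eN e_nat invr1 mulr1.
have lt k : (k < len)%N -> (p + k < N)%N.
  by move=> kl; apply: leq_trans plN; rewrite ltn_add2l.
case: hx => hx.
  rewrite (eq_bigr _ (fun (k : 'I_len) _ => em k)).
  apply: (@kusmin_landau_unit (fun k => x (p + k)%N - (m * k)%:R)) => // [k kl|].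
    have := hx _ (lt _ kl) (Pk _ kl).
    by rewrite addnS mulnS natrD; lra.
  left=> k _; have := mono (p + k)%N.
  by rewrite !addnS !mulnS !natrD; lra.
rewrite -nrm_conj conj_sum.
rewrite (eq_bigr (fun k : 'I_len => e ((m * k)%:R - x (p + k)%N))); last first.
  by move=> k _; rewrite em conj_e opprB.
apply: (@kusmin_landau_unit (fun k => (m * k)%:R - x (p + k)%N)) => // [k kl|].
  have := hx _ (lt _ kl) (Pk _ kl).
  by rewrite addnS mulnS natrD; lra.
right=> k _; have := mono (p + k)%N.
by rewrite !addnS !mulnS !natrD; lra.
Qed.

End KusminLandau.

(** * Elementary bounds on the phase h sqrt a *)

Section RealBounds.
Variable R : realType.
Implicit Types (u v U V s H : R).

Lemma inv_diffE (h : R) u v : 0 < u -> 0 < v ->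
  h / (2 * u) - h / (2 * v) = h * (v ^+ 2 - u ^+ 2) / (2 * (u * v) * (u + v)).
Proof. by move=> u0 v0; field; rewrite !gt_eqF // addr_gt0. Qed.

(** For an integer frequency [m = h / (2 b)], this and the next lemma measure how
    far the derivative [h / (2 u)] of [h sqrt a] at [a = u^2] is from [m]. *)
Lemma inv_diff_ge (h : R) u v V : 0 <= h -> 0 < u -> u <= v -> v <= V ->
  h * (v ^+ 2 - u ^+ 2) / (4 * V ^+ 3) <= h / (2 * u) - h / (2 * v).
Proof.
move=> h0 u0 uv vV; have v0 := lt_le_trans u0 uv; have V0 := lt_le_trans v0 vV.
rewrite inv_diffE //; apply: ler_wpM2l.
  by rewrite mulr_ge0 // subr_ge0 lerXn2r // nnegrE ltW.
rewrite lef_pV2 ?posrE ?mulr_gt0 ?exprn_gt0 ?addr_gt0 //.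
have -> : 4 * V ^+ 3 = 2 * (V * V) * (V + V) by ring.
apply: ler_pM; rewrite ?mulr_ge0 ?addr_ge0 ?(ltW u0) ?(ltW v0) //; last by lra.
by rewrite ler_pM2l //; apply: ler_pM; lra.
Qed.

Lemma inv_diff_le (h : R) u v U : 0 <= h -> 0 < U -> U <= u -> u <= v ->
  h / (2 * u) - h / (2 * v) <= h * (v ^+ 2 - u ^+ 2) / (4 * U ^+ 3).
Proof.
move=> h0 U0 Uu uv; have u0 := lt_le_trans U0 Uu; have v0 := lt_le_trans u0 uv.
rewrite inv_diffE //; apply: ler_wpM2l.
  by rewrite mulr_ge0 // subr_ge0 lerXn2r // nnegrE ltW.
rewrite lef_pV2 ?posrE ?mulr_gt0 ?exprn_gt0 ?addr_gt0 //.
have -> : 4 * U ^+ 3 = 2 * (U * U) * (U + U) by ring.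
apply: ler_pM; rewrite ?mulr_ge0 ?addr_ge0 ?(ltW U0) //; last by lra.
by rewrite ler_pM2l //; apply: ler_pM; lra.
Qed.

Lemma sqr_le_cube s H : 1 <= s -> s <= H -> H ^+ 3 <= s ^+ 4 -> H ^+ 2 <= s ^+ 3.
Proof.
move=> s1 sH H3; rewrite leNgt; apply/negP => hlt.
have H0 : 0 < H by lra.
have : (s ^+ 3) ^+ 3 < (H ^+ 2) ^+ 3.
  by rewrite ltr_pXn2r // nnegrE exprn_ge0 //; lra.
have : (H ^+ 3) ^+ 2 <= (s ^+ 4) ^+ 2.
  by rewrite lerXn2r // nnegrE exprn_ge0 //; lra.
have : s ^+ 8 <= s ^+ 9 by rewrite ler_weXn2l.
have e1 : (s ^+ 3) ^+ 3 = s ^+ 9 by rewrite -exprM.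
have e2 : (H ^+ 3) ^+ 2 = (H ^+ 2) ^+ 3 by rewrite -!exprM.
have e3 : (s ^+ 4) ^+ 2 = s ^+ 8 by rewrite -exprM.
rewrite e1 e2 e3; lra.
Qed.

Lemma le_small s H : 100 <= s -> s <= H -> H ^+ 3 <= s ^+ 4 -> 10 * H <= s ^+ 2.
Proof.
move=> s1 sH H3; have H2 : H ^+ 2 <= s ^+ 3 by apply: sqr_le_cube => //; lra.
rewrite leNgt; apply/negP => hlt.
have : (s ^+ 2) ^+ 2 < (10 * H) ^+ 2.
  by rewrite ltr_pXn2r // nnegrE ?exprn_ge0 //; lra.
have e1 : (s ^+ 2) ^+ 2 = s * s ^+ 3 by rewrite -exprS -exprM.
have e2 : (10 * H) ^+ 2 = 100 * H ^+ 2 by ring.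
have : 100 * s ^+ 3 <= s * s ^+ 3.
  by rewrite ler_pM2r // exprn_gt0; lra.
rewrite e1 e2; lra.
Qed.

Definition root_phase (h a : nat) : R := h%:R * Num.sqrt a%:R.
Definition phase_diff (h a : nat) : R := root_phase h a.+1 - root_phase h a.

Lemma sqrt_nat_gt0 a : (0 < a)%N -> 0 < Num.sqrt (a%:R : R).
Proof. by move=> a0; rewrite sqrtr_gt0 ltr0n. Qed.

Lemma sqrt_nat_ge (a : nat) u : 0 <= u -> u ^+ 2 <= a%:R -> u <= Num.sqrt a%:R.
Proof.
by move=> u0 ua; rewrite -[u]ger0_norm // -sqrtr_sqr ler_wsqrtr.
Qed.

Lemma sqrt_nat_le (a : nat) u : 0 <= u -> a%:R <= u ^+ 2 -> Num.sqrt a%:R <= u.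
Proof.
by move=> u0 ua; rewrite -[leRHS]ger0_norm // -sqrtr_sqr ler_wsqrtr.
Qed.

Lemma phase_diffE h a : phase_diff h a = h%:R / (Num.sqrt a.+1%:R + Num.sqrt a%:R).
Proof.
rewrite /phase_diff /root_phase -mulrBr; congr (_ * _).
have p : 0 < Num.sqrt (a.+1%:R : R) + Num.sqrt a%:R.
  by rewrite ltr_wpDr ?sqrtr_ge0 // sqrt_nat_gt0.
apply: (mulIf (lt0r_neq0 p)); rewrite mulVf ?lt0r_neq0 //.
by rewrite -subr_sqr !sqr_sqrtr ?ler0n // -natr1; ring.
Qed.

Lemma sqrt_leS a : Num.sqrt (a%:R : R) <= Num.sqrt a.+1%:R.
Proof. by rewrite ler_wsqrtr // ler_nat. Qed.

Lemma phase_diff_ge h a : h%:R / (2 * Num.sqrt (a.+1%:R : R)) <= phase_diff h a.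
Proof.
rewrite phase_diffE ler_wpM2l ?ler0n //; have := sqrt_leS a => hs.
have p := @sqrt_nat_gt0 a.+1 isT.
rewrite lef_pV2 ?posrE ?mulr_gt0 //; first by lra.
Qed.

Lemma phase_diff_le h a : (0 < a)%N -> phase_diff h a <= h%:R / (2 * Num.sqrt (a%:R : R)).
Proof.
move=> a0; rewrite phase_diffE ler_wpM2l ?ler0n //; have := sqrt_leS a => hs.
have p := sqrt_nat_gt0 a0.
by rewrite lef_pV2 ?posrE ?mulr_gt0 //; lra.
Qed.

Lemma phase_diff_ge0 h a : 0 <= phase_diff h a.
Proof. by rewrite phase_diffE divr_ge0 // addr_ge0 ?sqrtr_ge0. Qed.

Lemma phase_diff_decr h a b : (a <= b)%N -> phase_diff h b <= phase_diff h a.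
Proof.
move=> ab; rewrite !phase_diffE ler_wpM2l ?ler0n //.
have p k := @sqrt_nat_gt0 k.+1 isT.
rewrite lef_pV2 ?posrE ?ltr_wpDr ?sqrtr_ge0 //.
by apply: lerD; rewrite ler_wsqrtr // ler_nat.
Qed.

Lemma phase_diff_homo h h' a : (h <= h')%N -> phase_diff h a <= phase_diff h' a.
Proof.
by move=> hh; rewrite !phase_diffE ler_wpM2r ?ler_nat // invr_ge0 addr_ge0 ?sqrtr_ge0.
Qed.

(** Strict concavity: for consecutive square roots [u], [v], [w] two consecutive
    differences drop by [2 h / ((u + v) (v + w) (u + w))]. *)
Lemma phase_diff_gap h a k V : Num.sqrt (a + k).+1%:R <= V ->
  k%:R * (h%:R / (4 * V ^+ 3)) <= phase_diff h a - phase_diff h (a + k).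
Proof.
elim: k => [|k IH] hV; first by rewrite mul0r addn0 subrr.
have hV' : Num.sqrt (a + k).+1%:R <= V.
  by apply: le_trans hV; rewrite ler_wsqrtr // ler_nat addnS.
have V0 : 0 < V by apply: lt_le_trans hV'; exact: sqrt_nat_gt0.
suff : h%:R / (4 * V ^+ 3) <= phase_diff h (a + k) - phase_diff h (a + k.+1).
  by have := IH hV'; rewrite -natr1; lra.
rewrite !phase_diffE addnS.
set u := Num.sqrt (a + k)%:R; set v := Num.sqrt (a + k).+1%:R in hV' *.
set w := Num.sqrt (a + k).+2%:R.
have u0 : 0 <= u by exact: sqrtr_ge0.
have v0 : 0 < v by exact: sqrt_nat_gt0.
have w0 : 0 < w by exact: sqrt_nat_gt0.
have wV : w <= V by move: hV; rewrite addnS.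
have uv : u <= v by exact: sqrt_leS.
have vw : v <= w by exact: sqrt_leS.
have e1 : w ^+ 2 - u ^+ 2 = 2 by rewrite !sqr_sqrtr // -!natr1; ring.
have -> : h%:R / (v + u) - h%:R / (w + v) = h%:R * (2 / ((v + u) * (w + v) * (w + u))).
  have p1 : 0 < v + u by lra.
  have p2 : 0 < w + v by lra.
  have p3 : 0 < w + u by lra.
  rewrite -e1 subr_sqr; field.
  by rewrite !gt_eqF.
apply: ler_wpM2l => //.
have -> : (4 * V ^+ 3)^-1 = 2 / (8 * V ^+ 3) by field; rewrite gt_eqF.
apply: ler_wpM2l => //.
rewrite lef_pV2 ?posrE ?mulr_gt0 ?exprn_gt0 //; [|lra|lra|lra].
have -> : 8 * V ^+ 3 = (V + V) * (V + V) * (V + V) by ring.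
apply: ler_pM; rewrite ?mulr_ge0 //; [lra|lra|lra| |lra].
by apply: ler_pM; lra.
Qed.

End RealBounds.

(** * Gauss sums and Riemann sums *)

Section GaussSums.
Variable R : realType.

(** The trivial bound on a range whose length is only known through the distance
    between its elements. *)
Lemma nrm_sum_le1 (F : nat -> R[i]) (P : pred nat) (N L : nat) :
  (forall a, nrm (F a) <= 1) ->
  (forall i j k, (i <= j <= k)%N -> (k < N)%N -> P i -> P k -> P j) ->
  (forall i k, (i <= k < N)%N -> P i -> P k -> (k - i <= L)%N) ->
  nrm (\sum_(a < N | P a) F a) <= L.+1%:R.
Proof.
move=> F1 cP hL; have [p [len [plN Pk ->]]] := sum_convex_pred cP.
apply: le_trans (nrm_sum _ _ _) _.
apply: (@le_trans _ _ (\sum_(k < len) 1)); first exact: ler_sum.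
rewrite sumr_const card_ord ler_nat.
case: len plN Pk => // len plN Pk.
have := hL p (p + len)%N; rewrite addKn ltnS; apply.
- by rewrite leq_addr; apply: leq_trans plN; rewrite addnS.
- by have := Pk 0%N isT; rewrite addn0.
- exact: Pk.
Qed.

(** A Fresnel integral has size [al^(-1/2)]: up to [j = al^(-1/2)] the trivial bound
    suffices, and from there on the derivative of the phase exceeds [sqrt al]. *)
Lemma gauss_sum_bound (al : R) (J : nat) : 0 < al -> al <= 1 / 4 ->
  2 * al * J%:R <= 1 / 2 ->
  nrm (\sum_(j < J) e (- (al * j%:R ^+ 2))) <= 7 / Num.sqrt al.
Proof.
move=> al0 al1 alJ; set b := Num.sqrt al.
have b0 : 0 < b by rewrite sqrtr_gt0.
have bE : b * b = al by rewrite -expr2 sqr_sqrtr ?ltW.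
have b1 : b <= 1 / 2 by rewrite leNgt; apply/negP => hb; nra.
(* Trivial bound below [K], Kusmin-Landau from [K] on. *)
pose K := (Num.truncn b^-1).+1.
have bi0 : 0 < b^-1 by rewrite invr_gt0.
have K1 : b^-1 < K%:R by apply: truncnS_gt.
have K2 : K%:R <= b^-1 + 1.
  by rewrite -natr1 lerD2r truncn_le ltW.
rewrite (bigID (fun j : 'I_J => (j < K)%N)) /=.
apply: le_trans (le_normcD _ _) _.

have bi2 : 2 <= b^-1 by rewrite -[2]invrK lef_pV2 ?posrE //; lra.
apply: (@le_trans _ _ (K%:R + 4 * b^-1)); last by lra.
apply: lerD.
  apply: (@nrm_sum_le1 (fun j => e (- (al * j%:R ^+ 2))) (fun j => (j < K)%N)).
  - by move=> a; rewrite nrm_e.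
  - by move=> i j k; lia.
  - by move=> i k; rewrite /K; lia.
apply: (@kusmin_landau R (fun j => - (al * j%:R ^+ 2)) (fun j => ~~ (j < K)%N) J 0 b) => //.
- by move=> i j k; lia.
- by move=> a; rewrite -!natr1; nra.
right=> a aJ; rewrite -leqNgt => Ka.
have aK : K%:R <= a%:R :> R by rewrite ler_nat.
have aJ' : a%:R + 1 <= J%:R :> R by rewrite natr1 ler_nat.
have bK : 1 <= b * K%:R.
  have : b * b^-1 <= b * K%:R by rewrite ler_pM2l // ltW.
  by rewrite mulfV ?gt_eqF.
have -> : 0%:R - (- (al * a.+1%:R ^+ 2) - - (al * a%:R ^+ 2)) = al * (2 * a%:R + 1) :> R.
  by rewrite -natr1; ring.
apply/andP; split; last by nra.
have : b <= al * K%:R by rewrite -bE -mulrA ler_peMr // ltW.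
have : al * K%:R <= al * a%:R by rewrite ler_pM2l.
have : 0 <= al * a%:R by rewrite mulr_ge0 // ltW.
lra.
Qed.

Lemma sum_blocks (V : nmodType) (F : nat -> V) (B N : nat) :
  \sum_(j < B * N) F j = \sum_(k < B) \sum_(i < N) F (k * N + i)%N.
Proof.
elim: B => [|B IH]; first by rewrite mul0n !big_ord0.
by rewrite mulSnr big_split_ord big_ord_recr /= IH.
Qed.

(** Both sides approximate the integral of [g] over an interval of length [h / Q],
    once with unit steps and once with steps [1 / (Q r)].  Grouping the fine grid
    into unit cells compares them without mentioning the integral; the term [1]
    pays for the incomplete last cell. *)
Lemma riemann_cmp (g : R -> R[i]) (lam th : R) (h Q r : nat) :
  (0 < Q)%N -> (0 < r)%N -> 0 <= th <= 1 ->
  (forall t, nrm (g t) <= 1) ->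
  (forall k t, (k < h %/ Q)%N -> 0 <= t <= 1 ->
     nrm (g (k%:R + th) - g (k%:R + t)) <= lam) ->
  nrm (\sum_(k < h %/ Q) g (k%:R + th)
     - ((Q * r)%:R^-1)%:C%C * \sum_(j < h * r) g (j%:R / (Q * r)%:R))
  <= (h %/ Q)%:R * lam + 1.
Proof.
move=> Q0 r0 th01 g1 glam.
set B := (h %/ Q)%N; set N := (Q * r)%N.
have N0 : (0 < N)%N by rewrite muln_gt0 Q0.
have NR : 0 < N%:R :> R by rewrite ltr0n.
(* The fine grid has [h r] points: [h %/ Q] full unit cells of [Q r] points each,
   and a remainder. *)
have -> : (h * r = B * N + (h %% Q) * r)%N.
  by rewrite {1}(divn_eq h Q) mulnDl mulnA.
rewrite big_split_ord /= (sum_blocks (fun j => g (j%:R / N%:R))) mulrDr opprD addrA.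
apply: le_trans (le_normcD _ _) _; apply: lerD.
  rewrite mulr_sumr -sumrB.
  apply: le_trans (nrm_sum _ _ _) _.
  apply: (@le_trans _ _ (\sum_(k < B) lam)); last first.
    by rewrite sumr_const card_ord mulr_natl.
  apply: ler_sum => k _.
  have -> : g (k%:R + th) - (N%:R^-1)%:C%C * \sum_(i < N) g ((k * N + i)%:R / N%:R)
     = (N%:R^-1)%:C%C * \sum_(i < N) (g (k%:R + th) - g (k%:R + i%:R / N%:R)).
    rewrite sumrB mulrBr; congr (_ - _); last first.
      congr (_ * _); apply: eq_bigr => i _; congr g.
      by rewrite natrD natrM mulrDl mulfK ?gt_eqF.
    rewrite sumr_const card_ord -(mulr_natl (g _) N) mulrA.
    have -> : N%:R = (N%:R : R)%:C%C by rewrite rmorph_nat.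
    by rewrite -rmorphM /= mulVf ?gt_eqF // mul1r.
  rewrite Normc.normcM nrm_real ger0_norm ?invr_ge0 ?ler0n //.
  rewrite ler_pdivrMl //.
  apply: le_trans (nrm_sum _ _ _) _.
  apply: (@le_trans _ _ (\sum_(i < N) lam)); last first.
    by rewrite sumr_const card_ord mulr_natl.
  apply: ler_sum => i _; apply: glam; first exact: ltn_ord.
  by rewrite divr_ge0 ?ler0n //= ler_pdivrMr // mul1r ler_nat ltnW.
rewrite normcN Normc.normcM nrm_real ger0_norm ?invr_ge0 ?ler0n //.
rewrite ler_pdivrMl // mulr1.
apply: le_trans (nrm_sum _ _ _) _.
apply: (@le_trans _ _ (\sum_(k < h %% Q * r) 1)); first exact: ler_sum.
rewrite sumr_const card_ord ler_nat leq_mul2r.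
by rewrite (ltnW (ltn_pmod _ _)) ?orbT.
Qed.

End GaussSums.

(** * Blocks, dual weights and the local expansion *)

Section Blocks.
Variable R : realType.
Implicit Types (s H : R).

(** The block to which [a] belongs: the integer nearest to the phase difference,
    which is used in place of the derivative. *)
Definition nearest_freq (h a : nat) : nat := Num.truncn (phase_diff R h a + 1 / 2).

Lemma nearest_freq_eq h a m :
  (nearest_freq h a == m) = (m%:R <= phase_diff R h a + 1 / 2 < m%:R + 1).
Proof.
have d0 := phase_diff_ge0 R h a.
by rewrite /nearest_freq truncn_eq ?natr1 //; lra.
Qed.

Lemma nearest_freq_anti h a b : (a <= b)%N -> (nearest_freq h b <= nearest_freq h a)%N.
Proof. by move=> ab; apply: le_truncn; rewrite lerD2r phase_diff_decr. Qed.

Lemma nearest_freq_homo h h' a : (h <= h')%N -> (nearest_freq h a <= nearest_freq h' a)%N.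
Proof. by move=> ab; apply: le_truncn; rewrite lerD2r phase_diff_homo. Qed.

(** Twice a Riemann sum with step [1 / (Q J)] for the integral of [e(- m^3 t^2)] over
    [[0, 1/Q]].  It is independent of [h]; the choice of [J] is made once for all
    [h <= H]. *)
Definition dual_weight (Q J m : nat) : R[i] :=
  (2 / (Q * J)%:R)%:C%C *
  \sum_(j < J) e (- (m%:R ^+ 3 * (j%:R / (Q * J)%:R) ^+ 2)).

Lemma dual_weight_bound Q J m : (0 < Q)%N -> (0 < J)%N -> (0 < m)%N ->
  (4 * m ^ 3 <= Q ^ 2 * J)%N ->
  nrm (dual_weight Q J m) <= 14 / Num.sqrt (m%:R ^+ 3).
Proof.
move=> Q0 J0 m0 hm.
set L : R := (Q * J)%:R; set w : R := m%:R ^+ 3.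
have L0 : 0 < L by rewrite ltr0n muln_gt0 Q0.
have w0 : 0 < w by rewrite exprn_gt0 ?ltr0n.
have JR : 1 <= J%:R :> R by rewrite ler1n.
have hw : 4 * w <= L * Q%:R.
  by rewrite /w /L -!natrX -!natrM ler_nat (leq_trans hm) // expnS expn1; lia.
have QL : Q%:R <= L by rewrite ler_nat leq_pmulr.
have LJ : L = Q%:R * J%:R by rewrite /L natrM.
rewrite /dual_weight -/L Normc.normcM nrm_real ger0_norm; last by rewrite divr_ge0 // ltW.
have al0 : 0 < w / L ^+ 2 by apply: divr_gt0 => //; apply: exprn_gt0.
have := @gauss_sum_bound R (w / L ^+ 2) J al0.
have -> : Num.sqrt (w / L ^+ 2) = Num.sqrt w / L.
  by rewrite sqrtrM ?ltW // sqrtrV ?exprn_ge0 ?ltW // sqrtr_sqr ger0_norm // ltW.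
rewrite (eq_bigr (fun j : 'I_J => e (- (w * (j%:R / L) ^+ 2)))); last first.
  by move=> j _; congr (e (- _)); rewrite exprMn exprVn; ring.
move=> h; have {}h := h _ _.
apply: (@le_trans _ _ (2 / L * (7 / (Num.sqrt w / L)))).
  rewrite ler_pM2l ?divr_gt0 //; apply: h.
    rewrite ler_pdivrMr ?exprn_gt0 //.
    have : L * Q%:R <= L * L by rewrite ler_pM2l.
    by rewrite expr2; lra.
  have -> : 2 * (w / L ^+ 2) * J%:R = (2 * w * J%:R) / L ^+ 2 by ring.
  rewrite ler_pdivrMr ?exprn_gt0 //.
  have : 4 * w * J%:R <= L * Q%:R * J%:R by rewrite ler_wpM2r // ler0n.
  by have -> : L * Q%:R * J%:R = L * L by [rewrite -mulrA -LJ]; rewrite expr2; lra.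
have sw : 0 < Num.sqrt w by rewrite sqrtr_gt0.
rewrite le_eqVlt; apply/orP; left; apply/eqP.
by clearbody L; field; rewrite !gt_eqF.
Qed.

(** With [h = 2 m b] this is the second order expansion of [h y] in terms of [y^2]
    at [b^2].  The difference factors as [m (y - b)^3 (y + 3 b) / (4 b^2)]. *)
Lemma taylor_sqrt (m b y : R) : 0 < m -> 0 < b -> 0 <= y -> 1 <= 2 * b ->
  `|y ^+ 2 - b ^+ 2| <= b / 4 ->
  `|2 * m * b * y - (m * b ^+ 2 + m * y ^+ 2
       - m / (4 * b ^+ 2) * (y ^+ 2 - b ^+ 2) ^+ 2)| <= m / (32 * b).
Proof.
move=> m0 b0 y0 b1 hyb.
have -> : 2 * m * b * y - (m * b ^+ 2 + m * y ^+ 2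
       - m / (4 * b ^+ 2) * (y ^+ 2 - b ^+ 2) ^+ 2)
   = m / (4 * b ^+ 2) * ((y - b) ^+ 3 * (y + 3 * b)).
  by field; rewrite gt_eqF.
have d : `|y - b| <= 1 / 4.
  move: hyb; rewrite subr_sqr normrM (ger0_norm (_ : 0 <= y + b)); last by lra.
  move=> h; rewrite leNgt; apply/negP => hc.
  have : 1 / 4 * b < `|y - b| * (y + b).
    have : 1 / 4 * b < `|y - b| * b by rewrite ltr_pM2r.
    have : 0 <= `|y - b| * y by rewrite mulr_ge0.
    lra.
  lra.
rewrite normrM ger0_norm; last by rewrite divr_ge0 ?mulr_ge0 ?exprn_ge0 ?ltW.
rewrite normrM normrX (ger0_norm (_ : 0 <= y + 3 * b)); last by lra.
have d3 : `|y - b| ^+ 3 <= (1 / 4) ^+ 3 by rewrite lerXn2r ?nnegrE.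
have yb : y + 3 * b <= 5 * b by move: d; rewrite ler_norml; lra.
have : `|y - b| ^+ 3 * (y + 3 * b) <= (1 / 4) ^+ 3 * (5 * b).
  by apply: ler_pM => //; rewrite ?exprn_ge0 //; lra.
move=> hh; apply: (@le_trans _ _ (m / (4 * b ^+ 2) * ((1 / 4) ^+ 3 * (5 * b)))).
  by rewrite ler_pM2l // divr_gt0 ?mulr_gt0 ?exprn_gt0.
have -> : m / (4 * b ^+ 2) * ((1 / 4) ^+ 3 * (5 * b)) = 5 / 256 * (m / b).
  by field; rewrite gt_eqF.
have -> : m / (32 * b) = 1 / 32 * (m / b) by field; rewrite gt_eqF.
by rewrite ler_pM2r ?divr_gt0 //; lra.
Qed.

End Blocks.

(** * A block around an interior integer frequency *)

(** The window is split at [A] and both halves are indexed by their distance to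
    [A], in which the two halves of the Gaussian agree up to an offset. *)
Lemma sum_window (V : nmodType) (F : nat -> V) (P : pred nat) (A B T : nat) :
  (B <= A)%N -> (A + B <= T)%N -> (forall a, (A - B <= a < A + B)%N -> P a) ->
  \sum_(a < T | P a && ((A - B <= a)%N && (a < A + B)%N)) F a
  = \sum_(k < B) F (A - k.+1)%N + \sum_(k < B) F (A + k)%N.
Proof.
move=> BA ABT hP.
rewrite -(big_mkord (fun a => P a && ((A - B <= a)%N && (a < A + B)%N)) F).
rewrite (@big_cat_nat _ _ _ (A - B)) //=; last by lia.
rewrite (@big_cat_nat _ _ _ A (A - B)) //=; [|lia|lia].
rewrite (@big_cat_nat _ _ _ (A + B) A) //=; [|lia].
rewrite [X in X + _]big_nat_cond [X in X + _]big1 ?add0r; last first.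
  by move=> a; lia.
rewrite [X in _ + (_ + X)]big_nat_cond [X in _ + (_ + X)]big1 ?addr0; last first.
  by move=> a; lia.
congr (_ + _).
  rewrite big_nat_cond (eq_bigl (fun a => (A - B <= a < A)%N && true)); last first.
    move=> a; rewrite andbT; apply/andP/idP => [[]//|ha].
    by rewrite hP; [split=> //; lia | lia].
  rewrite -big_nat_cond big_nat_rev /= -{1}(add0n (A - B)%N) big_addn.
  have -> : (A - (A - B) = B)%N by lia.
  by rewrite big_mkord; apply: eq_bigr => k _; congr F; lia.
rewrite big_nat_cond (eq_bigl (fun a => (A <= a < A + B)%N && true)); last first.
  move=> a; rewrite andbT; apply/andP/idP => [[]//|ha].
  by rewrite hP; [split=> //; lia | lia].
rewrite -big_nat_cond -{1}(add0n A) big_addn addKn big_mkord.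
by apply: eq_bigr => k _; rewrite addnC.
Qed.

Section InteriorBlock.
Variable R : realType.
Variables (s H : R) (h bot top m Q r : nat).
Hypothesis s_big : 100 * 100 <= s.
Hypothesis sH : s <= H.
Hypothesis H3 : H ^+ 3 <= s ^+ 4.
Hypothesis h_lo : H <= 2 * h%:R.
Hypothesis h_hi : h%:R <= H.
Hypothesis Q_lo : 100 * H <= Q%:R * s.
Hypothesis Q_hi : Q%:R * s <= 101 * H.
Hypothesis r_gt0 : (0 < r)%N.
Hypothesis bot_lo : s ^+ 2 / 2 <= bot%:R.
Hypothesis top_hi : top%:R <= s ^+ 2.
Hypothesis m_hi : m%:R + 1 / 2 <= phase_diff R h bot.
Hypothesis m_lo : phase_diff R h top < m%:R - 1 / 2.

(** The derivative of the phase equals [m] at [b ^+ 2]; the window consists of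
    the [2 B] integers around this point. *)
Variable b : R.
Hypothesis b_def : b = h%:R / (2 * m%:R).
Variables A B : nat.
Hypothesis B_def : B = (h %/ Q)%N.
Hypothesis A_def : A = (Num.truncn (b ^+ 2)).+1.

Let s0 : 0 < s. Proof. by move: s_big; lra. Qed.
Let H0 : 0 < H. Proof. by move: s0 sH; lra. Qed.
Let H10 : 10 * H <= s ^+ 2.
Proof. by apply: le_small => //; move: s_big; lra. Qed.
Let h0 : 0 < h%:R :> R. Proof. by move: H0 h_lo; lra. Qed.
Let m0 : 0 < m%:R :> R.
Proof. by have := phase_diff_ge0 R h top; move: m_lo; lra. Qed.
Let b0 : 0 < b. Proof. by rewrite b_def divr_gt0 // mulr_gt0. Qed.
Let hE : h%:R = 2 * m%:R * b.
Proof. by rewrite b_def; field; rewrite gt_eqF. Qed.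
Let mE : m%:R = h%:R / (2 * b).
Proof. by rewrite hE; field; rewrite gt_eqF. Qed.

Let s2_big : 100 * 100 * s <= s ^+ 2.
Proof. by rewrite expr2 ler_pM2r. Qed.

Let bot0 : (0 < bot)%N.
Proof. by rewrite -(ltr_nat R); move: bot_lo s2_big s0; lra. Qed.

Let b_lo : s / 2 <= b.
Proof.
apply: (@le_trans _ _ (Num.sqrt bot%:R)).
  apply: sqrt_nat_ge; first by rewrite divr_ge0 // ltW.
  rewrite expr_div_n; move: bot_lo (sqr_ge0 s).
  by have -> : (2 : R) ^+ 2 = 4 by [ring]; lra.
have q0 : 0 < Num.sqrt (bot%:R : R) by apply: sqrt_nat_gt0.
have := le_trans m_hi (@phase_diff_le R h bot bot0).
rewrite hE ler_pdivlMr ?mulr_gt0 // => hh.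
rewrite leNgt; apply/negP => hc.
have : m%:R * b < m%:R * Num.sqrt bot%:R by rewrite ltr_pM2l.
by move: hh q0; lra.
Qed.

Let b_hi : b <= 2 * s.
Proof.
apply: (@le_trans _ _ (Num.sqrt top.+1%:R)); last first.
  apply: sqrt_nat_le; first by move: s0; lra.
  rewrite -natr1 exprMn; have -> : (2 : R) ^+ 2 = 4 by ring.
  by move: top_hi s2_big s_big; lra.
have q0 : 0 < Num.sqrt (top.+1%:R : R) by apply: sqrt_nat_gt0.
have := le_lt_trans (@phase_diff_ge R h top) m_lo.
rewrite {1}hE ltr_pdivrMr ?mulr_gt0 // => hh.
rewrite leNgt; apply/negP => hc.
have : m%:R * Num.sqrt top.+1%:R < m%:R * b by rewrite ltr_pM2l.
by move: hh q0; lra.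
Qed.

Let Q0 : (0 < Q)%N.
Proof.
rewrite lt0n; apply/eqP => QE; move: Q_lo; rewrite QE mul0r.
by move: H0; lra.
Qed.

Let B_hi : B%:R <= s / 100.
Proof.
have BQ : B%:R * Q%:R <= h%:R :> R by rewrite B_def -natrM ler_nat leq_divM.
have b1 : B%:R * (100 * H) <= B%:R * (Q%:R * s) by apply: ler_wpM2l.
have b2 : B%:R * Q%:R * s <= h%:R * s by rewrite ler_pM2r.
have b3 : h%:R * s <= H * s by rewrite ler_pM2r.
have : B%:R * 100 * H <= s * H by move: b1 b2 b3; lra.
by rewrite ler_pM2r //; lra.
Qed.

Let B_lo : s / 300 <= B%:R - 1.
Proof.
have BQ : h%:R < (B%:R + 1) * Q%:R :> R.
  by rewrite B_def natr1 -natrM ltr_nat ltn_ceil.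
have b1 : (B%:R + 1) * (Q%:R * s) <= (B%:R + 1) * (101 * H).
  by apply: ler_wpM2l => //; rewrite natr1.
have b2 : h%:R * s < (B%:R + 1) * Q%:R * s by rewrite ltr_pM2r.
have b3 : H * s <= 2 * h%:R * s by rewrite ler_pM2r.
have : s * H < (B%:R + 1) * 202 * H by move: b1 b2 b3; lra.
by rewrite ltr_pM2r //; move: s_big; lra.
Qed.

Let A_lo : b ^+ 2 < A%:R. Proof. by rewrite A_def; exact: truncnS_gt. Qed.
Let A_hi : A%:R <= b ^+ 2 + 1.
Proof. by rewrite A_def -natr1 lerD2r truncn_le sqr_ge0. Qed.

Let b2_lo : s ^+ 2 / 4 <= b ^+ 2.
Proof.
have : (s / 2) ^+ 2 <= b ^+ 2.
  by rewrite lerXn2r // nnegrE ltW // divr_gt0.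
by rewrite expr_div_n; have -> : (2 : R) ^+ 2 = 4 by ring.
Qed.

(** The whole window lies in the block of [m]: across it the derivative moves by
    much less than [1/2]. *)
Let window_nearest_freq (a : nat) : b ^+ 2 - (B%:R + 1) <= a%:R -> a%:R <= b ^+ 2 + B%:R ->
  nearest_freq R h a = m.
Proof.
move=> ha1 ha2; apply/eqP; rewrite nearest_freq_eq.
have s3 : 0 < (s / 3) by rewrite divr_gt0.
have key : h%:R * (B%:R + 1) / (4 * (s / 3) ^+ 3) <= 1 / 3.
  rewrite ler_pdivrMr ?mulr_gt0 ?exprn_gt0 //.
  have -> : 1 / 3 * (4 * (s / 3) ^+ 3) = 4 / 81 * (s ^+ 2 * s) by field.
  have k1 : B%:R + 1 <= s / 50 by move: B_hi s_big; lra.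
  have k2 : h%:R * (B%:R + 1) <= H * (s / 50).
    by apply: ler_pM => //; rewrite ?natr1 ?ler0n.
  have k3 : 10 * H * s <= s ^+ 2 * s by rewrite ler_pM2r.
  by move: k2 k3 (mulr_gt0 H0 s0); lra.
have a0 : (0 < a)%N.
  by rewrite -(ltr_nat R); move: ha1 b2_lo B_hi s2_big s_big; lra.
have u_lo : s / 3 <= Num.sqrt a%:R.
  apply: sqrt_nat_ge; first by rewrite ltW.
  rewrite expr_div_n; have -> : (3 : R) ^+ 2 = 9 by ring.
  by move: ha1 b2_lo B_hi s2_big s_big; lra.
have u0 : 0 < Num.sqrt (a%:R : R) by apply: sqrt_nat_gt0.
have uv := @sqrt_leS R a.
have v0 := lt_le_trans u0 uv.
have sq (k : nat) : Num.sqrt (k%:R : R) ^+ 2 = k%:R by rewrite sqr_sqrtr.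
have up : phase_diff R h a - m%:R <= 1 / 3.
  have := @phase_diff_le R h a a0; rewrite mE => h1.
  case: (lerP b (Num.sqrt a%:R)) => hb.
    have : h%:R / (2 * Num.sqrt a%:R) <= h%:R / (2 * b).
      by rewrite ler_pM2l // lef_pV2 ?posrE ?mulr_gt0 // ler_pM2l.
    by move: h1; lra.
  have := @inv_diff_le R h%:R (Num.sqrt a%:R) b (s / 3) (ltW h0) s3 u_lo (ltW hb).
  rewrite sq => h2.
  have : h%:R * (b ^+ 2 - a%:R) / (4 * (s / 3) ^+ 3) <= h%:R * (B%:R + 1) / (4 * (s / 3) ^+ 3).
    rewrite ler_pM2r ?invr_gt0 ?mulr_gt0 ?exprn_gt0 // ler_pM2l //.
    by move: ha1; lra.
  by move: key h1 h2; lra.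
have lo : m%:R - phase_diff R h a <= 1 / 3.
  have := @phase_diff_ge R h a; rewrite mE => h1.
  case: (lerP (Num.sqrt a.+1%:R) b) => hb.
    have : h%:R / (2 * b) <= h%:R / (2 * Num.sqrt a.+1%:R).
      by rewrite ler_pM2l // lef_pV2 ?posrE ?mulr_gt0 // ler_pM2l.
    by move: h1; lra.
  have b3 : s / 3 <= b by move: b_lo s0; lra.
  have := @inv_diff_le R h%:R b (Num.sqrt a.+1%:R) (s / 3) (ltW h0) s3 b3 (ltW hb).
  rewrite sq => h2; have aS : a.+1%:R = a%:R + 1 :> R by rewrite natr1.
  have : h%:R * (a.+1%:R - b ^+ 2) / (4 * (s / 3) ^+ 3) <= h%:R * (B%:R + 1) / (4 * (s / 3) ^+ 3).
    rewrite ler_pM2r ?invr_gt0 ?mulr_gt0 ?exprn_gt0 // ler_pM2l //.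
    by move: ha2; lra.
  by move: key h1 h2; lra.
by apply/andP; split; move: up lo; lra.
Qed.

Let block_bounds (a : nat) : nearest_freq R h a = m -> (bot <= a <= top)%N.
Proof.
move=> /eqP; rewrite nearest_freq_eq => /andP[h1 h2].
apply/andP; split; rewrite leqNgt; apply/negP => hc.
  have := @phase_diff_decr R h a bot (ltnW hc); move: m_hi h2; lra.
by have := @phase_diff_decr R h top a (ltnW hc); move: m_lo h1; lra.
Qed.

Let BA : (B < A)%N.
Proof.
by rewrite -(ltr_nat R); move: A_lo b2_lo B_hi s2_big s_big; lra.
Qed.

Let D : R := H / (200 * (100 * s ^+ 2)).
Let DV : 0 < 200 * (100 * s ^+ 2).
Proof. by have := exprn_gt0 2 s0; lra. Qed.
Let D0 : 0 < D. Proof. exact: divr_gt0. Qed.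
Let D1 : D <= 1 / 2.
Proof. by rewrite ler_pdivrMr //; move: H10 H0 s0; lra. Qed.

(** Leaving the window, of half length [B >= s/300], costs at least [D] in the
    derivative; this is where the constant in [D] comes from. *)
Let side_key : D <= h%:R * (B%:R - 1) / (4 * (2 * s) ^+ 3).
Proof.
rewrite ler_pdivlMr ?mulr_gt0 ?exprn_gt0 ?mulr_gt0 //.
have -> : D * (4 * (2 * s) ^+ 3) = 4 / 25 / 100 * (H * s).
  by rewrite /D; field; rewrite gt_eqF.
have : H / 2 * (s / 300) <= h%:R * (B%:R - 1).
  by apply: ler_pM; move: h_lo H0 s0 B_lo; lra.
by move: (mulr_gt0 H0 s0); lra.
Qed.

Let left_side (a : nat) : (a < A - B)%N -> D <= phase_diff R h a - m%:R.
Proof.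
move=> ha; have {}ha : (a.+1 + B <= A)%N by rewrite addSn addnC -ltn_subRL.
have {}ha : a.+1%:R + B%:R <= A%:R :> R by rewrite -natrD ler_nat.
have B1 : 1 <= B%:R :> R by move: B_lo s0; lra.
have ab : a.+1%:R <= b ^+ 2 by move: A_hi ha; lra.
have v0 : 0 < Num.sqrt (a.+1%:R : R) by apply: sqrt_nat_gt0.
have vb := @sqrt_nat_le R a.+1 b (ltW b0) ab.
have := @inv_diff_ge R h%:R _ b (2 * s) (ltW h0) v0 vb b_hi.
rewrite sqr_sqrtr ?ler0n // -mE => h1.
have := @phase_diff_ge R h a; move: side_key => h2 h3.
have : h%:R * (B%:R - 1) / (4 * (2 * s) ^+ 3) <=
       h%:R * (b ^+ 2 - a.+1%:R) / (4 * (2 * s) ^+ 3).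
  rewrite ler_pM2r ?invr_gt0 ?mulr_gt0 ?exprn_gt0 ?mulr_gt0 // ler_pM2l //.
  by move: A_hi ha; lra.
by move: h1 h2 h3; lra.
Qed.

Let right_side (a : nat) : (A + B <= a <= top)%N -> D <= m%:R - phase_diff R h a.
Proof.
move=> /andP[ha ta].
have {}ha : A%:R + B%:R <= a%:R :> R by rewrite -natrD ler_nat.
have {}ta : a%:R <= top%:R :> R by rewrite ler_nat.
have ab : b ^+ 2 <= a%:R by move: A_lo ha (ler0n R B); lra.
have a0 : (0 < a)%N by rewrite -(ltr_nat R); move: ab b2_lo s2_big s0; lra.
have bv := @sqrt_nat_ge R a b (ltW b0) ab.
have vs : Num.sqrt a%:R <= 2 * s.
  apply: sqrt_nat_le; first by move: s0; lra.
  rewrite exprMn; have -> : (2 : R) ^+ 2 = 4 by ring.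
  by move: ta top_hi s2_big s0; lra.
have := @inv_diff_ge R h%:R b _ (2 * s) (ltW h0) b0 bv vs.
rewrite sqr_sqrtr ?ler0n // -mE => h1.
have := @phase_diff_le R h a a0; move: side_key => h2 h3.
have : h%:R * (B%:R - 1) / (4 * (2 * s) ^+ 3) <=
       h%:R * (a%:R - b ^+ 2) / (4 * (2 * s) ^+ 3).
  rewrite ler_pM2r ?invr_gt0 ?mulr_gt0 ?exprn_gt0 ?mulr_gt0 // ler_pM2l //.
  by move: A_lo ha; lra.
by move: h1 h2 h3; lra.
Qed.

Let w0 : R[i] := e (h%:R ^+ 2 / (4 * m%:R)).
Let g (t : R) : R[i] := e (- (m%:R ^+ 3 * (t / h%:R) ^+ 2)).

Let taylor (a : nat) : `|a%:R - b ^+ 2| <= B%:R + 1 ->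
  nrm (e (root_phase R h a) - w0 * g (a%:R - b ^+ 2)) <= H / s ^+ 2.
Proof.
move=> hab; rewrite /w0 /g -eD.
(* The integer [m a] may be subtracted from the phase; this removes the linear
     term of the expansion. *)
have -> : e (root_phase R h a) = e (root_phase R h a - (m * a)%:R).
  by rewrite eD eN e_nat invr1 mulr1.
apply: le_trans (nrm_eB _ _) _.
set y : R := Num.sqrt a%:R.
have y2 : y ^+ 2 = a%:R by rewrite sqr_sqrtr.
have y0 : 0 <= y by exact: sqrtr_ge0.
have := @taylor_sqrt R m%:R b y m0 b0 y0.
have -> : 2 * m%:R * b * y - (m%:R * b ^+ 2 + m%:R * y ^+ 2 -
    m%:R / (4 * b ^+ 2) * (y ^+ 2 - b ^+ 2) ^+ 2)
   = root_phase R h a - (m * a)%:R - (h%:R ^+ 2 / (4 * m%:R) - m%:R ^+ 3 * ((a%:R - b ^+ 2) /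
       h%:R) ^+ 2).
  rewrite /root_phase -/y natrM -y2 hE; field.
  by rewrite !gt_eqF.
move=> h1; have {}h1 := h1 _ _.
have h2 : 8 * (m%:R / (32 * b)) <= H / s ^+ 2.
  have -> : 8 * (m%:R / (32 * b)) = h%:R / (8 * b ^+ 2).
    by rewrite hE; field; rewrite gt_eqF.
  rewrite ler_pdivrMr ?mulr_gt0 ?exprn_gt0 //.
  apply: (@le_trans _ _ (H / s ^+ 2 * (8 * (s ^+ 2 / 4)))).
    have -> : H / s ^+ 2 * (8 * (s ^+ 2 / 4)) = 2 * H by field; rewrite gt_eqF.
    by move: h_hi H0; lra.
  by rewrite ler_pM2l ?divr_gt0 ?exprn_gt0 // ler_pM2l.
apply: le_trans h2; rewrite ler_pM2l //; apply: h1.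
  by move: b_lo s_big; lra.
by rewrite y2; move: hab B_hi b_lo s_big; lra.
Qed.

(** The curvature of the phase near the centre of the window. *)
Let kappa : m%:R ^+ 3 / h%:R ^+ 2 <= H / s ^+ 3.
Proof.
have -> : m%:R ^+ 3 / h%:R ^+ 2 = h%:R / (8 * b ^+ 3).
  by rewrite hE; field; rewrite !gt_eqF.
rewrite ler_pdivrMr ?mulr_gt0 ?exprn_gt0 //.
apply: (@le_trans _ _ (H / s ^+ 3 * (8 * (s / 2) ^+ 3))).
  have -> : H / s ^+ 3 * (8 * (s / 2) ^+ 3) = H by field; rewrite gt_eqF.
  exact: h_hi.
rewrite ler_pM2l ?divr_gt0 ?exprn_gt0 // ler_pM2l //.
by rewrite lerXn2r // nnegrE ltW // divr_gt0.
Qed.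

Let g_lip (th : R) (k : nat) (t : R) : 0 <= th <= 1 -> (k < B)%N -> 0 <= t <= 1 ->
  nrm (g (k%:R + th) - g (k%:R + t)) <= H / s ^+ 2.
Proof.
move=> th01 kB t01; apply: le_trans (nrm_eB _ _) _.
have -> : - (m%:R ^+ 3 * ((k%:R + th) / h%:R) ^+ 2) -
     - (m%:R ^+ 3 * ((k%:R + t) / h%:R) ^+ 2)
   = m%:R ^+ 3 / h%:R ^+ 2 * ((t - th) * (2 * k%:R + t + th)).
  by field; rewrite gt_eqF.
rewrite normrM ger0_norm; last by rewrite divr_ge0 ?exprn_ge0.
rewrite normrM.
have kB' : k%:R + 1 <= B%:R :> R by rewrite natr1 ler_nat.
have n1 : `|t - th| <= 1 by rewrite ler_norml; lra.
have n2 : `|2 * k%:R + t + th| <= s / 50.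
  have k0 := ler0n R k; rewrite ger0_norm; last by lra.
  by move: B_hi kB'; lra.
have : `|t - th| * `|2 * k%:R + t + th| <= 1 * (s / 50) by apply: ler_pM.
rewrite mul1r => n3.
have : m%:R ^+ 3 / h%:R ^+ 2 * (`|t - th| * `|2 * k%:R + t + th|) <= H / s ^+ 3 * (s / 50).
  apply: ler_pM => //.
have -> : H / s ^+ 3 * (s / 50) = 1 / 50 * (H / s ^+ 2) by field; rewrite gt_eqF.
by have : 0 < H / s ^+ 2; [rewrite divr_gt0 ?exprn_gt0 | lra].
Qed.

Let half (th : R) : 0 <= th <= 1 ->
  nrm (\sum_(k < B) g (k%:R + th)
     - ((Q * r)%:R^-1)%:C%C * \sum_(j < h * r) g (j%:R / (Q * r)%:R))
  <= H / s + 1.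
Proof.
move=> th01.
have := @riemann_cmp R g (H / s ^+ 2) th h Q r Q0 r_gt0 th01 _ _.
rewrite -B_def => hh; apply: le_trans (hh _ _) _.
- by move=> t; rewrite nrm_e.
- by move=> k t kB t01; apply: g_lip.
rewrite lerD2r.
have -> : H / s = s * (H / s ^+ 2) by field; rewrite gt_eqF.
rewrite ler_pM2r ?divr_gt0 ?exprn_gt0 //.
by move: B_hi s0; lra.
Qed.

Let dual_weightE : h%:R%:C%C * dual_weight R Q (h * r) m =
  2%:R * (((Q * r)%:R^-1)%:C%C * \sum_(j < h * r) g (j%:R / (Q * r)%:R)).
Proof.
have hN : h%:R != 0 :> R by rewrite gt_eqF.
have QN : Q%:R != 0 :> R by rewrite pnatr_eq0 -lt0n.
have rN : r%:R != 0 :> R by rewrite pnatr_eq0 -lt0n.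
rewrite /dual_weight !mulrA; congr (_ * _).
  have -> : 2%:R = (2%:R : R)%:C%C by rewrite rmorph_nat.
  rewrite -!rmorphM /=; congr (_%:C%C).
  by rewrite !natrM; field; rewrite hN QN rN.
apply: eq_bigr => j _; rewrite /g; congr (e (- (_ * _ ^+ 2))).
by rewrite !natrM; field; rewrite hN QN rN.
Qed.

Let right_half :
  nrm (\sum_(k < B) e (root_phase R h (A + k)) - w0 * \sum_(k < B) g (k%:R + (A%:R - b ^+ 2)))
  <= H / s.
Proof.
rewrite mulr_sumr -sumrB; apply: le_trans (nrm_sum _ _ _) _.
apply: (@le_trans _ _ (\sum_(k < B) H / s ^+ 2)).
  apply: ler_sum => k _.
  have -> : k%:R + (A%:R - b ^+ 2) = (A + k)%:R - b ^+ 2 by rewrite natrD; ring.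
  apply: taylor; rewrite natrD ler_norml.
  have kB : k%:R <= B%:R :> R by rewrite ler_nat ltnW.
  by move: A_lo A_hi kB (ler0n R k) (ler0n R B); lra.
rewrite sumr_const card_ord -mulr_natl.
have -> : H / s = s * (H / s ^+ 2) by field; rewrite gt_eqF.
rewrite ler_pM2r ?divr_gt0 ?exprn_gt0 //.
by move: B_hi s0; lra.
Qed.

Let left_half :
  nrm (\sum_(k < B) e (root_phase R h (A - k.+1)) - w0 * \sum_(k < B) g (k%:R + (b ^+ 2 +
      1 - A%:R)))
  <= H / s.
Proof.
rewrite mulr_sumr -sumrB; apply: le_trans (nrm_sum _ _ _) _.
apply: (@le_trans _ _ (\sum_(k < B) H / s ^+ 2)).
  apply: ler_sum => k _.
  have kA : (k.+1 <= A)%N by apply: leq_trans (ltn_ord k) _; apply: ltnW.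
  have -> : g (k%:R + (b ^+ 2 + 1 - A%:R)) = g ((A - k.+1)%:R - b ^+ 2).
    rewrite /g natrB // -natr1; congr (e (- (_ * _))).
    by rewrite -[RHS]sqrrN; congr (_ ^+ 2); ring.
  apply: taylor; rewrite natrB // -natr1 ler_norml.
  have kB : k%:R + 1 <= B%:R :> R by rewrite natr1 ler_nat.
  by move: A_lo A_hi kB (ler0n R k) (ler0n R B); lra.
rewrite sumr_const card_ord -mulr_natl.
have -> : H / s = s * (H / s ^+ 2) by field; rewrite gt_eqF.
rewrite ler_pM2r ?divr_gt0 ?exprn_gt0 //.
by move: B_hi s0; lra.
Qed.

Let inblock (a : nat) := (bot <= a)%N && (nearest_freq R h a == m).

Let inblock_convex i j k : (i <= j <= k)%N -> inblock i -> inblock k -> inblock j.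
Proof.
move=> /andP[ij jk] /andP[bi /eqP ri] /andP[bk /eqP rk].
rewrite /inblock (leq_trans bi ij) /= eqn_leq -{1}ri -rk.
by rewrite !nearest_freq_anti.
Qed.

Let window_in (a : nat) : (A - B <= a < A + B)%N -> inblock a /\ (a <= top)%N.
Proof.
move=> /andP[h1 h2].
have h3 : A%:R - B%:R <= a%:R :> R by rewrite lerBlDr -natrD ler_nat addnC -leq_subLR.
have h4 : a%:R + 1 <= A%:R + B%:R :> R by rewrite natr1 -natrD ler_nat.
have e1 : nearest_freq R h a = m.
  by apply: window_nearest_freq; move: A_lo A_hi h3 h4; lra.
have /andP[e2 e3] := block_bounds e1.
by rewrite /inblock e1 eqxx e2 e3.
Qed.

Let window_top : (A + B <= top.+1)%N.
Proof.
have B1 : (0 < B)%N by rewrite -(ltr_nat R); move: B_lo s0; lra.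
have AB0 : (0 < A + B)%N by rewrite addn_gt0 B1 orbT.
have := @window_in (A + B).-1; case=> [|_]; last by rewrite -ltnS prednK.
rewrite prednK // leqnn andbT -ltnS prednK //.
by rewrite (leq_ltn_trans (leq_subr _ _)) // -{1}(addn0 A) ltn_add2l.
Qed.

Let H2 : H / s <= s ^+ 2 / H.
Proof.
rewrite ler_pdivrMr // mulrAC ler_pdivlMr //.
have := @sqr_le_cube R s H; rewrite -exprSr expr2; apply=> //.
by move: s_big; lra.
Qed.

(** The two sides of the window are Kusmin-Landau sums; in the window each half is
    compared first with its Gaussian and then with half of the dual weight, the
    halves being sampled at the fractional offsets [A - b^2] and [b^2 + 1 - A]. *)
Lemma interior_block :
  nrm (\sum_(a < top.+1 | (bot <= a)%N && (nearest_freq R h a == m)) e (root_phase R h a)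
     - h%:R%:C%C * dual_weight R Q (h * r) m * e (h%:R ^+ 2 / (4 * m%:R)))
  <= 100 * (100 * 20) * (s ^+ 2 / H).
Proof.
rewrite (bigID (fun a : 'I_top.+1 => (a < A - B)%N)) /=.
rewrite [X in _ + X - _](bigID (fun a : 'I_top.+1 => (a < A + B)%N)) /=.
set SL := \sum_(_ < _ | _) _.
rewrite (eq_bigl (fun a : 'I_top.+1 => inblock a && ((A - B <= a)%N && (a < A + B)%N)));
  last by move=> a; rewrite -leqNgt andbA.
rewrite (@sum_window _ (fun a => e (root_phase R h a)) inblock _ _ _ (ltnW BA) window_top);
    last first.
  by move=> a /window_in[].
set SR := \sum_(_ < top.+1 | _) _.
rewrite dual_weightE -/w0.
set G := _%:C%C * \sum_(j < h * r) _.
have nL : nrm SL <= 4 / D.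
  apply: (@kusmin_landau R (root_phase R h) (fun a => inblock a && (a < A - B)%N) _ m D) => //.
  - move=> i j k ijk _ /andP[pi iA] /andP[pk kA].
    rewrite (inblock_convex ijk) //=.
    by move/andP: ijk => [_ /leq_ltn_trans]; apply.
  - by move=> a; apply: phase_diff_decr.
  left=> a _ /andP[/andP[_ ra] aA]; rewrite left_side //=.
  by move: ra; rewrite nearest_freq_eq /phase_diff; lra.
have nR : nrm SR <= 4 / D.
  apply: (@kusmin_landau R (root_phase R h) (fun a =>
      inblock a && ~~ (a < A - B)%N && ~~ (a < A + B)%N) _ m D) => //.
  - move=> i j k ijk _ /andP[/andP[pi iA] iB] /andP[/andP[pk kA] kB].
    rewrite (inblock_convex ijk) //= -!leqNgt; rewrite -!leqNgt in iA iB.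
    by move/andP: ijk => [ij _]; rewrite (leq_trans iA) // (leq_trans iB).
  - by move=> a; apply: phase_diff_decr.
  right=> a aT /andP[/andP[/andP[_ ra] _] aA]; rewrite right_side /=;
      last by rewrite leqNgt aA -ltnS.
  by move: ra; rewrite nearest_freq_eq /phase_diff; lra.
have th1 : 0 <= A%:R - b ^+ 2 <= 1 by move: A_lo A_hi; lra.
have th2 : 0 <= b ^+ 2 + 1 - A%:R <= 1 by move: A_lo A_hi; lra.
have r1 := half th1; have r2 := half th2.
rewrite -/G in r1 r2.
have t1 := right_half; have t2 := left_half.
set X1 := \sum_(k < B) e (root_phase R h (A + k)) in t1 *.
set X2 := \sum_(k < B) e (root_phase R h (A - k.+1)) in t2 *.
set Y1 := \sum_(k < B) _ in t1 r1; set Y2 := \sum_(k < B) _ in t2 r2.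
have -> : SL + (X2 + X1 + SR) - 2%:R * G * w0
  = SL + (SR + ((X1 - w0 * Y1) + ((X2 - w0 * Y2) + (w0 * (Y1 - G) + w0 * (Y2 - G))))).
  by ring.
have nw z : nrm (w0 * z) = nrm z by rewrite Normc.normcM nrm_e mul1r.
apply: le_trans (le_normcD _ _) _.
apply: le_trans (lerD (lexx _) (le_normcD _ _)) _.
apply: le_trans (lerD (lexx _) (lerD (lexx _) (le_normcD _ _))) _.
apply: le_trans (lerD (lexx _) (lerD (lexx _) (lerD (lexx _) (le_normcD _ _)))) _.
apply: le_trans (lerD (lexx _) (lerD (lexx _) (lerD (lexx _) (lerD (lexx _) (le_normcD _ _))))) _.
rewrite !nw.
have DE : 4 / D = 100 * (100 * 8) * (s ^+ 2 / H).
  by rewrite /D; field; rewrite !gt_eqF.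
have Hs : 1 <= H / s by rewrite ler_pdivlMr // mul1r.
by rewrite DE in nL nR; move: nL nR r1 r2 t1 t2 Hs H2; lra.
Qed.

End InteriorBlock.

(** * The dual sum for one frequency h *)

Lemma sum_ord_restrict (V : nmodType) (P : pred nat) (F : nat -> V) (N N' : nat) :
  (forall m, P m -> (m < N)%N /\ (m < N')%N) ->
  \sum_(m < N | P m) F m = \sum_(m < N' | P m) F m.
Proof.
wlog NN : N N' / (N <= N')%N => [hw|] hP.
  case/orP: (leq_total N N') => h; first exact: hw.
  by rewrite (hw _ _ h) // => m /hP [].
rewrite (big_ord_widen_cond N') //; apply: eq_bigl => m.
by apply: andb_idr => /hP [].
Qed.

Lemma sum_indic_le1 (R : realType) (K c : nat) :
  \sum_(m < K) ((m : nat) == c)%:R <= 1 :> R.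
Proof.
case: (ltnP c K) => cK; last first.
  rewrite big1 // => m _; apply/eqP; rewrite pnatr_eq0 eqb0.
  by rewrite neq_ltn (leq_trans (ltn_ord m) cK).
rewrite (bigD1 (Ordinal cK)) //= eqxx big1 ?addr0 // => m.
by rewrite -val_eqE /= => /negbTE ->.
Qed.

Section PerFrequency.
Variable R : realType.
Variables (s H : R) (h bot top Q r : nat).
Hypothesis s_big : 100 * 100 <= s.
Hypothesis sH : s <= H.
Hypothesis H3 : H ^+ 3 <= s ^+ 4.
Hypothesis h_lo : H <= 2 * h%:R.
Hypothesis h_hi : h%:R <= H.
Hypothesis Q_lo : 100 * H <= Q%:R * s.
Hypothesis Q_hi : Q%:R * s <= 101 * H.
Hypothesis r_gt0 : (0 < r)%N.
Hypothesis bot_lo : s ^+ 2 / 2 <= bot%:R.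
Hypothesis top_hi : top%:R <= s ^+ 2.

Let s0 : 0 < s. Proof. by move: s_big; lra. Qed.
Let H0 : 0 < H. Proof. by move: s0 sH; lra. Qed.
Let H10 : 10 * H <= s ^+ 2.
Proof. by apply: le_small => //; move: s_big; lra. Qed.
Let h0 : 0 < h%:R :> R. Proof. by move: H0 h_lo; lra. Qed.
Let s2_big : 100 * 100 * s <= s ^+ 2.
Proof. by rewrite expr2 ler_pM2r. Qed.

(** The integers [m] whose block avoids both ends of the summation range.  The
    condition is stated with [nearest_freq] at the two ends because it then
    describes an interval in [h] for fixed [m]. *)
Definition interior_freq (h bot top m : nat) := (nearest_freq R h top < m)%N &&
    (m < nearest_freq R h bot)%N.

Let block (m : nat) := \sum_(a < top.+1 | (bot <= a)%N &&
    (nearest_freq R h a == m)) e (root_phase R h a).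

Let sqrt_top : Num.sqrt (top.+1%:R : R) <= 2 * s.
Proof.
apply: sqrt_nat_le; first by move: s0; lra.
have -> : top.+1%:R = top%:R + 1 :> R by rewrite natr1.
rewrite exprMn; have -> : (2 : R) ^+ 2 = 4 by ring.
by move: top_hi s2_big s_big; lra.
Qed.

(** Used for the blocks cut by an end of the range, which have no clean main term.  Where the
    derivative is within [H / s^2] of [m] there are only [O(s)] points, because
    consecutive derivatives differ by at least about [H / s^3]; elsewhere
    Kusmin-Landau gives [O(s^2 / H)], which is at most [O(s)]. *)
Lemma edge_block m : nrm (block m) <= 140 * s.
Proof.
pose D := H / s ^+ 2.
have D0 : 0 < D by rewrite divr_gt0 // exprn_gt0.
have D1 : D <= 1 / 2.
  by rewrite ler_pdivrMr ?exprn_gt0 //; move: H10 H0; lra.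
rewrite /block (bigID (fun a : 'I_top.+1 => D <= phase_diff R h a - m%:R)) /=.
rewrite [X in _ + X](bigID (fun a : 'I_top.+1 => D <= m%:R - phase_diff R h a)) /=.
have rdd a : nearest_freq R h a == m -> m%:R - phase_diff R h a <=
    1 / 2 /\ phase_diff R h a - m%:R <= 1 / 2.
  by rewrite nearest_freq_eq; lra.
have cv i j k : (i <= j <= k)%N -> (bot <= i)%N && (nearest_freq R h i == m) ->
    (bot <= k)%N && (nearest_freq R h k == m) -> (bot <= j)%N && (nearest_freq R h j == m).
  move=> /andP[ij jk] /andP[bi /eqP ri] /andP[bk /eqP rk].
  rewrite (leq_trans bi ij) /= eqn_leq -{1}ri -rk.
  by rewrite !nearest_freq_anti.
have DE : 4 / D <= 4 * s.
  rewrite ler_pdivrMr // /D.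
  have -> : 4 * s * (H / s ^+ 2) = 4 * (H / s) by field; rewrite gt_eqF.
  by have : 1 <= H / s; [rewrite ler_pdivlMr ?mul1r | lra].
apply: le_trans (le_normcD _ _) _.
apply: le_trans (lerD (lexx _) (le_normcD _ _)) _.
have n1 : nrm (\sum_(a < top.+1 | (bot <= a)%N && (nearest_freq R h a == m) &&
    (D <= phase_diff R h a - m%:R))
   e (root_phase R h a)) <= 4 / D.
  apply: (@kusmin_landau R (root_phase R h) (fun a =>
      (bot <= a)%N && (nearest_freq R h a == m) && (D <= phase_diff R h a - m%:R)) _ m D) => //.
  - move=> i j k ijk _ /andP[pi iA] /andP[pk kA]; rewrite (cv _ _ _ ijk) //=.
    by move/andP: ijk => [_ /(@phase_diff_decr R h)]; move: kA; lra.
  - by move=> a; apply: phase_diff_decr.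
  left=> a _ /andP[/andP[_ /rdd[_ ra]] aA].
  by apply/andP; split.
have n2 : nrm (\sum_(a < top.+1 | (bot <= a)%N && (nearest_freq R h a == m) &&
    ~~ (D <= phase_diff R h a - m%:R)
      && (D <= m%:R - phase_diff R h a)) e (root_phase R h a)) <= 4 / D.
  apply: (@kusmin_landau R (root_phase R h) (fun a =>
      (bot <= a)%N && (nearest_freq R h a == m) && ~~ (D <= phase_diff R h a - m%:R) &&
      (D <= m%:R - phase_diff R h a)) _ m D) => //.
  - move=> i j k ijk _ /andP[/andP[pi iA] iB] /andP[/andP[pk kA] kB];
      rewrite (cv _ _ _ ijk) //= -ltNge.
    rewrite -ltNge in iA.
    by move/andP: ijk => [/(@phase_diff_decr R h) q _]; move: iA iB q; lra.
  - by move=> a; apply: phase_diff_decr.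
  right=> a _ /andP[/andP[/andP[_ /rdd[ra _]] _] aA].
  by apply/andP; split.
(* The derivatives at two such points differ by less than [2 D]. *)
have n3 : nrm (\sum_(a < top.+1 | (bot <= a)%N && (nearest_freq R h a == m) &&
    ~~ (D <= phase_diff R h a - m%:R)
      && ~~ (D <= m%:R - phase_diff R h a)) e (root_phase R h a)) <= (Num.truncn (128 * s)).+1%:R.
  apply: (@nrm_sum_le1 R (fun a => e (root_phase R h a)) (fun a =>
      (bot <= a)%N && (nearest_freq R h a == m) && ~~ (D <= phase_diff R h a - m%:R) &&
      ~~ (D <= m%:R - phase_diff R h a))) => //.
  - by move=> a; rewrite nrm_e.
  - move=> i j k ijk _ /andP[/andP[pi iA] iB] /andP[/andP[pk kA] kB];
      rewrite (cv _ _ _ ijk) //= -!ltNge.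
    rewrite -!ltNge in iA iB kA kB.
    move/andP: ijk => [/(@phase_diff_decr R h) q /(@phase_diff_decr R h) q'].
    by apply/andP; split; move: iA kB q q'; lra.
  - move=> i k /andP[ik kT] /andP[/andP[pi iA] iB] /andP[/andP[pk kA] kB].
    rewrite -!ltNge in iA iB kA kB.
    rewrite truncn_ge_nat; last by move: s0; lra.
    have := @phase_diff_gap R h i (k - i) (2 * s); rewrite subnKC //.
    move=> hh; have {}hh := hh _.
    have : (k - i)%:R * (h%:R / (4 * (2 * s) ^+ 3)) <= 2 * D.
      apply: le_trans (hh _) _; last by move: iA kB; lra.
      apply: le_trans sqrt_top; rewrite ler_wsqrtr // ler_nat.
      exact: kT.
    rewrite mulrA ler_pdivrMr ?mulr_gt0 ?exprn_gt0 ?mulr_gt0 //.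
    have -> : 2 * D * (4 * (2 * s) ^+ 3) = 64 * s * H.
      by rewrite /D; field; rewrite gt_eqF.
    move=> h1; rewrite -(ler_pM2r h0); apply: le_trans h1 _.
    have : s * H <= s * (2 * h%:R) by rewrite ler_pM2l.
    lra.
have n4 : (Num.truncn (128 * s)).+1%:R <= 128 * s + 1.
  by rewrite -natr1 lerD2r truncn_le mulr_ge0 // ltW.
by move: n1 n2 n3 n4 DE s_big; lra.
Qed.

Lemma interior_freq_bounds m : interior_freq h bot top m ->
  [/\ m%:R + 1 / 2 <= phase_diff R h bot, phase_diff R h top < m%:R - 1 / 2,
      (m <= Num.truncn (H / s)%R)%N & H / (8 * s) <= m%:R].
Proof.
move=> /andP[m1 m2].
have d0 := phase_diff_ge0 R h top; have d1 := phase_diff_ge0 R h bot.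
have lo : phase_diff R h top < m%:R - 1 / 2.
  have : phase_diff R h top + 1 / 2 < (nearest_freq R h top).+1%:R by apply: truncnS_gt.
  have : (nearest_freq R h top).+1%:R <= m%:R :> R by rewrite ler_nat.
  lra.
have hi : m%:R + 1 / 2 <= phase_diff R h bot.
  have : (nearest_freq R h bot)%:R <= phase_diff R h bot + 1 / 2 by rewrite truncn_le; lra.
  have : m%:R + 1 <= (nearest_freq R h bot)%:R :> R by rewrite natr1 ler_nat.
  lra.
have b0 : (0 < bot)%N by rewrite -(ltr_nat R); move: bot_lo s2_big s0; lra.
split=> //.
  rewrite truncn_ge_nat ?(divr_ge0 (ltW H0) (ltW s0)) // ler_pdivlMr //.
  have q0 : 0 < Num.sqrt (bot%:R : R) by apply: sqrt_nat_gt0.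
  have : s / 2 <= Num.sqrt (bot%:R : R).
    apply: sqrt_nat_ge; first by move: s0; lra.
    rewrite expr_div_n; move: bot_lo (sqr_ge0 s).
    by have -> : (2 : R) ^+ 2 = 4 by [ring]; lra.
  have := le_trans hi (@phase_diff_le R h bot b0).
  rewrite ler_pdivlMr ?mulr_gt0 // => h1 h2.
  have h3 : m%:R * (s / 2) <= m%:R * Num.sqrt (bot%:R : R) by apply: ler_wpM2l.
  by move: h1 h3 q0 h_hi; lra.
rewrite ler_pdivrMr ?mulr_gt0 //.
have q0 : 0 < Num.sqrt (top.+1%:R : R) by apply: sqrt_nat_gt0.
have := le_lt_trans (@phase_diff_ge R h top) lo.
rewrite ltr_pdivrMr ?mulr_gt0 // => h1.
have h3 : m%:R * Num.sqrt (top.+1%:R : R) <= m%:R * (2 * s) by apply: ler_wpM2l.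
by move: h1 h3 q0 h_lo; lra.
Qed.

(** The interior blocks contribute [O(H / s)] errors of size [O(s^2 / H)]; besides
    them only the blocks containing the two ends of the range are nonempty. *)
Lemma exp_sum_approx :
  nrm (\sum_(a < top.+1 | (bot <= a)%N) e (root_phase R h a)
   - h%:R%:C%C * \sum_(m < (Num.truncn (H / s)).+1 | interior_freq h bot top m)
        dual_weight R Q (h * r) m * e (h%:R ^+ 2 / (4 * m%:R)))
  <= 100 * (100 * 41) * s.
Proof.
set X := (Num.truncn _).+1; set K := (nearest_freq R h bot).+1.
have part : \sum_(a < top.+1 | (bot <= a)%N) e (root_phase R h a) = \sum_(m < K) block m.
  rewrite (partition_big (fun a : 'I_top.+1 => inord (nearest_freq R h a) : 'I_K) predT) //=.
  apply: eq_bigr => m _; apply: eq_bigl => a; apply: andb_id2l => ba.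
  by rewrite -val_eqE /= inordK // ltnS nearest_freq_anti.
rewrite part (bigID (fun m : 'I_K => interior_freq h bot top m)) /=.
rewrite mulr_sumr -(@sum_ord_restrict _ (interior_freq h bot top) (fun m =>
    h%:R%:C%C * (dual_weight R Q (h * r) m * e (h%:R ^+ 2 / (4 * m%:R)))) K X); last first.
  move=> m fm; have [_ _ mX _] := interior_freq_bounds fm; split=> //.
  by case/andP: fm => _ /ltnW.
rewrite addrAC -sumrB; apply: le_trans (le_normcD _ _) _.
have n1 : nrm (\sum_(m < K | interior_freq h bot top m)
     (block m - h%:R%:C%C * (dual_weight R Q (h * r) m * e (h%:R ^+ 2 / (4 * m%:R)))))
   <= 100 * (100 * 40) * s.
  apply: le_trans (nrm_sum _ _ _) _.
  rewrite (@sum_ord_restrict _ (interior_freq h bot top) (fun m =>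
      nrm (block m - h%:R%:C%C * (dual_weight R Q (h * r) m * e (h%:R ^+ 2 / (4 * m%:R))))) K
      X); last first.
    move=> m fm; have [_ _ mX _] := interior_freq_bounds fm; split=> //.
    by case/andP: fm => _ /ltnW.
  apply: (@le_trans _ _ (\sum_(m < X) 100 * (100 * 20) * (s ^+ 2 / H))).
    rewrite big_mkcond; apply: ler_sum => m _; case: ifP => fm; last first.
      by rewrite mulr_ge0 // divr_ge0 ?exprn_ge0 ?ltW.
    have [f1 f2 _ _] := interior_freq_bounds fm.
    rewrite mulrA; exact: (@interior_block R s H h bot top m Q r s_big sH H3 h_lo h_hi Q_lo
        Q_hi r_gt0 bot_lo top_hi f1 f2 _ erefl).
  rewrite sumr_const card_ord -[_ *+ X]mulr_natl.
  have XH : X%:R <= 2 * (H / s).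
    have : X%:R <= H / s + 1.
      by rewrite /X -natr1 lerD2r truncn_le (divr_ge0 (ltW H0) (ltW s0)).
    by have : 1 <= H / s; [rewrite ler_pdivlMr ?mul1r | lra].
  apply: (@le_trans _ _ (2 * (H / s) * (100 * (100 * 20) * (s ^+ 2 / H)))).
    by rewrite ler_pM2r // mulr_gt0 // divr_gt0 // exprn_gt0.
  have -> : 2 * (H / s) * (100 * (100 * 20) * (s ^+ 2 / H)) = 100 * (100 * 40) * s.
    by field; rewrite !gt_eqF.
  by [].
have n2 : nrm (\sum_(m < K | ~~ interior_freq h bot top m) block m) <= 280 * s.
  apply: le_trans (nrm_sum _ _ _) _.
  apply: (@le_trans _ _ (\sum_(m < K) 140 * s * (((m : nat) == nearest_freq R h top)%:R +
      ((m : nat) == nearest_freq R h bot)%:R))).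
    rewrite big_mkcond; apply: ler_sum => m _.
    have p0 : 0 <= 140 * s * (((m : nat) == nearest_freq R h top)%:R +
        ((m : nat) == nearest_freq R h bot)%:R).
      by rewrite mulr_ge0 ?mulr_ge0 ?addr_ge0 ?ler0n // ltW.
    case: ifP => // nf.
    have edge := edge_block m.
    case: eqP => e1; first by rewrite mulrDr mulr1; apply: le_trans edge _;
        rewrite lerDl mulr_ge0 ?ler0n ?mulr_ge0 ?ltW.
    case: eqP => e2; first by rewrite add0r mulr1.
    rewrite addr0 mulr0 /block big1 ?Normc.normc0 // => a /andP[ba /eqP ra].
    case/negP: nf; apply/andP; split; rewrite ltn_neqAle; apply/andP; split.
    - by apply/eqP => q; apply: e1.
    - by rewrite -ra nearest_freq_anti // -ltnS.
    - by apply/eqP.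
    - by rewrite -ra nearest_freq_anti.
  rewrite -mulr_sumr big_split /=.
  have i1 := sum_indic_le1 R K (nearest_freq R h top);
      have i2 := sum_indic_le1 R K (nearest_freq R h bot).
  apply: (@le_trans _ _ (140 * s * (1 + 1))).
    by rewrite ler_pM2l ?mulr_gt0 //; apply: lerD.
  by lra.
by move: n1 n2 s0; lra.
Qed.

End PerFrequency.

(** * Weyl differencing *)

(** Multiplication by [a] permutes the residues modulo [q]. *)
Lemma coprime_perm_sum (V : nmodType) (a q : nat) (G : nat -> V) :
  (0 < q)%N -> coprime a q ->
  \sum_(i < q) G ((a * i) %% q)%N = \sum_(i < q) G i.
Proof.
move=> q0 cop.
have lt i : ((a * i) %% q < q)%N by rewrite ltn_pmod.
pose f (i : 'I_q) : 'I_q := Ordinal (lt i).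
have f_inj : injective f.
  move=> i j /(congr1 val) /= /eqP eqm; apply: val_inj => /=.
  wlog ij : i j eqm / (i <= j)%N => [hw|].
    case/orP: (leq_total i j) => h; first exact: hw.
    by apply/esym/hw => //; rewrite eq_sym.
  move: eqm; rewrite eq_sym eqn_mod_dvd ?leq_mul2l ?ij ?orbT //.
  rewrite -mulnBr Gauss_dvdr; last by rewrite coprime_sym.
  case: (posnP (j - i)%N) => [/eqP|p]; first by rewrite subn_eq0 => ji _; apply/eqP;
      rewrite eqn_leq ij.
  by move/(dvdn_leq p); have := ltn_ord j; lia.
by rewrite [RHS](reindex_inj f_inj).
Qed.

Section Weyl.
Variable R : realType.

Definition harm_sum (n : nat) : R := \sum_(i < n) i.+1%:R^-1.

(** Weyl differencing: expand the square and sort the pairs by their difference. *)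
Lemma van_der_corput_sqr (z : nat -> R[i]) (l : nat) :
  nrm (\sum_(i < l) z i) ^+ 2 <= \sum_(i < l) nrm (z i) ^+ 2
   + 2 * \sum_(k < l) nrm (\sum_(j < l - k.+1) z (j + k.+1)%N * (z j)^*%C).
Proof.
pose E l := \sum_(k < l) \sum_(j < l - k.+1) z (j + k.+1)%N * (z j)^*%C.
have ES n : E n.+1 = E n + z n * ((\sum_(i < n) z i)^*)%C.
  rewrite /E big_ord_recr /= subnn big_ord0 addr0.
  rewrite conj_sum [X in _ = _ + _ * X](reindex_inj rev_ord_inj) /= mulr_sumr -big_split /=.
  apply: eq_bigr => k _; rewrite subSS -subnSK // big_ord_recr /=.
  by rewrite subnK.
have key : (nrm (\sum_(i < l) z i) ^+ 2)%:C%C =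
    \sum_(i < l) (nrm (z i) ^+ 2)%:C%C + (E l + (E l)^*%C).
  elim: l => [|n IH].
    rewrite /E !big_ord0 Normc.normc0 expr0n; apply/eqP.
    by rewrite eq_complex /= oppr0 !addr0 !eqxx.
  rewrite nrm_sqr !big_ord_recr /= nrm_sqr.
  move: IH; rewrite nrm_sqr ES => IH.
  rewrite !(rmorphD (@conjc R)) (rmorphM (@conjc R)) /= conjcK.
  set S := \sum_(i < n) z i in IH *; set W := \sum_(i < n) _ in IH *.
  have -> : (S + z n) * ((S^*)%C + ((z n)^*)%C) = S * (S^*)%C + (S * ((z n)^*)%C +
      z n * (S^*)%C + z n * ((z n)^*)%C) by ring.
  by rewrite IH; ring.
have -> : nrm (\sum_(i < l) z i) ^+ 2 = nrm ((nrm (\sum_(i < l) z i) ^+ 2)%:C%C).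
  by rewrite nrm_real ger0_norm // exprn_ge0 // nrm_ge0.
rewrite key; apply: le_trans (le_normcD _ _) _; apply: lerD.
  apply: le_trans (nrm_sum _ _ _) _; apply: ler_sum => i _.
  by rewrite nrm_real ger0_norm // exprn_ge0 // nrm_ge0.
apply: le_trans (le_normcD _ _) _; rewrite nrm_conj.
have : nrm (E l) <= \sum_(k < l) nrm (\sum_(j < l - k.+1) z (j + k.+1)%N * (z j)^*%C).
  exact: nrm_sum.
lra.
Qed.

Lemma geom_sum_le (x : R) (n : nat) : e x != 1 ->
  nrm (\sum_(j < n) e x ^+ j) <= 2 / nrm (e x - 1).
Proof.
move=> ex; have n0 : e x - 1 != 0 by rewrite subr_eq0.
have p0 : 0 < nrm (e x - 1).
  rewrite lt0r nrm_ge0 andbT; apply/eqP => /Normc.eq0_normc h.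
  by rewrite h eqxx in n0.
rewrite ler_pdivlMr // mulrC -Normc.normcM -subrX1 -eMn.
by apply: le_trans (le_normcD _ _) _; rewrite normcN Normc.normc1 nrm_e.
Qed.

(** For [b > 0], [q/b + q/(q - b)] majorizes the reciprocal of the distance from [b/q] to the
    nearest integer without a case distinction. *)
Definition geom_majorant (N q b : nat) : R :=
  if b == 0 then N%:R else q%:R / b%:R + q%:R / (q - b)%:R.

Lemma geom_sum_rational_le (N q b n : nat) : (n <= N)%N -> (b < q)%N ->
  nrm (\sum_(j < n) e (b%:R / q%:R : R) ^+ j) <= geom_majorant N q b.
Proof.
move=> nN bq; rewrite /geom_majorant; case: eqP => [|/eqP b0].
  move=> _; apply: le_trans (nrm_sum _ _ _) _.
  apply: (@le_trans _ _ (\sum_(j < n) 1)).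
    by apply: ler_sum => j _; rewrite nrmX nrm_e expr1n.
  by rewrite sumr_const card_ord ler_nat.
have b0' : 0 < b%:R :> R by rewrite ltr0n lt0n.
have q0 : 0 < q%:R :> R by rewrite ltr0n; apply: leq_trans bq.
have qb0 : 0 < (q - b)%:R :> R by rewrite ltr0n subn_gt0.
set x : R := b%:R / q%:R.
suff [y [ey yl yb]] : exists y : R, [/\ e x = e y,
    0 < y \/ 0 < - y & 2 * `|y| <= nrm (e y - 1) /\ (q%:R / b%:R = `|y|^-1 \/ q%:R / (q -
    b)%:R = `|y|^-1)].
  have ny : 0 < `|y| by rewrite normr_gt0; case: yl => h; apply/eqP => yy; move: h;
      rewrite yy ?oppr0 ltxx.
  case: yb => yb1 yb2.
  have h1 : 2 / nrm (e y - 1) <= `|y|^-1.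
    have -> : `|y|^-1 = 2 / (2 * `|y|) by field; rewrite gt_eqF.
    rewrite ler_pM2l // lef_pV2 ?posrE ?mulr_gt0 //.
    by apply: lt_le_trans yb1; rewrite mulr_gt0.
  have ney : e y != 1.
    apply/eqP => ey1; move: yb1; rewrite ey1 subrr Normc.normc0; lra.
  rewrite ey; apply: le_trans (geom_sum_le _ ney) _; apply: le_trans h1 _.
  have p1 : 0 < q%:R / b%:R :> R by rewrite divr_gt0.
  have p2 : 0 < q%:R / (q - b)%:R :> R by rewrite divr_gt0.
  by case: yb2 => <-; lra.
have x0 : 0 < x by rewrite divr_gt0.
case: (lerP x (1 / 2)) => hx.
  exists x; split=> //; first by left.
  split; first by apply: nrm_e_sub1_ge; rewrite ger0_norm // ltW.
  by left; rewrite ger0_norm ?ltW // invf_div.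
have x1 : x < 1 by rewrite ltr_pdivrMr // mul1r ltr_nat.
exists (x - 1); split.
- by rewrite eD eN (e_nat R 1) invr1 mulr1.
- by right; lra.
have nx : `|x - 1| = 1 - x by rewrite ltr0_norm; lra.
split; first by apply: nrm_e_sub1_ge; rewrite nx; lra.
right; rewrite nx /x natrB ?(ltnW bq) //; field.
by rewrite (gt_eqF q0) -natrB ?(ltnW bq) // (gt_eqF qb0).
Qed.

Lemma sum_inv_lt_le_harm (q : nat) : \sum_(i < q | (0 < i)%N) i%:R^-1 <= harm_sum q.
Proof.
case: q => [|q]; first by rewrite big_ord0 /harm_sum big_ord0.
rewrite big_mkcond big_ord_recl /= add0r /harm_sum [leRHS]big_ord_recr /=.
by rewrite lerDl invr_ge0.
Qed.

Lemma geom_majorant_sum (N q : nat) : (0 < q)%N ->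
  \sum_(i < q) geom_majorant N q i <= N%:R + 2 * q%:R * harm_sum q.
Proof.
move=> q0.
have -> : \sum_(i < q) geom_majorant N q i = N%:R +
   (q%:R * \sum_(i < q | (0 < i)%N) i%:R^-1 + q%:R * \sum_(i < q | (0 < i)%N) (q - i)%:R^-1).
  rewrite !mulr_sumr -big_split /=.
  rewrite (bigD1 (Ordinal q0)) //= /geom_majorant /=; congr (_ + _).
  have pe (i : 'I_q) : (i != Ordinal q0) = (0 < i)%N by rewrite -val_eqE /= lt0n.
  rewrite (eq_bigl _ _ pe); apply: eq_bigr => i; rewrite lt0n => /negbTE.
  by move=> ->.
have h1 := sum_inv_lt_le_harm q.
have h2 : \sum_(i < q | (0 < i)%N) (q - i)%:R^-1 <= harm_sum q.
  rewrite /harm_sum [leRHS](reindex_inj rev_ord_inj) /=.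
  rewrite big_mkcond; apply: ler_sum => i _.
  rewrite subnSK //; case: ifP => // _; by rewrite invr_ge0.
have q0' : 0 <= q%:R :> R by [].
have := ler_wpM2l q0' h1; have := ler_wpM2l q0' h2.
lra.
Qed.

(** After differencing, the inner sums are geometric with ratio [e(a k / q)].  As
    [k] runs over a full period the residues [a k] modulo [q] take each value once,
    so a period contributes [N + q log q], and there are about [N / q] periods.
    The leading coefficient enters only through [2 th] modulo [1], whence the
    integer [c]. *)
Lemma weyl_bound (P : pred nat) (N a q c : nat) (th T : R) :
  (forall i j k, (i <= j <= k)%N -> (k < N)%N -> P i -> P k -> P j) ->
  (0 < q)%N -> coprime a q -> 2 * th + c%:R = a%:R / q%:R ->
  (q <= 2 * N)%N -> harm_sum q <= T -> 1 <= T ->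
  nrm (\sum_(h < N | P h) e (th * h%:R ^+ 2)) ^+ 2 <= 32 * T * (N%:R ^+ 2 / q%:R).
Proof.
move=> cP q0 cop thE qN hT T1.
have qR : 0 < q%:R :> R by rewrite ltr0n.
have [p [len [plN Pk sumE]]] := sum_convex_pred cP.
rewrite (sumE _ (fun h => e (th * h%:R ^+ 2))).
have lN : (len <= N)%N by apply: leq_trans plN; rewrite leq_addl.
apply: le_trans (van_der_corput_sqr (fun i => e (th * (p + i)%:R ^+ 2)) len) _.
have s1 : \sum_(i < len) nrm (e (th * (p + i)%:R ^+ 2)) ^+ 2 <= N%:R.
  rewrite (eq_bigr (fun=> 1)) => [|i _]; last by rewrite nrm_e expr1n.
  by rewrite sumr_const card_ord ler_nat.
have inner (k : nat) :
  nrm (\sum_(j < len - k.+1) e (th * (p + (j + k.+1))%:R ^+ 2) * (e (th * (p + j)%:R ^+ 2))^*%C)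
  <= geom_majorant N q ((a * k.+1) %% q).
  have -> : \sum_(j < len - k.+1) e (th * (p + (j + k.+1))%:R ^+ 2) * (e (th * (p +
      j)%:R ^+ 2))^*%C
    = e (th * (k.+1%:R ^+ 2 + 2 * k.+1%:R * p%:R)) *
      \sum_(j < len - k.+1) e (((a * k.+1) %% q)%:R / q%:R) ^+ j.
    rewrite mulr_sumr; apply: eq_bigr => j _.
    rewrite conj_e -eMn -!eD.
    have -> : e (th * (p + (j + k.+1))%:R ^+ 2 - th * (p + j)%:R ^+ 2) =
       e (th * (p + (j + k.+1))%:R ^+ 2 - th * (p + j)%:R ^+ 2 + (c * k.+1 * j)%:R).
      by rewrite [RHS]eD e_nat mulr1.
    have -> : e (th * (k.+1%:R ^+ 2 + 2 * k.+1%:R * p%:R) + ((a * k.+1) %% q)%:R / q%:R * j%:R)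
      = e (th * (k.+1%:R ^+ 2 + 2 * k.+1%:R * p%:R) + ((a * k.+1) %% q)%:R / q%:R * j%:R +
          ((a * k.+1) %/ q * j)%:R).
      by rewrite [RHS]eD e_nat mulr1.
    congr e.
    have dv : ((a * k.+1) %% q)%:R = a%:R * k.+1%:R - ((a * k.+1) %/ q)%:R * q%:R :> R.
      have dq : (a * k.+1)%:R = ((a * k.+1) %/ q)%:R * q%:R + ((a * k.+1) %% q)%:R :> R.
        by rewrite -natrM -natrD -divn_eq.
      by rewrite -natrM dq; ring.
    have aE : a%:R = (2 * th + c%:R) * q%:R by rewrite thE divfK ?gt_eqF.
    rewrite dv aE !natrD !natrM.
    by field; rewrite gt_eqF.
  rewrite Normc.normcM nrm_e mul1r; apply: geom_sum_rational_le.
    by apply: leq_trans lN; rewrite leq_subr.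
  by rewrite ltn_pmod.
(* [B] periods cover the shifts [1, .., N]. *)
set B := (N %/ q).+1.
have s2 : \sum_(k < len) nrm (\sum_(j < len - k.+1) e (th * (p + (j +
    k.+1))%:R ^+ 2) * (e (th * (p + j)%:R ^+ 2))^*%C)
   <= B%:R * (N%:R + 2 * q%:R * harm_sum q).
  apply: (@le_trans _ _ (\sum_(k < len) geom_majorant N q ((a * k.+1) %% q))).
    by apply: ler_sum => k _; apply: inner.
  have gp b : 0 <= geom_majorant N q b.
    by rewrite /geom_majorant; case: ifP => _ //; rewrite addr_ge0 // divr_ge0.
  apply: (@le_trans _ _ (\sum_(k < B * q) geom_majorant N q ((a * k) %% q))).
    apply: (@le_trans _ _ (\sum_(k < len.+1) geom_majorant N q ((a * k) %% q))).
      by rewrite big_ord_recl /= lerDr.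
    rewrite (big_ord_widen (B * q) (fun k => geom_majorant N q ((a * k) %% q))).
      by rewrite big_mkcond; apply: ler_sum => k _; case: ifP.
    by apply: leq_ltn_trans lN _; rewrite /B ltn_ceil.
  rewrite (sum_blocks (fun k => geom_majorant N q ((a * k) %% q))).
  rewrite (eq_bigr (fun=> \sum_(i < q) geom_majorant N q i)).
    by rewrite sumr_const card_ord -[_ *+ B]mulr_natl ler_wpM2l // geom_majorant_sum.
  move=> k _; rewrite -(coprime_perm_sum (geom_majorant N q) q0 cop).
  by apply: eq_bigr => i _; rewrite mulnDr mulnA modnMDl.
have qN' : q%:R <= 2 * N%:R :> R by rewrite -natrM ler_nat.
have BN : B%:R <= 3 * (N%:R / q%:R) :> R.
  have : (N %/ q)%:R <= N%:R / q%:R :> R.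
    by rewrite ler_pdivlMr // -natrM ler_nat leq_divM.
  have : 1 / 2 <= N%:R / q%:R :> R by rewrite ler_pdivlMr //; lra.
  have -> : B%:R = (N %/ q)%:R + 1 :> R by rewrite natr1.
  lra.
have NN : N%:R <= 2 * (N%:R ^+ 2 / q%:R) :> R.
  have -> : 2 * (N%:R ^+ 2 / q%:R) = N%:R * (2 * N%:R) / q%:R :> R by field; rewrite gt_eqF.
  by rewrite ler_pdivlMr // ler_wpM2l.
have h0 : 0 <= harm_sum q by apply: sumr_ge0 => i _; rewrite invr_ge0.
have k1 : N%:R + 2 * q%:R * harm_sum q <= N%:R * (1 + 4 * T) .
  have : q%:R * harm_sum q <= 2 * N%:R * T by apply: ler_pM.
  lra.
have k2 : B%:R * (N%:R + 2 * q%:R * harm_sum q) <= 3 * (N%:R / q%:R) * (N%:R * (1 + 4 * T)).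
  by apply: ler_pM => //; rewrite addr_ge0 // !mulr_ge0.
have k3 : 3 * (N%:R / q%:R) * (N%:R * (1 + 4 * T)) = (3 + 12 * T) * (N%:R ^+ 2 / q%:R) :> R.
  by field; rewrite gt_eqF.
have k4 : 0 <= N%:R ^+ 2 / q%:R :> R by rewrite divr_ge0 // exprn_ge0.
have k5 : N%:R ^+ 2 / q%:R <= T * (N%:R ^+ 2 / q%:R) by rewrite ler_peMl.
apply: le_trans (lerD s1 (ler_wpM2l _ s2)) _ => //.
by rewrite k3 in k2; move: k2 NN k5; lra.
Qed.

End Weyl.

(** * Differences of sums of two unit fractions *)

Section EgyptianFractions.
Local Open Scope nat_scope.

(** Numerator and denominator of [1/m1 + 1/m2] in lowest terms. *)
Definition pair_num (m1 m2 : nat) := (m1 + m2) %/ gcdn (m1 * m2) (m1 + m2).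
Definition pair_den (m1 m2 : nat) := (m1 * m2) %/ gcdn (m1 * m2) (m1 + m2).

Lemma pair_gcd_gt0 m1 m2 : 0 < m1 -> 0 < gcdn (m1 * m2) (m1 + m2).
Proof. by move=> h; rewrite gcdn_gt0 addn_gt0 h orbT. Qed.

Lemma pair_den_gt0 m1 m2 : 0 < m1 -> 0 < m2 -> 0 < pair_den m1 m2.
Proof.
move=> h1 h2; rewrite divn_gt0 ?pair_gcd_gt0 // dvdn_leq ?muln_gt0 ?h1 //.
exact: dvdn_gcdl.
Qed.

Lemma pair_den_le X m1 m2 : m1 <= X -> m2 <= X -> pair_den m1 m2 <= X ^ 2.
Proof. by move=> h1 h2; rewrite (leq_trans (leq_div _ _)) // -mulnn leq_mul. Qed.

Lemma pair_coprime m1 m2 : 0 < m1 -> coprime (pair_num m1 m2) (pair_den m1 m2).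
Proof.
move=> h1; have g0 := @pair_gcd_gt0 m1 m2 h1.
rewrite /coprime -(eqn_pmul2r g0) mul1n muln_gcdl.
by rewrite !divnK ?dvdn_gcdl ?dvdn_gcdr // gcdnC.
Qed.

(** Write [m1 = g u] and [m2 = g v] with [u], [v] coprime, and [d = gcd (g, u + v)].
    Then the reduced denominator is [(g / d) u v], from which [(m1, m2)] is
    recovered by choosing the divisors [u], [v] of it and the divisor [d] of
    [u + v]. *)
Lemma pair_den_fiber m1 m2 : 0 < m1 -> 0 < m2 ->
  exists u v d, [/\ u %| pair_den m1 m2, v %| pair_den m1 m2, d %| u + v &
    m1 = pair_den m1 m2 %/ (u * v) * d * u /\ m2 = pair_den m1 m2 %/ (u * v) * d * v].
Proof.
move=> h1 h2; set g := gcdn m1 m2.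
have g0 : 0 < g by rewrite gcdn_gt0 h1.
pose u := m1 %/ g; pose v := m2 %/ g; pose d := gcdn g (u + v).
have uE : m1 = u * g by rewrite divnK // dvdn_gcdl.
have vE : m2 = v * g by rewrite divnK // dvdn_gcdr.
have u0 : 0 < u by move: h1; rewrite {1}uE muln_gt0 => /andP[].
have v0 : 0 < v by move: h2; rewrite {1}vE muln_gt0 => /andP[].
have cuv : coprime u v.
  by rewrite /coprime -(eqn_pmul2r g0) mul1n muln_gcdl -uE -vE.
have d0 : 0 < d by rewrite gcdn_gt0 g0.
have dg : d %| g by apply: dvdn_gcdl.
have cs : coprime (u + v) (u * v).
  rewrite coprimeMr; apply/andP; split.
    by rewrite coprime_sym /coprime gcdnDl.
  by rewrite coprime_sym /coprime gcdnDr gcdnC.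
have denE : pair_den m1 m2 = (g %/ d) * (u * v).
  rewrite /pair_den {1 2}uE {1 2}vE uE vE.
  have -> : u * g * (v * g) = (g * (u * v)) * g by ring.
  rewrite -mulnDl -muln_gcdl divnMr //.
  rewrite gcdnC Gauss_gcdl // gcdnC -/d.
  by rewrite -{1}(divnK dg) -mulnA [d * _]mulnC mulnA mulnK.
exists u, v, d; rewrite denE; split.
- by rewrite mulnA mulnAC dvdn_mull.
- by rewrite mulnA dvdn_mull.
- exact: dvdn_gcdr.
- by rewrite mulnK ?muln_gt0 ?u0 // divnK // ![g * _]mulnC.
Qed.

Lemma size_flatten_le (A : eqType) (B : Type) (f : A -> seq B) (s : seq A) c :
  (forall x, x \in s -> size (f x) <= c) ->
  size (flatten [seq f x | x <- s]) <= size s * c.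
Proof.
elim: s => //= x s IH h; rewrite size_cat mulSn leq_add ?h ?mem_head //.
by apply: IH => y ys; apply: h; rewrite in_cons ys orbT.
Qed.

Definition pair_set (X beta : nat) : {set 'I_X.+1 * 'I_X.+1} :=
  [set p : 'I_X.+1 * 'I_X.+1 | [&& 0 < p.1, 0 < p.2 & pair_den p.1 p.2 == beta]].

Lemma card_pair_set (X beta T : nat) :
  (forall k, 0 < k <= 2 * X ^ 2 -> size (divisors k) <= T) ->
  #|pair_set X beta| <= T ^ 3.
Proof.
move=> hT; have [->|[p0]] := set_0Vmem (pair_set X beta); first by rewrite cards0.
rewrite inE => /and3P[p1 p2 /eqP pb].
have beta0 : 0 < beta by rewrite -pb pair_den_gt0.
have betaX : beta <= X ^ 2 by rewrite -pb; apply: pair_den_le; rewrite -ltnS.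
(* All pairs that [pair_den_fiber] can produce for the denominator [beta]. *)
pose L := flatten [seq flatten [seq [seq (beta %/ (u * v) * d * u, beta %/ (u * v) * d * v)
   | d <- divisors (u + v)] | v <- divisors beta] | u <- divisors beta].
pose vals (p : 'I_X.+1 * 'I_X.+1) : nat * nat := (val p.1, val p.2).
have vi : injective vals by move=> [a b] [c d] [/val_inj -> /val_inj ->].
rewrite cardE -(size_map vals).
have db : size (divisors beta) <= T.
  by apply: hT; rewrite beta0 (leq_trans betaX) // leq_pmull.
apply: (@leq_trans (size L)); last first.
  apply: leq_trans (@size_flatten_le _ _ _ _ (T * T) _) _; last first.
    by rewrite expnS -mulnn leq_mul2r db orbT.
  move=> u; rewrite -dvdn_divisors // => ub.
  apply: leq_trans (@size_flatten_le _ _ _ _ T _) _; last first.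
    by rewrite leq_mul2r db orbT.
  move=> v; rewrite -dvdn_divisors // => vb; rewrite size_map; apply: hT.
  rewrite addn_gt0 (dvdn_gt0 beta0 ub) /= mul2n -addnn.
  by rewrite leq_add // (leq_trans _ betaX) // dvdn_leq.
apply: uniq_leq_size; first by rewrite map_inj_uniq // enum_uniq.
move=> x /mapP[p]; rewrite mem_enum inE => /and3P[q1 q2 /eqP dq] ->.
have [u [v [d [ub vb ds [e1 e2]]]]] := pair_den_fiber q1 q2.
rewrite dq in ub vb e1 e2.
apply/flatten_mapP; exists u; first by rewrite -dvdn_divisors.
apply/flatten_mapP; exists v; first by rewrite -dvdn_divisors.
apply/mapP; exists d; last by rewrite /vals -e1 -e2.
by rewrite -dvdn_divisors // addn_gt0 (dvdn_gt0 beta0 ub).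
Qed.

Section Difference.
Variables m1 m2 m3 m4 : nat.
Hypotheses (h1 : 0 < m1) (h2 : 0 < m2) (h3 : 0 < m3) (h4 : 0 < m4).
Let B := pair_den m1 m2.
Let E := pair_den m3 m4.
Let t := gcdn B E.
Definition cofactor_l := B %/ t.
Definition cofactor_r := E %/ t.
Let D := 2 * t * (cofactor_l * cofactor_r).
(** The fraction [diff_num / (2 t b b')] represents [rho / 2] modulo [1]; the second
    summand replaces a negative term, by adding an integer, so that everything
    stays a natural number. *)
Definition diff_num := pair_num m1 m2 * cofactor_r + pair_num m3 m4 * (D - cofactor_l).
Definition diff_gcd := gcdn (2 * t) diff_num.
Definition diff_quot := (2 * t) %/ diff_gcd.
Definition diff_den := cofactor_l * cofactor_r * diff_quot.
Definition diff_red_num := diff_num %/ diff_gcd.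

Let B0 : 0 < B. Proof. exact: pair_den_gt0. Qed.
Let E0 : 0 < E. Proof. exact: pair_den_gt0. Qed.
Let t0 : 0 < t. Proof. by rewrite gcdn_gt0 B0. Qed.
Let bE : cofactor_l * t = B. Proof. by rewrite divnK // dvdn_gcdl. Qed.
Let eE : cofactor_r * t = E. Proof. by rewrite divnK // dvdn_gcdr. Qed.

Lemma cofactor_l_gt0 : 0 < cofactor_l. Proof. by move: B0; rewrite -bE muln_gt0 => /andP[]. Qed.
Lemma cofactor_r_gt0 : 0 < cofactor_r. Proof. by move: E0; rewrite -eE muln_gt0 => /andP[]. Qed.
Lemma diff_gcd_gt0 : 0 < diff_gcd. Proof. by rewrite gcdn_gt0 muln_gt0 t0. Qed.
Lemma diff_quot_gcdE : diff_quot * diff_gcd = 2 * t. Proof. by rewrite divnK // dvdn_gcdl. Qed.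
Lemma diff_quot_gt0 : 0 < diff_quot.
Proof. by have : 0 < diff_quot * diff_gcd;
    [rewrite diff_quot_gcdE muln_gt0 | rewrite muln_gt0 => /andP[]]. Qed.
Lemma diff_quot_gcd_lE : diff_quot * diff_gcd * cofactor_l = 2 * pair_den m1 m2.
Proof. by rewrite diff_quot_gcdE -mulnA [t * _]mulnC bE. Qed.
Lemma diff_quot_gcd_rE : diff_quot * diff_gcd * cofactor_r = 2 * pair_den m3 m4.
Proof. by rewrite diff_quot_gcdE -mulnA [t * _]mulnC eE. Qed.

Let cbe : coprime cofactor_l cofactor_r.
Proof. by rewrite /coprime -(eqn_pmul2r t0) mul1n muln_gcdl bE eE. Qed.

Let numE : diff_num + pair_num m3 m4 * cofactor_l = pair_num m1 m2 * cofactor_r +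
    pair_num m3 m4 * D.
Proof.
rewrite /diff_num -addnA -mulnDr subnK // /D mulnCA leq_pmulr // !muln_gt0 t0 cofactor_r_gt0.
by [].
Qed.

Let cb_num : coprime cofactor_l diff_num.
Proof.
have bB : cofactor_l %| B by apply/dvdnP; exists t; rewrite mulnC bE.
set d := gcdn cofactor_l diff_num; have db : d %| cofactor_l by apply: dvdn_gcdl.
have dn : d %| diff_num by apply: dvdn_gcdr.
have : d %| pair_num m1 m2 * cofactor_r + pair_num m3 m4 * D.
  by rewrite -numE dvdn_add // dvdn_mull.
rewrite dvdn_addl; last by apply: dvdn_mull; apply: dvdn_mull; apply: dvdn_mulr.
move=> h; have : d %| gcdn cofactor_l (pair_num m1 m2 * cofactor_r) by rewrite dvdn_gcd db.
have /eqP -> : coprime cofactor_l (pair_num m1 m2 * cofactor_r).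
  rewrite coprimeMr cbe andbT coprime_sym.
  exact: coprime_dvdr bB (pair_coprime _ h1).
by rewrite dvdn1.
Qed.

Let ce_num : coprime cofactor_r diff_num.
Proof.
have eEd : cofactor_r %| E by apply/dvdnP; exists t; rewrite mulnC eE.
set d := gcdn cofactor_r diff_num; have de : d %| cofactor_r by apply: dvdn_gcdl.
have dn : d %| diff_num by apply: dvdn_gcdr.
have : d %| diff_num + pair_num m3 m4 * cofactor_l.
  by rewrite numE dvdn_add // dvdn_mull // /D dvdn_mull // dvdn_mull.
rewrite dvdn_addr // => h.
have : d %| gcdn cofactor_r (pair_num m3 m4 * cofactor_l) by rewrite dvdn_gcd de.
have /eqP -> : coprime cofactor_r (pair_num m3 m4 * cofactor_l).
  rewrite coprimeMr [coprime cofactor_r cofactor_l]coprime_sym cbe andbT coprime_sym.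
  exact: coprime_dvdr eEd (pair_coprime _ h3).
by rewrite dvdn1.
Qed.

Lemma diff_den_gt0 : 0 < diff_den. Proof. by rewrite !muln_gt0 cofactor_l_gt0 cofactor_r_gt0
    diff_quot_gt0. Qed.

Lemma diff_coprime : coprime diff_red_num diff_den.
Proof.
have aE : diff_red_num * diff_gcd = diff_num by rewrite divnK // dvdn_gcdr.
rewrite coprimeMr coprimeMr; apply/andP; split; last first.
  by rewrite /coprime -(eqn_pmul2r diff_gcd_gt0) mul1n muln_gcdl aE diff_quot_gcdE gcdnC.
have an : diff_red_num %| diff_num by rewrite -aE dvdn_mulr.
by apply/andP; split; rewrite coprime_sym;
    [apply: coprime_dvdr an cb_num | apply: coprime_dvdr an ce_num].
Qed.

(** The denominator divides [2 t b b'], twice the least common multiple of the two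
    pair denominators. *)
Lemma diff_den_le X : m1 <= X -> m2 <= X -> m3 <= X -> m4 <= X -> diff_den <= 2 * X ^ 4.
Proof.
move=> l1 l2 l3 l4.
have BX : B <= X ^ 2 by apply: pair_den_le.
have EX : E <= X ^ 2 by apply: pair_den_le.
have uq : diff_quot <= 2 * t by apply: leq_div.
apply: (@leq_trans (cofactor_l * cofactor_r * (2 * t))); first by rewrite leq_mul2l uq orbT.
have -> : cofactor_l * cofactor_r * (2 * t) = 2 * (cofactor_l * t * cofactor_r) by ring.
rewrite bE.
rewrite leq_mul2l /= (expnD X 2 2) leq_mul //.
by apply: leq_trans EX; apply: leq_div.
Qed.

Lemma diff_frac (R : realType) :
  (2 * ((m1%:R^-1 + m2%:R^-1 - m3%:R^-1 - m4%:R^-1) / 4) + (pair_num m3 m4)%:R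
   = diff_red_num%:R / diff_den%:R :> R)%R.
Proof.
have pos n : 0 < n -> (n%:R != 0 :> R)%R by rewrite pnatr_eq0 -lt0n.
have frac n n' : 0 < n -> 0 < n' ->
    (n%:R^-1 + n'%:R^-1 = (pair_num n n')%:R / (pair_den n n')%:R :> R)%R.
  move=> n0 n0'; have g0 := @pair_gcd_gt0 n n' n0.
  have e1 : pair_num n n' * gcdn (n * n') (n + n') = n + n' by rewrite divnK // dvdn_gcdr.
  have e2 : pair_den n n' * gcdn (n * n') (n + n') = n * n' by rewrite divnK // dvdn_gcdl.
  have -> : ((pair_num n n')%:R / (pair_den n n')%:R = (n%:R + n'%:R) / (n%:R * n'%:R) :> R)%R.
    rewrite -natrD -natrM; move: e1 e2 g0; move: (gcdn _ _) => g <- <- g0.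
    by rewrite !natrM; field; rewrite !pos // pair_den_gt0.
  by field; rewrite !pos.
have -> : (m1%:R^-1 + m2%:R^-1 - m3%:R^-1 - m4%:R^-1 =
   (m1%:R^-1 + m2%:R^-1) - (m3%:R^-1 + m4%:R^-1) :> R)%R by ring.
rewrite !frac // -/B -/E.
have -> : (diff_red_num%:R / diff_den%:R = diff_num%:R / (2 * t%:R * (cofactor_l%:R *
    cofactor_r%:R)) :> R)%R.
  have -> : (2 * t%:R = diff_quot%:R * diff_gcd%:R :> R)%R by rewrite -!natrM diff_quot_gcdE.
  have -> : (diff_num%:R = diff_red_num%:R * diff_gcd%:R :> R)%R by rewrite -natrM divnK //
      dvdn_gcdr.
  by rewrite /diff_den !natrM; field; rewrite !pos ?cofactor_l_gt0 ?cofactor_r_gt0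
      ?diff_quot_gt0 ?diff_gcd_gt0.
have nE : (diff_num%:R = (pair_num m1 m2)%:R * cofactor_r%:R +
    (pair_num m3 m4)%:R * (2 * t%:R * (cofactor_l%:R * cofactor_r%:R)) - (pair_num m3 m4)%:R
    * cofactor_l%:R :> R)%R.
  by rewrite -!natrM -natrD -numE natrD addrK.
have BR : (B%:R = cofactor_l%:R * t%:R :> R)%R by rewrite -natrM bE.
have ER : (E%:R = cofactor_r%:R * t%:R :> R)%R by rewrite -natrM eE.
rewrite nE BR ER.
by field; rewrite !pos ?cofactor_l_gt0 ?cofactor_r_gt0.
Qed.

End Difference.
End EgyptianFractions.

(** * Summing over quadruples *)

Section QuadrupleSum.
Variable R : realType.

(** Change of variables for a map whose fibres have at most [T] elements. *)
Lemma sum_fiber_le (A V : finType) (PA : pred A) (Q : pred V) (phi : A -> V)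
    (F : V -> R) (T : nat) :
  (forall x, PA x -> Q (phi x)) -> (forall v, Q v -> 0 <= F v) ->
  (forall v, Q v -> (#|[set x | PA x && (phi x == v)]| <= T)%N) ->
  \sum_(x | PA x) F (phi x) <= T%:R * \sum_(v | Q v) F v.
Proof.
move=> hQ F0 hT; rewrite (partition_big phi Q) //= mulr_sumr.
apply: ler_sum => v Qv.
rewrite (eq_bigr (fun=> F v)) => [|x /andP[_ /eqP ->] //].
rewrite sumr_const -[_ *+ _]mulr_natl ler_wpM2r ?F0 // ler_nat.
by apply: leq_trans (hT v Qv); rewrite leq_eqVlt -cardsE eqxx.
Qed.

Lemma count_le (N w : nat) : (\sum_(g < N | 0 < g <= w) 1 <= w)%N.
Proof.
suff : (\sum_(g < N | 0 < g <= w) 1 <= minn w N.-1)%N by move=> h; lia.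
elim: N => [|N IH]; first by rewrite big_ord0.
rewrite big_mkcond /= in IH; rewrite big_mkcond big_ord_recr /=.
by move: (\sum_(i < N) _)%N IH => S IH; case: ifP; lia.
Qed.

Lemma sum_inv_eq_harm (Z : nat) : \sum_(i < Z.+1) (i%:R : R)^-1 = harm_sum R Z.
Proof. by rewrite big_ord_recl /= invr0 add0r. Qed.

Definition inv_sqrt_prod (b b' u : nat) : R := (Num.sqrt (b * b' * u)%:R)^-1.

(** The conditions bound [g] by [Y / (u sqrt (b b'))], the geometric mean of the two
    constraints.  When [b], [b'] or [u] vanishes both sides are zero, as the
    inverse of [0] is [0]. *)
Lemma sum_inv_sqrt_prod_le (Y b b' u N : nat) :
  \sum_(g < N | [&& 0 < b, 0 < b', 0 < u, 0 < g, u * g * b <= Y & u * g * b' <= Y]%N)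
     inv_sqrt_prod b b' u <= Y%:R * (b%:R^-1 * (b'%:R^-1 * u%:R^-1)).
Proof.
case: (posnP b) => [->|b0] /=; first by rewrite big_pred0 // invr0 mul0r mulr0.
case: (posnP b') => [->|c0] /=.
  by rewrite big_pred0 // invr0 !(mul0r, mulr0).
case: (posnP u) => [->|u0] /=; first by rewrite big_pred0 // invr0 !mulr0.
have b0' : 0 < b%:R :> R by rewrite ltr0n.
have c0' : 0 < b'%:R :> R by rewrite ltr0n.
have u0' : 0 < u%:R :> R by rewrite ltr0n.
set r : R := Num.sqrt (b%:R * b'%:R).
have r2 : r * r = b%:R * b'%:R by rewrite -expr2 sqr_sqrtr // mulr_ge0.
have r0 : 0 < r by rewrite sqrtr_gt0 mulr_gt0.
pose w := Num.truncn (Y%:R / (u%:R * r)).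
have W0 : 0 <= Y%:R / (u%:R * r) by rewrite divr_ge0 // mulr_ge0 // ltW.
apply: (@le_trans _ _ (w%:R * inv_sqrt_prod b b' u)).
  rewrite mulr_natl.
  apply: (@le_trans _ _ (\sum_(g < N | (0 < g <= w)%N) inv_sqrt_prod b b' u)).
    rewrite big_mkcond [leRHS]big_mkcond; apply: ler_sum => g _.
    have p0 : 0 <= inv_sqrt_prod b b' u by rewrite invr_ge0 sqrtr_ge0.
    case: ifP => [/and3P[g0 gb ge]|_]; last by case: ifP.
    rewrite ifT // g0 /= /w truncn_ge_nat // ler_pdivlMr ?mulr_gt0 //.
    have gb' : u%:R * g%:R * b%:R <= Y%:R :> R by rewrite -!natrM ler_nat.
    have ge' : u%:R * g%:R * b'%:R <= Y%:R :> R by rewrite -!natrM ler_nat.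
    have ug0 : 0 < u%:R * g%:R :> R by rewrite mulr_gt0 // ltr0n.
    have : (u%:R * g%:R * r) ^+ 2 <= Y%:R ^+ 2.
      have -> : (u%:R * g%:R * r) ^+ 2 = (u%:R * g%:R * b%:R) * (u%:R * g%:R * b'%:R) :> R.
        have -> : (u%:R * g%:R * r) ^+ 2 = (u%:R * g%:R) ^+ 2 * (r * r) by ring.
        by rewrite r2; ring.
      by rewrite expr2; apply: ler_pM => //; rewrite mulr_ge0 ?(ltW ug0) // ltW.
    rewrite ler_pXn2r // ?nnegrE //; last by rewrite mulr_ge0 // ltW.
    by have -> : g%:R * (u%:R * r) = u%:R * g%:R * r :> R by ring.
  rewrite -mulr_natl sumr_const -[_ *+ _]mulr_natl ler_wpM2r ?invr_ge0 ?sqrtr_ge0 //.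
  by rewrite ler_nat -sum1_card count_le.
have wle : w%:R <= Y%:R / (u%:R * r) by rewrite /w truncn_le.
have ple : inv_sqrt_prod b b' u <= r^-1.
  rewrite lef_pV2 ?posrE ?sqrtr_gt0 ?ltr0n ?muln_gt0 ?b0 ?c0 ?u0 //.
  rewrite /r ler_wsqrtr // !natrM ler_peMr ?mulr_ge0 ?ler0n // ler1n //.
  by rewrite mulr_gt0.
apply: le_trans (ler_pM (ler0n _ _) _ wle ple) _; first by rewrite invr_ge0 sqrtr_ge0.
have -> : Y%:R / (u%:R * r) / r = Y%:R / (u%:R * (r * r)) by field; rewrite !gt_eqF.
rewrite r2 le_eqVlt; apply/orP; left; apply/eqP.
by field; rewrite !gt_eqF.
Qed.

(** A quadruple is sent to [(b, b', u, g)], which determines the two pair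
    denominators and hence the quadruple up to [T^6] choices. *)
Lemma quad_sum_bound (X T : nat) :
  (forall k, (0 < k <= 2 * X ^ 2)%N -> (size (divisors k) <= T)%N) ->
  harm_sum R (2 * X ^ 2) <= T%:R ->
  \sum_(x : 'I_X.+1 * 'I_X.+1 * ('I_X.+1 * 'I_X.+1)
      | [&& 0 < x.1.1, 0 < x.1.2, 0 < x.2.1 & 0 < x.2.2]%N)
    (Num.sqrt (diff_den x.1.1 x.1.2 x.2.1 x.2.2)%:R : R)^-1
  <= 2 * X%:R ^+ 2 * T%:R ^+ 9.
Proof.
move=> hT hH; set Z := (2 * X ^ 2)%N.
pose V : finType := ('I_Z.+1 * ('I_Z.+1 * ('I_Z.+1 * 'I_Z.+1)))%type.
pose A : finType := ('I_X.+1 * 'I_X.+1 * ('I_X.+1 * 'I_X.+1))%type.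
pose PA (x : A) := [&& 0 < x.1.1, 0 < x.1.2, 0 < x.2.1 & 0 < x.2.2]%N.
pose qbx (x : A) := cofactor_l x.1.1 x.1.2 x.2.1 x.2.2.
pose qex (x : A) := cofactor_r x.1.1 x.1.2 x.2.1 x.2.2.
pose qux (x : A) := diff_quot x.1.1 x.1.2 x.2.1 x.2.2.
pose qgx (x : A) := diff_gcd x.1.1 x.1.2 x.2.1 x.2.2.
pose phi (x : A) : V := (inord (qbx x), (inord (qex x), (inord (qux x), inord (qgx x)))).
pose Q (v : V) := [&& 0 < v.1, 0 < v.2.1, 0 < v.2.2.1, 0 < v.2.2.2,
   v.2.2.1 * v.2.2.2 * v.1 <= Z & v.2.2.1 * v.2.2.2 * v.2.1 <= Z]%N.
pose F (v : V) := inv_sqrt_prod v.1 v.2.1 v.2.2.1.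
have facts x : PA x -> [/\ (0 < qbx x)%N, (0 < qex x)%N, (0 < qux x)%N, (0 < qgx x)%N &
    [/\ (qux x * qgx x * qbx x = 2 * pair_den x.1.1 x.1.2)%N,
        (qux x * qgx x * qex x = 2 * pair_den x.2.1 x.2.2)%N,
        (2 * pair_den x.1.1 x.1.2 <= Z)%N & (2 * pair_den x.2.1 x.2.2 <= Z)%N]].
  move=> /and4P[x1 x2 x3 x4].
  have l (y : 'I_X.+1) : (y <= X)%N by rewrite -ltnS.
  split; [exact: cofactor_l_gt0|exact: cofactor_r_gt0|exact: diff_quot_gt0|exact:
      diff_gcd_gt0|split].
  - exact: diff_quot_gcd_lE.
  - exact: diff_quot_gcd_rE.
  - by rewrite leq_mul2l /=; apply: pair_den_le.
  - by rewrite leq_mul2l /=; apply: pair_den_le.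
have small x : PA x -> [/\ (qbx x < Z.+1)%N, (qex x < Z.+1)%N,
    (qux x < Z.+1)%N & (qgx x < Z.+1)%N].
  move=> /facts [b0 c0 u0 g0 [e1 e2 e3 e4]].
  split; rewrite ltnS.
  - by apply: leq_trans e3; rewrite -e1 leq_pmull // muln_gt0 u0.
  - by apply: leq_trans e4; rewrite -e2 leq_pmull // muln_gt0 u0.
  - by apply: leq_trans e3; rewrite -e1 -mulnA leq_pmulr // muln_gt0 g0.
  - by apply: leq_trans e3; rewrite -e1 mulnAC leq_pmull // muln_gt0 u0.
have phiE x : PA x -> [/\ (phi x).1 = qbx x :> nat, (phi x).2.1 = qex x :> nat,
     (phi x).2.2.1 = qux x :> nat & (phi x).2.2.2 = qgx x :> nat].
  by move=> /small [s1 s2 s3 s4]; rewrite /= !inordK.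
rewrite (eq_bigr (fun x : A => F (phi x))); last first.
  by move=> x px; have [e1 e2 e3 _] := phiE x px; rewrite /F /inv_sqrt_prod e1 e2 e3.
apply: le_trans (@sum_fiber_le A V PA Q phi F (T ^ 3 * T ^ 3)%N _ _ _) _.
- move=> x px; have [e1 e2 e3 e4] := phiE x px.
  have [b0 c0 u0 g0 [k1 k2 k3 k4]] := facts x px.
  by rewrite /Q e1 e2 e3 e4 b0 c0 u0 g0 k1 k2 k3 k4.
- by move=> v _; rewrite /F invr_ge0 sqrtr_ge0.
- move=> v Qv; set bb := ((v.2.2.1 * v.2.2.2 * v.1) %/ 2)%N.
  set ee := ((v.2.2.1 * v.2.2.2 * v.2.1) %/ 2)%N.
  have hs : [set x | PA x && (phi x == v)] \subset finset.setX (pair_set X bb) (pair_set X ee).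
    apply/fintype.subsetP => x; rewrite inE => /andP[px /eqP pv].
    have [e1 e2 e3 e4] := phiE x px.
    have [b0 c0 u0 g0 [k1 k2 k3 k4]] := facts x px.
    move/and4P: px => [x1 x2 x3 x4].
    rewrite inE !inE x1 x2 x3 x4 /=.
    rewrite /bb /ee -pv e1 e2 e3 e4 k1 k2.
    by rewrite !mulKn // !eqxx.
  apply: leq_trans (subset_leq_card hs) _; rewrite cardsX.
  by apply: leq_mul; apply: card_pair_set.
have sumV : \sum_(v | Q v) F v <= Z%:R * harm_sum R Z ^+ 3.
  rewrite big_mkcond /=.
  rewrite -(pair_bigA _ (fun b (p : 'I_Z.+1 * ('I_Z.+1 * 'I_Z.+1)) =>
      if Q (b, p) then F (b, p) else 0)) /=.
  have -> : Z%:R * harm_sum R Z ^+ 3 = \sum_(b < Z.+1) \sum_(c < Z.+1) \sum_(u < Z.+1) Z%:R *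
      (b%:R^-1 * (c%:R^-1 * u%:R^-1)).
    rewrite -!sum_inv_eq_harm !exprS expr0 mulr1.
    rewrite mulr_suml mulr_sumr; apply: eq_bigr => b _.
    rewrite mulr_suml !mulr_sumr; apply: eq_bigr => c _.
    by rewrite !mulr_sumr.
  apply: ler_sum => b _.
  rewrite -(pair_bigA _ (fun c (p : 'I_Z.+1 * 'I_Z.+1) =>
      if Q (b, (c, p)) then F (b, (c, p)) else 0)) /=.
  apply: ler_sum => c _.
  rewrite -(pair_bigA _ (fun u g => if Q (b, (c, (u, g))) then F (b, (c, (u, g))) else 0)) /=.
  apply: ler_sum => u _.
  by rewrite -big_mkcond; apply: sum_inv_sqrt_prod_le.
have T0 : 0 <= T%:R :> R by [].
have h0 : 0 <= harm_sum R Z by apply: sumr_ge0 => i _; rewrite invr_ge0.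
have H3 : harm_sum R Z ^+ 3 <= T%:R ^+ 3 by rewrite lerXn2r ?nnegrE.
apply: le_trans (ler_wpM2l _ sumV) _ => //.
apply: le_trans (ler_wpM2l _ (ler_wpM2l _ H3)) _ => //.
rewrite /Z !(natrM, natrX).
by rewrite le_eqVlt; apply/orP; left; apply/eqP; ring.
Qed.

End QuadrupleSum.

(** * Divisor and harmonic bounds *)

Section ArithmeticBounds.
Variable R : realType.

(** Exponential growth beats linear growth; used with [v] an exponent in a prime
    factorization or a binary logarithm. *)
Lemma succ_le_pow2 (eps : R) : 0 < eps ->
  exists2 D : R, 1 <= D & forall v : nat, v%:R + 1 <= D * (2 `^ eps) ^+ v.
Proof.
move=> e0; have l0 : 0 < ln 2 :> R by rewrite ln_gt0 // ltr1n.
have el0 : 0 < eps * ln 2 by rewrite mulr_gt0.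
exists (1 + (eps * ln 2)^-1); first by rewrite lerDl invr_ge0 ltW.
move=> v.
have : 1 + v%:R * (eps * ln 2) <= (2 `^ eps) ^+ v.
  rewrite /powR ifF; last by apply/negbTE; rewrite pnatr_eq0.
  by rewrite -expRM_natl mulrC; apply: expR_ge1Dx.
have h2 : 0 <= (eps * ln 2)^-1 by rewrite invr_ge0 ltW.
move=> h; apply: le_trans (ler_wpM2l _ h); last by rewrite addr_ge0.
have -> : (1 + (eps * ln 2)^-1) * (1 + v%:R * (eps * ln 2)) =
   1 + v%:R + ((eps * ln 2)^-1 + v%:R * (eps * ln 2)).
  by field; rewrite !gt_eqF.
have : 0 <= v%:R * (eps * ln 2) by rewrite mulr_ge0 // ltW.
lra.
Qed.

Lemma size_divisors_pfactor (p v m : nat) : prime p -> (0 < m)%N ->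
  (size (divisors (p ^ v * m)) <= v.+1 * size (divisors m))%N.
Proof.
move=> pp m0.
have n0 : (0 < p ^ v * m)%N by rewrite muln_gt0 expn_gt0 prime_gt0.
pose L := [seq (p ^ i * d)%N | i <- iota 0 v.+1, d <- divisors m].
rewrite (leq_trans (@uniq_leq_size _ _ L _ _)) ?divisors_uniq //; last first.
  by rewrite size_allpairs size_iota.
move=> d; rewrite -dvdn_divisors // => dn.
have d0 : (0 < d)%N by apply: dvdn_gt0 dn.
set g := gcdn d (p ^ v).
have g0 : (0 < g)%N by rewrite gcdn_gt0 d0.
have [i iv gE] : exists2 i, (i <= v)%N & g = (p ^ i)%N.
  by apply/dvdn_pfactor => //; apply: dvdn_gcdr.
have dE : (d %/ g * g = d)%N by rewrite divnK // dvdn_gcdl.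
have pE : (p ^ v %/ g * g = p ^ v)%N by rewrite divnK // dvdn_gcdr.
have cop : coprime (d %/ g) (p ^ v %/ g).
  by rewrite /coprime -(eqn_pmul2r g0) mul1n muln_gcdl dE pE.
have : (d %/ g %| p ^ v %/ g * m)%N.
  by rewrite -(dvdn_pmul2r g0) dE mulnAC pE.
rewrite Gauss_dvdr // => dm.
apply/allpairsP; exists (i, (d %/ g)%N); split=> /=.
- by have := mem_iota 0 v.+1 i; rewrite /= => ->; rewrite add0n ltnS.
- by rewrite -dvdn_divisors.
- by rewrite -gE mulnC dE.
Qed.

(** Multiplicatively, a prime power [p^v] contributes [v + 1] to the number of
    divisors.  If [p^eps >= 2] this is at most [p^(v eps)]; each of the finitely
    many smaller primes costs a factor [D].  The induction is on a bound for the
    primes occurring in the number. *)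
Lemma divisor_bound (eps : R) : 0 < eps ->
  exists2 C : R, 1 <= C & forall k : nat, (0 < k)%N ->
    (size (divisors k))%:R <= C * k%:R `^ eps.
Proof.
move=> e0; have [D D1 hD] := succ_le_pow2 e0.
(* From [P0] on, [p^eps >= 2]. *)
pose P0 := (Num.truncn (2 `^ eps^-1 : R)).+1.
have hP0 (p : nat) : (P0 <= p)%N -> 2 <= p%:R `^ eps :> R.
  move=> hp; have h1 : 2 `^ eps^-1 <= p%:R :> R.
    by apply: le_trans (ltW (truncnS_gt _)) _; rewrite ler_nat.
  have -> : 2 = (2 `^ eps^-1) `^ eps :> R.
    by rewrite -powRrM mulVf ?gt_eqF // powRr1.
  by apply: ge0_ler_powR; rewrite ?nnegrE ?powR_ge0 ?(ltW e0).
have D0 : 0 < D by apply: lt_le_trans D1.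
exists (D ^+ P0); first exact: exprn_ege1.
suff main : forall k n : nat, (0 < n)%N ->
   (forall p, prime p -> (p %| n)%N -> (p < k)%N) ->
   (size (divisors n))%:R <= D ^+ minn k P0 * n%:R `^ eps.
  move=> n n0.
  have := main n.+1 n n0; move=> h; have {}h := h _.
  apply: le_trans (h _) _.
    by move=> p _ pn; rewrite ltnS; apply: dvdn_leq.
  by rewrite ler_wpM2r ?powR_ge0 // ler_weXn2l // geq_minr.
elim=> [|k IH] n n0 hn.
  have -> : n = 1%N.
    apply/eqP; rewrite eqn_leq n0 andbT leqNgt; apply/negP => n1.
    by have := hn _ (pdiv_prime n1) (pdiv_dvd n).
  by rewrite min0n expr0 mul1r powR1.
have Dmono : D ^+ minn k P0 <= D ^+ minn k.+1 P0.
  by rewrite ler_weXn2l // leq_min geq_minr andbT geq_min leqnSn.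
case: (boolP (prime k && (k %| n)%N)) => [/andP[pk kn]|nk]; last first.
  apply: le_trans (IH n n0 _) _; last by rewrite ler_wpM2r ?powR_ge0.
  move=> p pp pn; have := hn p pp pn; rewrite ltnS leq_eqVlt => /orP[/eqP pE|//].
  by move: nk; rewrite -pE pp pn.
have [m cm nE] := pfactor_coprime pk n0.
set v := logn k n in nE.
have m0 : (0 < m)%N by move: n0; rewrite nE muln_gt0 => /andP[].
have IHm := IH m m0.
have {}IHm : (size (divisors m))%:R <= D ^+ minn k P0 * m%:R `^ eps.
  apply: IHm => p pp pm; have pn : (p %| n)%N by rewrite nE dvdn_mulr.
  have := hn p pp pn; rewrite ltnS leq_eqVlt => /orP[/eqP pE|//].
  by move: cm; rewrite -pE prime_coprime // pm.
have k1 : (1 < k)%N by apply: prime_gt1.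
have fac : v%:R + 1 <= D ^+ (minn k.+1 P0 - minn k P0) * (k ^ v)%:R `^ eps.
  have -> : (k ^ v)%:R `^ eps = (k%:R `^ eps) ^+ v :> R.
    by rewrite natrX -powR_mulrn ?ler0n // -powRrM mulrC powRrM powR_mulrn ?powR_ge0.
  case: (boolP (k < P0)%N) => kP; last rewrite -leqNgt in kP.
    have -> : (minn k.+1 P0 - minn k P0 = 1)%N.
      by rewrite !(minn_idPl _) ?(ltnW kP) // subSnn.
    rewrite expr1; apply: le_trans (hD v) _; rewrite ler_pM2l //.
    rewrite lerXn2r ?nnegrE ?powR_ge0 //.
    by apply: ge0_ler_powR; rewrite ?nnegrE ?ler_nat ?(ltW e0).
  have -> : (minn k.+1 P0 - minn k P0 = 0)%N.
    by rewrite !(minn_idPr _) ?subnn // leqW.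
  rewrite expr0 mul1r; apply: (@le_trans _ _ (2 ^+ v)).
    by rewrite natr1 -natrX ler_nat ltn_expl.
  by rewrite lerXn2r ?nnegrE ?powR_ge0 // hP0.
apply: (@le_trans _ _ ((v%:R + 1) * (size (divisors m))%:R)).
  by rewrite natr1 -natrM ler_nat nE mulnC size_divisors_pfactor.
apply: le_trans (ler_pM _ _ fac IHm) _; rewrite ?addr_ge0 //.
have -> : n%:R `^ eps = (k ^ v)%:R `^ eps * m%:R `^ eps :> R.
  by rewrite nE natrM powRM // mulrC.
have <- : D ^+ (minn k.+1 P0 - minn k P0) * D ^+ minn k P0 = D ^+ minn k.+1 P0.
  by rewrite -exprD subnK // leq_min geq_minr andbT geq_min leqnSn.
by rewrite mulrACA.
Qed.

Lemma harm_sum_le m n : (m <= n)%N -> harm_sum R m <= harm_sum R n.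
Proof.
move=> mn; rewrite /harm_sum (big_ord_widen n (fun i => i.+1%:R^-1)) //.
by rewrite big_mkcond; apply: ler_sum => i _; case: ifP => // _; rewrite invr_ge0.
Qed.

Lemma harm_sum_pow2 k : harm_sum R (2 ^ k) <= k%:R + 1.
Proof.
elim: k => [|k IH]; first by rewrite expn0 /harm_sum big_ord_recl big_ord0 invr1 addr0 add0r.
rewrite expnS mul2n -addnn /harm_sum big_split_ord /=.
have : \sum_(i < 2 ^ k) (2 ^ k + i).+1%:R^-1 <= 1 :> R.
  apply: (@le_trans _ _ (\sum_(i < 2 ^ k) (2 ^ k)%:R^-1)).
    apply: ler_sum => i _; rewrite lef_pV2 ?posrE ?ltr0n ?expn_gt0 //.
    by rewrite ler_nat leqW // leq_addr.
  rewrite sumr_const card_ord -(mulr_natr ((2 ^ k)%:R^-1)) mulVf // pnatr_eq0.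
have kS : k.+1%:R = k%:R + 1 :> R by rewrite natr1.
by move: IH; rewrite /harm_sum; lra.
Qed.

Lemma harm_sum_bound (eps : R) : 0 < eps ->
  exists2 C : R, 1 <= C & forall k : nat, (0 < k)%N ->
    harm_sum R k <= C * k%:R `^ eps.
Proof.
move=> e0; have [D D1 hD] := succ_le_pow2 e0.
exists (2 * D); first by lra.
move=> k k0; set v := trunc_log 2 k.
have kv : (k <= 2 ^ v.+1)%N by apply: ltnW; apply: trunc_log_ltn.
apply: le_trans (harm_sum_le kv) _; apply: le_trans (harm_sum_pow2 _) _.
have vS : v.+1%:R = v%:R + 1 :> R by rewrite natr1.
apply: (@le_trans _ _ (2 * (v%:R + 1))).
  by have := ler0n R v; lra.
rewrite -mulrA ler_pM2l //; apply: le_trans (hD v) _.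
rewrite ler_wpM2l //; first by lra.
have -> : (2 `^ eps) ^+ v = (2 ^ v)%:R `^ eps :> R.
  by rewrite natrX -(@powR_mulrn _ 2) ?ler0n // -powRrM mulrC powRrM powR_mulrn ?powR_ge0.
by apply: ge0_ler_powR; rewrite ?nnegrE ?(ltW e0) ?ler0n // ler_nat; apply: trunc_logP.
Qed.

End ArithmeticBounds.

(** * The fourth moment of the dual sum *)

Section FourthMoment.
Variable R : realType.

(** The terms with some [fl h m] false vanish, so after expanding the fourth power
    only the [h] admitting all four indices remain, with a coefficient that does
    not depend on [h]. *)
Lemma fourth_moment_expand (X N : nat) (P : pred nat) (fl : nat -> nat -> bool)
    (c : nat -> R[i]) (kap : R) :
  (forall h m, P h -> fl h m -> nrm (c m) <= kap /\ (0 < m)%N) ->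
  \sum_(h < N | P h) nrm (\sum_(m < X.+1 | fl h m) c m * e (h%:R ^+ 2 / (4 * m%:R))) ^+ 4
  <= kap ^+ 4 *
   \sum_(x : 'I_X.+1 * 'I_X.+1 * ('I_X.+1 * 'I_X.+1)
      | [&& 0 < x.1.1, 0 < x.1.2, 0 < x.2.1 & 0 < x.2.2]%N)
    nrm (\sum_(h < N | P h && [&& fl h x.1.1, fl h x.1.2, fl h x.2.1 & fl h x.2.2])
      e ((x.1.1%:R^-1 + x.1.2%:R^-1 - x.2.1%:R^-1 - x.2.2%:R^-1) / 4 * h%:R ^+ 2)).
Proof.
move=> hc.
pose A : finType := ('I_X.+1 * 'I_X.+1 * ('I_X.+1 * 'I_X.+1))%type.
pose G h m : R[i] := if fl h m then c m * e (h%:R ^+ 2 / (4 * m%:R)) else 0.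
pose al h (x : A) := [&& fl h x.1.1, fl h x.1.2, fl h x.2.1 & fl h x.2.2].
pose W h := \sum_(m < X.+1) G h m.
rewrite (eq_bigr (fun h : 'I_N => nrm (W h) ^+ 4)); last first.
  by move=> h _; rewrite big_mkcond.
have four h : (nrm (W h) ^+ 4)%:C%C =
   \sum_(x : A) G h x.1.1 * G h x.1.2 * (((G h x.2.1)^*)%C * ((G h x.2.2)^*)%C).
  have -> : nrm (W h) ^+ 4 = nrm (W h) ^+ 2 * nrm (W h) ^+ 2 by rewrite -exprD.
  have -> : ((nrm (W h) ^+ 2 * nrm (W h) ^+ 2)%:C = (nrm (W h) ^+ 2)%:C * (nrm (W h) ^+ 2)%:C)%C.
    exact: (rmorphM (@real_complex R)).
  have WJ : ((W h)^*)%C = \sum_(m < X.+1) ((G h m)^*)%C by exact: conj_sum.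
  rewrite nrm_sqr mulrACA WJ /W.
  rewrite big_distrlr [X in _ * X]big_distrlr /=.
  by rewrite !pair_bigA big_distrlr /= pair_bigA.
set L := \sum_(h < N | P h) _.
have L0 : 0 <= L by apply: sumr_ge0 => h _; rewrite exprn_ge0 // nrm_ge0.
have -> : L = nrm (L%:C)%C by rewrite nrm_real ger0_norm.
have -> : L%:C%C = \sum_(h < N | P h) (nrm (W h) ^+ 4)%:C%C.
  exact: (rmorph_sum (@real_complex R)).
rewrite (eq_bigr _ (fun (h : 'I_N) _ => four h)) exchange_big /=.
apply: le_trans (nrm_sum _ _ _) _.
rewrite mulr_sumr [leRHS]big_mkcond; apply: ler_sum => x _.
pose cc := c x.1.1 * c x.1.2 * ((c x.2.1)^* * (c x.2.2)^*)%C.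
pose th : R := (x.1.1%:R^-1 + x.1.2%:R^-1 - x.2.1%:R^-1 - x.2.2%:R^-1) / 4.
have -> : \sum_(h < N | P h) G h x.1.1 * G h x.1.2 * (((G h x.2.1)^*)%C * ((G h x.2.2)^*)%C)
   = cc * \sum_(h < N | P h && al h x) e (th * h%:R ^+ 2).
  rewrite mulr_sumr big_mkcondr /=; apply: eq_bigr => h _.
  have cJ0 : ((0 : R[i])^*)%C = 0 by exact: (rmorph0 (@conjc R)).
  rewrite /G /al; case: (fl h x.1.1); last by rewrite !mul0r.
  case: (fl h x.1.2); last by rewrite mulr0 mul0r.
  case: (fl h x.2.1); last by rewrite cJ0 mul0r mulr0.
  case: (fl h x.2.2); last by rewrite cJ0 !mulr0.
  have cM (u v : R[i]) : ((u * v)^*)%C = conjc u * conjc v by exact: (rmorphM (@conjc R)).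
  pose E (m : nat) : R[i] := e (h%:R ^+ 2 / (4 * m%:R)).
  change ((c x.1.1 * E x.1.1) * (c x.1.2 * E x.1.2) *
    (conjc (c x.2.1 * E x.2.1) * conjc (c x.2.2 * E x.2.2)) = cc * e (th * h%:R ^+ 2)).
  rewrite (cM (c x.2.1)) (cM (c x.2.2)) /E !conj_e /cc.
  have -> : e (th * h%:R ^+ 2) = e (h%:R ^+ 2 / (4 * x.1.1%:R)) * e (h%:R ^+ 2 / (4 * x.1.2%:R))
    * (e (- (h%:R ^+ 2 / (4 * x.2.1%:R))) * e (- (h%:R ^+ 2 / (4 * x.2.2%:R)))).
    by rewrite -!eD /th; congr e; rewrite !invfM; ring.
  by ring.
rewrite Normc.normcM.
case: (pickP (fun h : 'I_N => P h && al h x)) => [h0 /andP[Ph0 /and4P[f1 f2 f3 f4]]|none];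
    last first.
  rewrite (eq_bigl _ _ none) big_pred0_eq Normc.normc0 mulr0; case: ifP => // _.
  rewrite mulr_ge0 ?nrm_ge0 // exprn_even_ge0 //.
have [b1 p1] := hc _ _ Ph0 f1; have [b2 p2] := hc _ _ Ph0 f2.
have [b3 p3] := hc _ _ Ph0 f3; have [b4 p4] := hc _ _ Ph0 f4.
rewrite p1 p2 p3 p4 /= ler_wpM2r ?nrm_ge0 //.
have n0 := @nrm_ge0 R.
have k0 : 0 <= kap by apply: le_trans b1.
rewrite /cc !Normc.normcM !nrm_conj.
have -> : kap ^+ 4 = (kap * kap) * (kap * kap) by ring.
by apply: ler_pM; rewrite ?mulr_ge0 // ler_pM.
Qed.

Lemma exists_nat_ceil (x : R) : exists b : nat, forall a : nat, (x <= a%:R) = (b <= a)%N.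
Proof.
have ex : exists a : nat, x <= a%:R.
  by exists (Num.truncn x).+1; apply/ltW/truncnS_gt.
case: (ex_minnP ex) => b xb bmin; exists b => a.
apply/idP/idP; first exact: bmin.
by move=> ba; apply: le_trans xb _; rewrite ler_nat.
Qed.

Lemma add_pow4_le (x y : R) : 0 <= x -> 0 <= y ->
  (x + y) ^+ 4 <= 8 * (x ^+ 4 + y ^+ 4).
Proof.
move=> x0 y0.
have s2 (u v : R) : (u + v) ^+ 2 <= 2 * (u ^+ 2 + v ^+ 2).
  by have := sqr_ge0 (u - v); rewrite sqrrB sqrrD; lra.
have -> : (x + y) ^+ 4 = ((x + y) ^+ 2) ^+ 2 by rewrite -exprM.
apply: (@le_trans _ _ ((2 * (x ^+ 2 + y ^+ 2)) ^+ 2)).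
  by rewrite lerXn2r ?nnegrE ?sqr_ge0 // mulr_ge0 // addr_ge0 ?sqr_ge0.
have := s2 (x ^+ 2) (y ^+ 2); rewrite -!exprM /= => h.
have -> : (2 * (x ^+ 2 + y ^+ 2)) ^+ 2 = 4 * (x ^+ 2 + y ^+ 2) ^+ 2 by ring.
lra.
Qed.

(** Combines the expansion with [weyl_bound] for each quadruple and [quad_sum_bound]
    for the sum over quadruples.  The power of [T] is [1] from the harmonic sum in
    Weyl's bound and [9] from the count. *)
Lemma dual_moment (s H : R) (bot top Q J X N T : nat) :
  100 * 100 <= s -> s <= H -> H ^+ 3 <= s ^+ 4 ->
  s ^+ 2 / 2 <= bot%:R -> top%:R <= s ^+ 2 ->
  (0 < Q)%N -> (0 < J)%N -> (4 * X ^ 3 <= Q ^ 2 * J)%N ->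
  X = Num.truncn (H / s) -> N = (Num.truncn H).+1 ->
  (forall k, (0 < k <= 2 * X ^ 4)%N -> (size (divisors k) <= T)%N) ->
  (forall k, (0 < k <= 2 * X ^ 4)%N -> harm_sum R k <= T%:R) ->
  H ^+ 4 * \sum_(h < N | H / 2 <= h%:R)
     nrm (\sum_(m < X.+1 | interior_freq R h bot top m) dual_weight R Q J m * e (h%:R ^+ 2 /
         (4 * m%:R))) ^+ 4
  <= 24 * 14 ^+ 4 * 8 ^+ 6 * (H * s ^+ 4 * T%:R ^+ 10).
Proof.
move=> sb sH H3 bot_lo top_hi Q0 J0 QJ XE NE hT hH.
have s0 : 0 < s by move: sb; lra.
have H0 : 0 < H by move: s0 sH; lra.
have M1 : 1 <= H / s by rewrite ler_pdivlMr // mul1r.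
have M0 : 0 < H / s by rewrite divr_gt0.
have XM : X%:R <= H / s by rewrite XE truncn_le ltW.
have X1 : (1 <= X)%N by rewrite XE truncn_gt0.
have NH : N%:R <= 2 * H.
  have : (Num.truncn H)%:R <= H by rewrite truncn_le ltW.
  have : N%:R = (Num.truncn H)%:R + 1 :> R by rewrite NE natr1.
  by move: sb sH; lra.
have HN : H <= N%:R by rewrite NE; apply/ltW/truncnS_gt.
have X2 : (0 < 2 * X ^ 2 <= 2 * X ^ 4)%N.
  by rewrite muln_gt0 expn_gt0 X1 /= leq_mul2l leq_pexp2l ?orbT.
have T1 : 1 <= T%:R :> R.
  apply: le_trans (hH 1%N _); first by rewrite /harm_sum big_ord_recl big_ord0 invr1 addr0.
  by rewrite /= muln_gt0 expn_gt0 X1.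
(* Interior frequencies are at least [w], so all dual weights are at most [kap]. *)
pose w : R := H / (8 * s).
have w0 : 0 < w by rewrite divr_gt0 // mulr_gt0.
pose kap : R := 14 / Num.sqrt (w ^+ 3).
have sw0 : 0 < Num.sqrt (w ^+ 3) by rewrite sqrtr_gt0 exprn_gt0.
have kap4 : kap ^+ 4 = 14 ^+ 4 / w ^+ 6.
  rewrite /kap expr_div_n; congr (_ / _).
  have -> : Num.sqrt (w ^+ 3) ^+ 4 = (Num.sqrt (w ^+ 3) ^+ 2) ^+ 2 by rewrite -exprM.
  by rewrite sqr_sqrtr ?exprn_ge0 ?ltW // -exprM.
pose P (h : nat) := H / 2 <= h%:R.
have fb h m : P h -> (h < N)%N -> interior_freq R h bot top m ->
    nrm (dual_weight R Q J m) <= kap /\ (0 < m)%N.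
  move=> Ph hN fm.
  have h_lo : H <= 2 * h%:R by move: Ph; rewrite /P; lra.
  have h_hi : h%:R <= H by move: hN; rewrite NE ltnS truncn_ge_nat // ltW.
  have [_ _ mX mlo] := interior_freq_bounds sb sH h_lo h_hi bot_lo top_hi fm.
  have m0 : 0 < m%:R :> R by apply: lt_le_trans w0 mlo.
  have m0' : (0 < m)%N by rewrite -(ltr_nat R).
  split=> //; apply: le_trans (dual_weight_bound _ Q0 J0 m0' _) _.
    by apply: leq_trans QJ; rewrite leq_mul2l leq_exp2r // XE mX orbT.
  rewrite /kap ler_pM2l // lef_pV2 ?posrE ?sqrtr_gt0 ?exprn_gt0 //.
  by rewrite ler_wsqrtr // lerXn2r // nnegrE ltW.
pose P' (h : nat) := P h && (h < N)%N.
have := @fourth_moment_expand X N P' (fun h m =>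
    interior_freq R h bot top m) (dual_weight R Q J) kap.
move=> hx; have {}hx := hx _.
have PP' (h : 'I_N) : P' h = P h by rewrite /P' ltn_ord andbT.
rewrite (eq_bigl (fun h : 'I_N => P' h)); last by move=> h; rewrite PP'.
apply: (@le_trans _ _ (H ^+ 4 * (kap ^+ 4 * (6 * T%:R * N%:R * (2 * X%:R ^+ 2 * T%:R ^+ 9))))).
  rewrite ler_pM2l ?exprn_gt0 //; apply: le_trans (hx _) _.
    by move=> h m /andP[Ph hN]; apply: fb.
  rewrite ler_pM2l ?kap4 ?divr_gt0 ?exprn_gt0 //.
  have hq : harm_sum R (2 * X ^ 2) <= T%:R by apply: hH.
  have hT2 k : (0 < k <= 2 * X ^ 2)%N -> (size (divisors k) <= T)%N.
    move=> /andP[k0 kX]; apply: hT; rewrite k0 (leq_trans kX) //.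
    by case/andP: X2.
  apply: le_trans (ler_wpM2l _ (quad_sum_bound hT2 hq)); last by rewrite !mulr_ge0.
  rewrite mulr_sumr; apply: ler_sum => x /and4P[x1 x2 x3 x4].
  set q := diff_den _ _ _ _.
  have q0 : (0 < q)%N by apply: diff_den_gt0.
  have qR : 0 < q%:R :> R by rewrite ltr0n.
  have l (y : 'I_X.+1) : (y <= X)%N by rewrite -ltnS.
  have qX : (q <= 2 * X ^ 4)%N by apply: diff_den_le.
  have XN : (X ^ 4 <= N)%N.
    rewrite -(ler_nat R) natrX; apply: le_trans HN.
    apply: (@le_trans _ _ ((H / s) ^+ 4)); first by rewrite lerXn2r ?nnegrE ?ler0n ?(ltW M0).
    rewrite expr_div_n ler_pdivrMr ?exprn_gt0 //.
    have -> : H ^+ 4 = H * H ^+ 3 by rewrite -exprS.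
    by rewrite ler_pM2l.
  have cop : coprime (diff_red_num x.1.1 x.1.2 x.2.1 x.2.2) q by apply: diff_coprime.
  have qr := @diff_frac x.1.1 x.1.2 x.2.1 x.2.2 x1 x2 x3 x4 R.
  have := @weyl_bound R (fun h => P' h && [&& interior_freq R h bot top x.1.1,
      interior_freq R h bot top x.1.2,
     interior_freq R h bot top x.2.1 & interior_freq R h bot top x.2.2]) N _ q _ _ T%:R _ q0
         cop qr _ _ T1.
  set S := \sum_(h < N | _) _ => hw; have {}hw := hw _ _ _.
  have : nrm S ^+ 2 <= 32 * T%:R * (N%:R ^+ 2 / q%:R).
    apply: hw.
    - have cf m i j k : (i <= j <= k)%N -> interior_freq R i bot top m ->
        interior_freq R k bot top m -> interior_freq R j bot top m.
        move=> /andP[ij jk] /andP[_ i2] /andP[k1 _]; apply/andP; split.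
          by apply: leq_ltn_trans k1; apply: nearest_freq_homo.
        by apply: leq_trans i2 _; apply: nearest_freq_homo.
      move=> i j k ijk kN /andP[/andP[Pi iN] /and4P[i1 i2 i3 i4]] /andP[/andP[Pk _] /and4P[k1
          k2 k3 k4]].
      rewrite (cf _ _ _ _ ijk i1 k1) (cf _ _ _ _ ijk i2 k2).
      rewrite (cf _ _ _ _ ijk i3 k3) (cf _ _ _ _ ijk i4 k4).
      rewrite /P' /= andbT; move/andP: ijk => [ij jk]; apply/andP; split;
          last exact: leq_ltn_trans jk kN.
      by move: Pi; rewrite /P => /le_trans; apply; rewrite ler_nat.
    - by apply: leq_trans qX _; rewrite leq_mul2l.
    - by apply: hH; rewrite q0.
  set sq := Num.sqrt (q%:R : R).
  have sq0 : 0 < sq by rewrite sqrtr_gt0.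
  have sq2 : sq ^+ 2 = q%:R by rewrite sqr_sqrtr // ltW.
  move=> h2.
  have h3 : nrm S ^+ 2 <= (6 * T%:R * N%:R / sq) ^+ 2.
    apply: le_trans h2 _.
    have -> : (6 * T%:R * N%:R / sq) ^+ 2 = 36 * (T%:R * T%:R) * (N%:R ^+ 2 / q%:R) :> R.
      by rewrite -sq2; field; rewrite gt_eqF.
    rewrite ler_wpM2r ?divr_ge0 ?exprn_ge0 //.
    have : T%:R <= T%:R * T%:R :> R by rewrite ler_peMr.
    lra.
  rewrite ler_pXn2r ?nnegrE ?nrm_ge0 // in h3.
  by rewrite divr_ge0 ?mulr_ge0 // ltW.
have XM2 : X%:R ^+ 2 <= (H / s) ^+ 2 by rewrite lerXn2r ?nnegrE ?ler0n ?(ltW M0).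
have t0 : 0 <= T%:R ^+ 9 :> R by rewrite exprn_ge0.
have k0 : 0 <= kap ^+ 4 by rewrite kap4 divr_ge0 ?exprn_ge0 ?ltW.
apply: (@le_trans _ _ (H ^+ 4 * (kap ^+ 4 * (6 * T%:R * (2 * H) * (2 * (H / s) ^+ 2 * T%:R ^+
    9))))).
  rewrite ler_pM2l ?exprn_gt0 // ler_wpM2l //.
  apply: ler_pM; rewrite ?mulr_ge0 ?exprn_ge0 //.
    by rewrite ler_wpM2l // mulr_ge0.
  by rewrite ler_wpM2r // ler_pM2l.
rewrite kap4 /w le_eqVlt; apply/orP; left; apply/eqP.
have -> : T%:R ^+ 10 = T%:R * T%:R ^+ 9 :> R by rewrite -exprS.
have c8 : 0 < (8 : R) ^+ 6 by rewrite exprn_gt0.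
have -> : (H / (8 * s)) ^+ 6 = H ^+ 6 / (8 ^+ 6 * s ^+ 6).
  by rewrite expr_div_n; congr (_ / _); exact: exprMn.
clear -c8 H0 s0.
move: (8 ^+ 6) c8 => d8 c8; move: (14 ^+ 4) => c14.
move: (T%:R ^+ 9) => t9; move: (T%:R) => t.
by field; rewrite !gt_eqF.
Qed.

End FourthMoment.

(** * The moment for large n *)

Section Final.
Variable R : realType.

Lemma dyadic_sum (V : nmodType) (x : R) (F : int -> V) : 0 <= x ->
  \sum_(a \in dyadic x) F a = \sum_(a < (Num.truncn x).+1 | x / 2 <= a%:R) F (Posz a).
Proof.
move=> x0; pose r := [seq Posz a | a <- iota 0 (Num.truncn x).+1 & x / 2 <= a%:R].
have inr a : (a \in r) = (x / 2 <= a%:~R <= x).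
  apply/mapP/idP => [[k]|/andP[h1 h2]].
    rewrite mem_filter => /andP[h1]; have -> := mem_iota 0 (Num.truncn x).+1 k.
    rewrite add0n ltnS truncn_ge_nat // => /andP[_ h2] ->.
    by apply/andP; split.
  have a0 : 0 <= a.
    by rewrite -(ler0z R); apply: le_trans h1; rewrite divr_ge0.
  case: a a0 h1 h2 => // k _ h1 h2; exists k => //.
  rewrite mem_filter; apply/andP; split=> //.
  by have -> := mem_iota 0 (Num.truncn x).+1 k; rewrite add0n ltnS truncn_ge_nat.
have -> : dyadic x = [set` r]%classic.
  by apply/seteqP; split => a /=; rewrite inr.
rewrite -fsbig_seq; last first.
  rewrite map_inj_uniq; last by move=> a b [].
  by rewrite filter_uniq // iota_uniq.
by rewrite big_map big_filter -(big_mkord (fun a => x / 2 <= a%:R) (fun a => F (Posz a))).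
Qed.

Lemma M4_nat (s H : R) (bot : nat) : 0 <= s -> 0 <= H ->
  (forall a : nat, (s ^+ 2 / 2 <= a%:R) = (bot <= a)%N) ->
  M4 H (s ^+ 2) = \sum_(h < (Num.truncn H).+1 | H / 2 <= h%:R)
    nrm (\sum_(a < (Num.truncn (s ^+ 2)).+1 | (bot <= a)%N) e (root_phase R h a)) ^+ 4.
Proof.
move=> s0 H0 hb; rewrite /M4 dyadic_sum //; apply: eq_bigr => h _.
congr (nrm _ ^+ 4); rewrite /exp_sum dyadic_sum ?sqr_ge0 //.
by apply: eq_bigl => a; rewrite hb.
Qed.

Lemma moment_large_le (s H : R) (T : nat) :
  100 * 100 <= s -> s <= H -> H ^+ 3 <= s ^+ 4 ->
  (forall k, (0 < k)%N -> k%:R <= 2 * s ^+ 2 -> (size (divisors k) <= T)%N) ->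
  (forall k, (0 < k)%N -> k%:R <= 2 * s ^+ 2 -> harm_sum R k <= T%:R) ->
  M4 H (s ^+ 2) <= (8 * (24 * 14 ^+ 4 * 8 ^+ 6) + 16 * (100 * (100 * 41)) ^+ 4)
     * (H * s ^+ 4 * T%:R ^+ 10).
Proof.
move=> sb sH H3 hT hH.
have s0 : 0 < s by move: sb; lra.
have H0 : 0 < H by move: s0 sH; lra.
have H10 : 10 * H <= s ^+ 2 by apply: le_small => //; move: sb; lra.
have M1 : 1 <= H / s by rewrite ler_pdivlMr // mul1r.
have M0 : 0 < H / s by rewrite divr_gt0.
have [bot hb] := exists_nat_ceil (s ^+ 2 / 2).
have bot_lo : s ^+ 2 / 2 <= bot%:R by rewrite hb.
rewrite (M4_nat (ltW s0) (ltW H0) hb).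
set top := Num.truncn (s ^+ 2).
have top_hi : top%:R <= s ^+ 2 by rewrite truncn_le sqr_ge0.
pose X := Num.truncn (H / s); pose N := (Num.truncn H).+1.
have XM : X%:R <= H / s by rewrite truncn_le ltW.
have X1 : (0 < X)%N by rewrite truncn_gt0.
have X4 : (2 * X ^ 4)%:R <= 2 * s ^+ 2.
  rewrite natrM ler_pM2l // natrX; apply: (@le_trans _ _ H); last by move: H10 H0; lra.
  apply: (@le_trans _ _ ((H / s) ^+ 4)); first by rewrite lerXn2r ?nnegrE ?ler0n ?(ltW M0).
  rewrite expr_div_n ler_pdivrMr ?exprn_gt0 //.
  have -> : H ^+ 4 = H * H ^+ 3 by rewrite -exprS.
  by rewrite ler_pM2l.
have hT' k : (0 < k <= 2 * X ^ 4)%N -> (size (divisors k) <= T)%N.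
  move=> /andP[k0 kX]; apply: hT => //; apply: le_trans X4; by rewrite ler_nat.
have hH' k : (0 < k <= 2 * X ^ 4)%N -> harm_sum R k <= T%:R.
  move=> /andP[k0 kX]; apply: hH => //; apply: le_trans X4; by rewrite ler_nat.
have T1 : 1 <= T%:R :> R.
  apply: le_trans (hH' 1%N _); first by rewrite /harm_sum big_ord_recl big_ord0 invr1 addr0.
  by rewrite /= muln_gt0 expn_gt0 X1.
(* The window has half length [h / Q], about [s / 100] for [h] of size [H]. *)
pose Q := Num.truncn (101 * H / s).
have Qx0 : 0 <= 101 * H / s by rewrite divr_ge0 ?mulr_ge0 // ltW.
have Q_hi : Q%:R * s <= 101 * H by rewrite -ler_pdivlMr // truncn_le.
have Q_lo : 100 * H <= Q%:R * s.
  have h1 : 101 * H / s < Q.+1%:R by apply: truncnS_gt.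
  have h2 : Q.+1%:R = Q%:R + 1 :> R by rewrite natr1.
  by move: h1; rewrite h2 ltr_pdivrMr //; move: sH; lra.
have Q0 : (0 < Q)%N.
  by rewrite lt0n; apply/eqP => QE; move: Q_lo H0; rewrite QE mul0r; lra.
(* Divisible by every [h <= H], and large enough for [dual_weight_bound]. *)
pose J := ((Num.truncn H)`! * (4 * X ^ 3).+1)%N.
have J0 : (0 < J)%N by rewrite muln_gt0 fact_gt0.
have QJ : (4 * X ^ 3 <= Q ^ 2 * J)%N.
  apply: (@leq_trans J); last by rewrite leq_pmull // expn_gt0 Q0.
  by apply: leq_trans (leqnSn _) _; rewrite leq_pmull // fact_gt0.
pose W h := \sum_(m < X.+1 | interior_freq R h bot top m) dual_weight R Q J m * e (h%:R ^+ 2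
    / (4 * m%:R)).
have dual := @dual_moment R s H bot top Q J X N T sb sH H3 bot_lo top_hi Q0 J0 QJ erefl erefl
    hT' hH'.
pose K : R := 100 * (100 * 41).
have K0 : 0 <= K by rewrite !mulr_ge0.
have each (h : nat) : (h < N)%N -> H / 2 <= h%:R ->
  nrm (\sum_(a < top.+1 | (bot <= a)%N) e (root_phase R h a)) ^+ 4
   <= 8 * (H ^+ 4 * nrm (W h) ^+ 4 + K ^+ 4 * s ^+ 4).
  move=> hN Ph.
  have h_lo : H <= 2 * h%:R by move: Ph; lra.
  have h_hi : h%:R <= H by move: hN; rewrite /N ltnS truncn_ge_nat // ltW.
  have h0 : (0 < h)%N by rewrite -(ltr_nat R); move: h_lo H0; lra.
  have hJ : (h %| J)%N by rewrite dvdn_mulr // dvdn_fact // h0 -ltnS.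
  pose r := (J %/ h)%N.
  have rJ : (h * r)%N = J by rewrite mulnC divnK.
  have r0 : (0 < r)%N by rewrite divn_gt0 // dvdn_leq.
  have := @exp_sum_approx R s H h bot top Q r sb sH H3 h_lo h_hi Q_lo Q_hi r0 bot_lo top_hi.
  rewrite rJ -/X -/(W h) -/K; set S := \sum_(_ < _ | _) _ => happ.
  have SE : nrm S <= H * nrm (W h) + K * s.
    have -> : S = h%:R%:C%C * W h + (S - h%:R%:C%C * W h) by rewrite addrC subrK.
    apply: le_trans (le_normcD _ _) _; apply: lerD => //.
    rewrite Normc.normcM nrm_real ger0_norm ?ler0n // ler_wpM2r // nrm_ge0 //.
  have p1 : 0 <= H * nrm (W h) by rewrite mulr_ge0 ?nrm_ge0 // ltW.
  have p2 : 0 <= K * s by rewrite mulr_ge0 // ltW.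
  apply: (@le_trans _ _ ((H * nrm (W h) + K * s) ^+ 4)).
    by rewrite lerXn2r ?nnegrE ?nrm_ge0 // addr_ge0.
  by rewrite -!exprMn; apply: add_pow4_le.
apply: (@le_trans _ _ (\sum_(h < N | H / 2 <= h%:R) 8 * (H ^+ 4 * nrm (W h) ^+ 4 +
    K ^+ 4 * s ^+ 4))).
  by apply: ler_sum => h Ph; apply: each.
rewrite -mulr_sumr big_split /= -mulr_sumr.
have NH : N%:R <= 2 * H.
  have h1 : (Num.truncn H)%:R <= H by rewrite truncn_le ltW.
  have h2 : N%:R = (Num.truncn H)%:R + 1 :> R by rewrite natr1.
  by move: sb sH; lra.
have t10 : 1 <= T%:R ^+ 10 :> R by apply: exprn_ege1.
have second : \sum_(h < N | H / 2 <= h%:R) K ^+ 4 * s ^+ 4 <=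
    2 * K ^+ 4 * (H * s ^+ 4 * T%:R ^+ 10).
  apply: (@le_trans _ _ (\sum_(h < N) K ^+ 4 * s ^+ 4)).
    rewrite big_mkcond; apply: ler_sum => h _; case: ifP => // _.
    by rewrite mulr_ge0 ?exprn_ge0 // ltW.
  rewrite sumr_const card_ord -[_ *+ N]mulr_natl.
  have a0 : 0 <= K ^+ 4 * s ^+ 4 by rewrite mulr_ge0 ?exprn_ge0 // ltW.
  apply: le_trans (ler_wpM2r a0 NH) _.
  have -> : 2 * K ^+ 4 * (H * s ^+ 4 * T%:R ^+ 10) = 2 * H * (K ^+ 4 * s ^+ 4) * T%:R ^+ 10.
    by move: (T%:R ^+ 10) (K ^+ 4) => u v; ring.
  by rewrite ler_peMr // mulr_ge0 // mulr_ge0 // ltW.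
rewrite -/N -/K in dual *.
have := lerD dual second.
move: (24 * 14 ^+ 4 * 8 ^+ 6) (K ^+ 4) (H * s ^+ 4 * T%:R ^+ 10) => c1 c2 z.
rewrite -/(W _) => hh.
apply: le_trans (ler_wpM2l _ hh) _ => //.
by lra.
Qed.

End Final.

(** * The theorem *)

(** The trivial bound [|S| <= 2 n], for the bounded values of [n] to which the
    asymptotic argument does not apply. *)
Lemma moment_small_le (R : realType) (s H : R) : 1 <= s -> 1 <= H ->
  M4 H (s ^+ 2) <= 32 * H * s ^+ 8.
Proof.
move=> s1 H1; have s0 : 0 < s by lra.
have [bot hb] := exists_nat_ceil (s ^+ 2 / 2).
rewrite (M4_nat (ltW s0) _ hb); last by lra.
set top := Num.truncn (s ^+ 2); set N := (Num.truncn H).+1.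
have n1 : 1 <= s ^+ 2 by rewrite exprn_ege1.
have tn : top.+1%:R <= 2 * s ^+ 2.
  have h1 : top%:R <= s ^+ 2 by rewrite truncn_le sqr_ge0.
  have h2 : top.+1%:R = top%:R + 1 :> R by rewrite natr1.
  lra.
have NH : N%:R <= 2 * H.
  have h1 : (Num.truncn H)%:R <= H by rewrite truncn_le; lra.
  have h2 : N%:R = (Num.truncn H)%:R + 1 :> R by rewrite natr1.
  lra.
apply: (@le_trans _ _ (\sum_(h < N) (2 * s ^+ 2) ^+ 4)).
  rewrite big_mkcond; apply: ler_sum => h _.
  have p0 : 0 <= 2 * s ^+ 2 by rewrite mulr_ge0 // sqr_ge0.
  case: ifP => _; last by rewrite exprn_ge0.
  rewrite lerXn2r ?nnegrE ?nrm_ge0 //.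
  apply: le_trans (nrm_sum _ _ _) _; apply: le_trans tn.
  apply: (@le_trans _ _ (\sum_(a < top.+1) 1)); last by rewrite sumr_const card_ord.
  by rewrite big_mkcond; apply: ler_sum => a _; case: ifP => // _; rewrite nrm_e.
rewrite sumr_const card_ord -[_ *+ N]mulr_natl.
have -> : 32 * H * s ^+ 8 = 2 * H * (2 * s ^+ 2) ^+ 4 by ring.
by rewrite ler_wpM2r // exprn_ge0 // mulr_ge0 // sqr_ge0.
Qed.

Theorem theorem1p2 (R : realType) (delta eps : R)
    (hdelta : 0 < delta < 1 / 6) (heps : 0 < eps) :
  exists C : R, forall n H : R,
    1 <= n ->
    n `^ (1 / 2 + delta) <= H <= n `^ (2 / 3) ->
    M4 H n <= C * H * n `^ (2 + eps).
Proof.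
have e1 : 0 < eps / 10 by rewrite divr_gt0.
have [C1 C1_ge hC1] := divisor_bound e1.
have [C2 C2_ge hC2] := harm_sum_bound e1.
pose C3 := (C1 + C2) * 2 `^ (eps / 10) + 1.
pose C4 : R := 8 * (24 * 14 ^+ 4 * 8 ^+ 6) + 16 * (100 * (100 * 41)) ^+ 4.
have p2 : 0 <= 2 `^ (eps / 10) :> R by apply: powR_ge0.
have C3_ge : 0 <= C3 by rewrite addr_ge0 // mulr_ge0 //; lra.
have K_ge : 0 <= 32 * (100 * 100) ^+ 4 :> R.
  by rewrite mulr_ge0 // exprn_ge0 // mulr_ge0.
have C4_ge : 0 <= C4.
  rewrite addr_ge0 // mulr_ge0 ?exprn_ge0 ?mulr_ge0 ?exprn_ge0 //.
exists (C4 * C3 ^+ 10 + 32 * (100 * 100) ^+ 4) => n H n1 /andP[Hlo Hhi].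
have n0 : 0 < n by lra.
pose s := Num.sqrt n.
have s2 : s ^+ 2 = n by rewrite sqr_sqrtr // ltW.
have s1 : 1 <= s by rewrite -sqrtr1 ler_wsqrtr.
have s0 : 0 < s by lra.
have sH : s <= H.
  apply: le_trans Hlo; rewrite /s -powR12_sqrt ?(ltW n0) //.
  rewrite -[leLHS]/(n `^ 2^-1); apply: ler_powR => //.
  by case/andP: hdelta; lra.
have H0 : 0 < H by lra.
clearbody s.
have H3 : H ^+ 3 <= s ^+ 4.
  apply: (@le_trans _ _ ((n `^ (2 / 3)) ^+ 3)).
    by rewrite lerXn2r ?nnegrE ?powR_ge0 // ltW.
  rewrite -powR_mulrn ?powR_ge0 // -powRrM.
  have -> : 2 / 3 * 3%:R = 2%:R :> R by field.
  by rewrite powR_mulrn ?(ltW n0) // -s2 -exprM.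
have nE : n `^ (2 + eps) = s ^+ 4 * n `^ eps.
  rewrite powRD; last by rewrite (gt_eqF n0) implybT.
  have -> : n `^ 2 = n ^+ 2 by exact: (powR_mulrn 2 (ltW n0)).
  by rewrite -s2 -exprM.
have ge1 (a : R) : 0 < a -> 1 <= n `^ a.
  move=> a0; have : 1 `^ a <= n `^ a.
    by rewrite ge0_ler_powR ?nnegrE ?(ltW a0) ?(ltW n0).
  by rewrite powR1.
have ne1 : 1 <= n `^ eps by exact: ge1.
have A0 : 0 <= H * (s ^+ 4 * n `^ eps).
  by rewrite mulr_ge0 ?mulr_ge0 ?exprn_ge0 ?powR_ge0 // ltW.
rewrite nE -mulrA mulrDl; have -> : M4 H n = M4 H (s ^+ 2) by rewrite s2.
case: (lerP (100 * 100) s) => sb.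
  (* A common bound for the divisor function and the harmonic sums up to [2 n]; its
     tenth power is [O(n^eps)]. *)
  pose T := (Num.truncn ((C1 + C2) * (2 * n) `^ (eps / 10))).+1.
  have C12 : 0 <= C1 + C2 by lra.
  have Tbig (k : nat) (y c : R) : (0 < k)%N -> k%:R <= 2 * s ^+ 2 -> 0 <= c -> c <= C1 + C2 ->
     y <= c * k%:R `^ (eps / 10) -> y <= T%:R.
    move=> k0 ks c0 cC hy; apply: le_trans hy _.
    apply: (@le_trans _ _ ((C1 + C2) * (2 * n) `^ (eps / 10))).
      apply: ler_pM; rewrite ?powR_ge0 //.
      by apply: ge0_ler_powR; rewrite ?nnegrE ?(ltW e1) ?mulr_ge0 ?(ltW n0) // -s2.
    by apply/ltW/truncnS_gt.
  have := @moment_large_le R s H T sb sH H3.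
  move=> hm; apply: le_trans (hm _ _) _.
  - move=> k k0 ks; rewrite -(ler_nat R).
    by apply: (Tbig k _ C1) => //; [lra | lra | exact: hC1].
  - by move=> k k0 ks; apply: (Tbig k _ C2) => //; [lra | lra | exact: hC2].
  rewrite -/C4.
  have Tle : T%:R <= C3 * n `^ (eps / 10).
    have h1 : T%:R <= (C1 + C2) * (2 * n) `^ (eps / 10) + 1.
      by rewrite /T -natr1 lerD2r truncn_le mulr_ge0 ?powR_ge0.
    apply: le_trans h1 _; rewrite powRM ?(ltW n0) //.
    have -> : C3 * n `^ (eps / 10) = (C1 + C2) * (2 `^ (eps / 10) * n `^ (eps / 10)) +
        n `^ (eps / 10).
      by rewrite /C3; move: (2 `^ _) (n `^ _) => u v; ring.
    rewrite lerD2l.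
    exact: ge1.
  have T10 : T%:R ^+ 10 <= C3 ^+ 10 * n `^ eps.
    have -> : n `^ eps = (n `^ (eps / 10)) ^+ 10.
      rewrite -powR_mulrn ?powR_ge0 // -powRrM; congr (_ `^ _).
      by field.
    by rewrite -exprMn lerXn2r ?nnegrE ?mulr_ge0 ?powR_ge0.
  have Hs : 0 <= H * s ^+ 4 by rewrite mulr_ge0 ?exprn_ge0 // ltW.
  apply: (@le_trans _ _ (C4 * (H * s ^+ 4 * (C3 ^+ 10 * n `^ eps)))).
    by rewrite ler_wpM2l // ler_wpM2l.
  rewrite -[leLHS]addr0; apply: lerD; last first.
    exact: mulr_ge0 K_ge A0.
  rewrite le_eqVlt; apply/orP; left; apply/eqP.
  by move: (C3 ^+ 10) (n `^ eps) (s ^+ 4) => u v x; ring.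
apply: le_trans (moment_small_le s1 _) _; first by lra.
rewrite -[leLHS]add0r; apply: lerD.
  by apply: mulr_ge0 A0; apply: mulr_ge0 => //; apply: exprn_ge0.
have s48 : s ^+ 8 = s ^+ 4 * s ^+ 4 by rewrite -exprD.
have s4 : s ^+ 4 <= (100 * 100) ^+ 4.
  rewrite lerXn2r ?nnegrE ?(ltW s0) ?(ltW sb) //.
have sn : s ^+ 4 <= s ^+ 4 * n `^ eps by rewrite ler_peMr // exprn_ge0 // ltW.
have x0 : 0 <= s ^+ 4 by rewrite exprn_ge0 // ltW.
have h1 : s ^+ 4 * s ^+ 4 <= (100 * 100) ^+ 4 * (s ^+ 4 * n `^ eps) by apply: ler_pM.
rewrite s48 -mulrA -mulrA ler_pM2l //.
have -> : (100 * 100) ^+ 4 * (H * (s ^+ 4 * n `^ eps)) = H * ((100 * 100) ^+ 4 * (s ^+ 4 * n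
    `^ eps)).
  by move: ((100 * 100) ^+ 4) (s ^+ 4) => u v; ring.
by rewrite ler_pM2l.
Qed.
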